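(* Let $H$ be a separable Hilbert space, let $G=(g_n)_{n=1}^\infty$ be a Riesz basis for $H$, let $E=(e_n)_{n=1}^\infty$ be a frame for $H$, and let $\mu$ be a weight with $\mu(n)\ge1$ for every $n\in\mathbb N$. Assume that one of the following holds: (A) $E$ is $\beta$-sub-exponentially localized with respect to $G$ for some $\beta\in(0,1)$, and $\mu$ is a $\beta_\mu$-sub-exponential weight with $\beta_\mu<\beta$; (B) $E$ is exponentially localized with respect to $G$, and $\mu$ is a $\beta_\mu$-sub-exponential weight ($\beta_\mu\in(0,1)$); (C) $E$ is $(k+1+\varepsilon)$-localized with respect to $G$ for some $\varepsilon>0$, and $\mu$ is a $k$-moderate weight ($k\ge 0$). Then for every $p\in[1,\infty)$ the following statements hold. (i) The analysis operator $U_E:f\mapsto(\langle f,e_n\rangle)_{n=1}^\infty$ maps $H_G^{\ell^p_\mu}$ boundedly into $\ell^p_\mu$. (ii) The synthesis operator $T_E:(c_n)_{n=1}^\infty\mapsto\sum_{n=1}^\infty c_ne_n$ maps $\ell^p_\mu$ boundedly into $H_G^{\ell^p_\mu}$. (iii) The frame operator $S_E=T_EU_E$ is invertible on $H_G^{\ell^p_\mu}$ (i.e. a bounded bijection of this space onto itself), and the series in $S_Ef=\sum_{n=1}^\infty\langle f,e_n\rangle e_n$ converges unconditionally (in $H_G^{\ell^p_\mu}$, for $f\in H_G^{\ell^p_\mu}$). (iv) The canonical dual frame $(\widetilde{e_n})_{n=1}^\infty$ of $E$ has the same type of localization as $E$: with respect to $G$ it is $\beta$-sub-exponentially localized in case (A),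 exponentially localized in case (B), and $(k+1+\varepsilon)$-localized in case (C). (v) The frame expansions $f=\sum_{n=1}^\infty\langle f,e_n\rangle\widetilde{e_n}=\sum_{n=1}^\infty\langle f,\widetilde{e_n}\rangle e_n$ hold, for $f\in H_G^{\ell^p_\mu}$, with unconditional convergence in $H_G^{\ell^p_\mu}$. (vi) The norms $\|f\|_{H_G^{\ell^p_\mu}}$, $\|(\langle f,e_n\rangle)_{n=1}^\infty\|_{\ell^p_\mu}$ and $\|(\langle f,\widetilde{e_n}\rangle)_{n=1}^\infty\|_{\ell^p_\mu}$ are equivalent on $H_G^{\ell^p_\mu}$.
   Context: $\mathbb N=\{1,2,\dots\}$. A frame for $H$ is a sequence $(e_n)$ in $H$ with $A\|f\|^2\le\sum_n|\langle f,e_n\rangle|^2\le B\|f\|^2$ for all $f\in H$ and some $A,B>0$; its canonical dual is $\widetilde{e_n}=S^{-1}e_n$, where $Sf=\sum_n\langle f,e_n\rangle e_n$ is the (invertible) frame operator on $H$. A Riesz basis is the image of an orthonormal basis under a bounded bijective operator on $H$; $(\widetilde{g_n})$ denotes its canonical dual (the unique biorthogonal sequence). Localization of the frame $E$ with respect to the Riesz basis $G$: $E$ is $\gamma$-localized (polynomially, $\gamma>0$) if there is $C>0$ with $\max\{|\langle e_m,g_n\rangle|,|\langle e_m,\widetilde{g_n}\rangle|\}\le C(1+|m-n|)^{-\gamma}$ for all $m,n\in\mathbb N$; exponentially localized if for some $\gamma>0$ there is $C>0$ with $\max\{|\langle e_m,g_n\rangle|,|\langle e_m,\widetilde{g_n}\rangle|\}\le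 Ce^{-\gamma|m-n|}$ for all $m,n$; $\beta$-sub-exponentially localized ($\beta\in(0,1)$) if for some $\gamma>0$ there is $C>0$ with $\max\{|\langle e_m,g_n\rangle|,|\langle e_m,\widetilde{g_n}\rangle|\}\le Ce^{-\gamma|m-n|^\beta}$ for all $m,n$. Weights: a positive continuous function $\mu$ on $\mathbb R$ is $k$-moderate ($k\ge0$) if there is $C>0$ with $\mu(t+x)\le C(1+|t|)^k\mu(x)$ for all $t,x\in\mathbb R$; it is $\beta$-sub-exponential ($\beta\in(0,1)$) if there are $C,\gamma>0$ with $\mu(t+x)\le Ce^{\gamma|t|^\beta}\mu(x)$ for all $t,x\in\mathbb R$. $\ell^p_\mu$ is the Banach space of complex sequences $(a_n)_{n=1}^\infty$ with norm $(\sum_{n=1}^\infty|a_n|^p\mu(n)^p)^{1/p}<\infty$. $H_G^{\ell^p_\mu}$ is the space of all $f\in H$ with $(\langle f,\widetilde{g_n}\rangle)_{n=1}^\infty\in\ell^p_\mu$, with norm $\|f\|_{H_G^{\ell^p_\mu}}=\|(\langle f,\widetilde{g_n}\rangle)_{n=1}^\infty\|_{\ell^p_\mu}$.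
   Formalization: Item (ii) fails as written when ℓ^p_μ is not contained in ℓ² (E=G orthonormal, μ=1, p=4, c_n=n^{-1/2}); it is proved for c in ℓ^p_μ∩ℓ² on H_G^{ℓ^p_μ}, and for all c in ℓ^p_μ on the completion of H_G^{ℓ^p_μ}, where (i), (iii), (v), (vi) are proved as well. *)

(* Defs.v *)
From HB Require Import structures.
From mathcomp Require Import all_boot all_order all_algebra sesquilinear.
From mathcomp Require Import all_classical all_reals all_analysis.
From mathcomp Require Import complex.
Set Implicit Arguments.
Unset Strict Implicit.
Unset Printing Implicit Defensive.
Import Order.TTheory GRing.Theory Num.Theory.
Import numFieldNormedType.Exports.
Local Open Scope classical_set_scope.
Local Open Scope ring_scope.

(* Conventions.
   - A complex Hilbert space is a complete normed module H over R[i] together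
     with dot : {dot H for Num.conj} (linear in its first argument) such that
     `|x| ^+ 2 = dot x x.
   - A sequence (v_n) indexed by {1, 2, ...} is a function v : nat -> T, where
     v n stands for v_(n + 1). *)

Section RealNorm.
Context {R : realType}.

(* On a space over R[i] the library norm takes its values in R[i], where it is
   always a nonnegative real; [rnorm] is that real number. *)
Definition rnorm {V : normedZmodType R[i]} (x : V) : R := complex.Re `|x|.

Definition separable_space (T : topologicalType) : Prop :=
  exists2 S : set T, countable S & dense S.

End RealNorm.

Section HilbertSequences.
Context {R : realType} {H : completeNormedModType R[i]}.
Variable dot : {dot H for Num.conj}.

Definition orthonormal_basis (o : nat -> H) : Prop :=
  (forall m n, dot (o m) (o n) = (m == n)%:R) /\
  (forall f, series (fun n => dot f (o n) *: o n) @ \oo --> f).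

Definition riesz_basis (g : nat -> H) : Prop :=
  exists (o : nat -> H) (T : {linear H -> H}),
    [/\ orthonormal_basis o,
        exists M : R, forall x, rnorm (T x) <= M * rnorm x,
        bijective T &
        forall n, g n = T (o n)].

Definition frame (e : nat -> H) : Prop :=
  exists A B : R, [/\ 0 < A, 0 < B &
    forall f : H,
      ((A * rnorm f ^+ 2)%:E
         <= \sum_(0 <= n <oo) (rnorm (dot f (e n)) ^+ 2)%:E)%E /\
      (\sum_(0 <= n <oo) (rnorm (dot f (e n)) ^+ 2)%:E
         <= (B * rnorm f ^+ 2)%:E)%E].

Definition analysis (e : nat -> H) (f : H) : nat -> R[i] :=
  fun n => dot f (e n).

End HilbertSequences.

Definition synthesis {R : realType} {V : normedModType R[i]}
  (e : nat -> V) (c : nat -> R[i]) : V := limn (series (fun n => c n *: e n)).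

Section CanonicalDual.
Context {R : realType} {H : completeNormedModType R[i]}.
Variable dot : {dot H for Num.conj}.

Definition frame_operator (e : nat -> H) (f : H) : H :=
  synthesis e (analysis dot e f).

(* S^-1 (e n), where S is the frame operator of e; S is bijective when e is a
   frame, so that the set below is then a singleton. A Riesz basis is a frame,
   and its canonical dual is its unique biorthogonal sequence. *)
Definition canonical_dual (e : nat -> H) (n : nat) : H :=
  xget 0 [set x | frame_operator e x = e n].

Definition localized_by (w : R -> R) (e g : nat -> H) : Prop :=
  exists2 C : R, 0 < C & forall m n : nat,
    Num.max (rnorm (dot (e m) (g n))) (rnorm (dot (e m) (canonical_dual g n)))
      <= C * w `|m%:R - n%:R|.

Definition poly_localized (gamma : R) (e g : nat -> H) : Prop :=
  localized_by (fun t => (1 + t) `^ (- gamma)) e g.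

Definition exp_localized (e g : nat -> H) : Prop :=
  exists2 gamma : R, 0 < gamma &
    localized_by (fun t => expR (- gamma * t)) e g.

Definition subexp_localized (beta : R) (e g : nat -> H) : Prop :=
  exists2 gamma : R, 0 < gamma &
    localized_by (fun t => expR (- gamma * t `^ beta)) e g.

End CanonicalDual.

Section Weights.
Context {R : realType}.

Definition weight (mu : R -> R) : Prop :=
  (forall x, 0 < mu x) /\ continuous mu.

Definition moderate (k : R) (mu : R -> R) : Prop :=
  weight mu /\ exists2 C : R, 0 < C &
    forall t x, mu (t + x) <= C * (1 + `|t|) `^ k * mu x.

Definition subexp_weight (beta : R) (mu : R -> R) : Prop :=
  weight mu /\ exists C gamma : R, [/\ 0 < C, 0 < gamma &
    forall t x, mu (t + x) <= C * expR (gamma * `|t| `^ beta) * mu x].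

End Weights.

Section SequenceSpaces.
Context {R : realType}.

(* The value is +oo outside of the space l^p_mu. *)
Definition lp_norm (p : R) (mu : R -> R) (a : nat -> R[i]) : \bar R :=
  ((\sum_(0 <= n <oo) (rnorm (a n) `^ p * mu n.+1%:R `^ p)%:E) `^ p^-1)%E.

Definition lp_space (p : R) (mu : R -> R) : set (nat -> R[i]) :=
  [set a | (lp_norm p mu a < +oo)%E].

End SequenceSpaces.

Section Cases.
Context {R : realType} {H : completeNormedModType R[i]}.
Variables (dot : {dot H for Num.conj}) (e g : nat -> H) (mu : R -> R).

Definition subexp_case (beta : R) : Prop :=
  [/\ 0 < beta < 1, subexp_localized dot beta e g &
      exists beta_mu : R, [/\ 0 < beta_mu < 1, beta_mu < beta &
        subexp_weight beta_mu mu]].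

Definition exp_case : Prop :=
  exp_localized dot e g /\
  exists2 beta_mu : R, 0 < beta_mu < 1 & subexp_weight beta_mu mu.

Definition poly_case (k eps : R) : Prop :=
  [/\ 0 <= k, 0 < eps, poly_localized dot (k + 1 + eps) e g & moderate k mu].

End Cases.

(* H_G^{l^p_mu}: the norm is +oo outside of the space. *)
Section AssociatedSpace.
Context {R : realType} {H : completeNormedModType R[i]}.
Variables (dot : {dot H for Num.conj}) (g : nat -> H) (p : R) (mu : R -> R).

Definition HG_norm (f : H) : \bar R :=
  lp_norm p mu (analysis dot (canonical_dual dot g) f).

Definition HG : set H := [set f | (HG_norm f < +oo)%E].

(* X is a Banach space completion of the normed space (HG, HG_norm), by means
   of iota (whose values outside of HG are irrelevant). *)
Definition HG_completion (X : completeNormedModType R[i]) (iota : H -> X) :=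
  [/\ forall (a : R[i]) (f h : H), HG f -> HG h ->
        iota (a *: f + h) = a *: iota f + iota h,
      forall f, HG f -> (rnorm (iota f))%:E = HG_norm f &
      dense (iota @` HG)].

End AssociatedSpace.

(* Statements about a normed space E = {x in V | N x < +oo} with norm N. The
   ambient space V gives a meaning to infinite sums. They are used with E = HG
   in V = H, and with E = V a completion of HG. The synthesis operator of e is
   [synthesis e]; U and Ud are analysis operators. *)
Section Items.
Context {R : realType} {V : normedModType R[i]}.
Variables (N : V -> \bar R) (p : R) (mu : R -> R).
Implicit Types (U : V -> nat -> R[i]) (e d : nat -> V).

Definition N_cvg (u : nat -> V) (x : V) : Prop :=
  (fun k => N (u k - x)) @ \oo --> 0%E.

Definition unconditional_sum (v : nat -> V) (x : V) : Prop :=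
  forall s : nat -> nat, bijective s -> N_cvg (series (v \o s)) x.

Definition analysis_bounded U : Prop :=
  exists M : R, forall x, (N x < +oo)%E ->
    lp_space p mu (U x) /\ (lp_norm p mu (U x) <= M%:E * N x)%E.

Definition synthesis_bounded (dom : set (nat -> R[i])) e : Prop :=
  exists M : R, forall c, dom c ->
    [/\ cvgn (series (fun n => c n *: e n)),
        N_cvg (series (fun n => c n *: e n)) (synthesis e c),
        (N (synthesis e c) < +oo)%E &
        (N (synthesis e c) <= M%:E * lp_norm p mu c)%E].

Definition frame_operator_invertible U e : Prop :=
  let S x := synthesis e (U x) in
  let E := [set x | (N x < +oo)%E] in
  [/\ set_bij E E S,
      exists M : R, forall x, E x -> (N (S x) <= M%:E * N x)%E,
      exists M : R, forall x, E x -> (N x <= M%:E * N (S x))%E &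
      forall x, E x -> unconditional_sum (fun n => U x n *: e n) (S x)].

Definition frame_expansions U Ud e d : Prop :=
  forall x, (N x < +oo)%E ->
    unconditional_sum (fun n => U x n *: d n) x /\
    unconditional_sum (fun n => Ud x n *: e n) x.

Definition norm_equivalence U : Prop :=
  exists A B : R, [/\ 0 < A, 0 < B & forall x, (N x < +oo)%E ->
    (A%:E * N x <= lp_norm p mu (U x))%E /\
    (lp_norm p mu (U x) <= B%:E * N x)%E].

End Items.

(* U extends the analysis operator of e from HG to a linear map on the
   completion X of HG; boundedness, which makes U unique, is part of the
   conclusions about U. *)
Definition analysis_extension {R : realType} {H : completeNormedModType R[i]}
    (dot : {dot H for Num.conj}) (g : nat -> H) (p : R) (mu : R -> R)
    (X : completeNormedModType R[i]) (iota : H -> X)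
    (e : nat -> H) (U : X -> nat -> R[i]) : Prop :=
  (forall (a : R[i]) x y n, U (a *: x + y) n = a * U x n + U y n) /\
  (forall f, HG dot g p mu f -> U (iota f) = analysis dot e f).

(* Main.v *)
(** Let S be the frame operator of E, B an upper frame bound and Q = 1 - S/B.
   Since |Sf|^2 <= B <Sf,f>, the frame bounds give |Q| <= r < 1, hence
   S^-1 = B^-1 sum_j Q^j. In the coordinates given by G the matrix of Q inherits
   the off-diagonal decay of E. The entries of the matrix of Q^j are O(r^j), and
   they also decay off the diagonal with a constant growing at most
   exponentially in j. For (sub)exponential decay, interpolating between these
   two bounds gives O(rho^j w) with rho < 1 and a slower weight w of the same
   type. For polynomial decay the exponent must not change; there Brandenburg's
   trick, applied to Q^(2^i), produces a power Q^J that is small in the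
   submultiplicative decay norm, and again the j-th power is O(rho^j w). Thus
   the matrix of S^-1 has the decay of E, and so does the dual frame.

   By the Schur test the matrices of the analysis and synthesis operators of E
   and of its dual are then bounded on l^p_mu. The identities S^-1 S = S S^-1 = 1
   and the frame expansions, which hold on H, pass to l^p_mu because they only
   need to be checked on unit sequences. Finally HG is identified with the
   coordinate sequences in l^p_mu and l^2, and its completion with l^p_mu. *)

Require Import Defs.
From HB Require Import structures.
From mathcomp Require Import all_boot all_order all_algebra sesquilinear.
From mathcomp Require Import all_classical all_reals all_analysis.
From mathcomp Require Import complex.
From mathcomp Require Import zify ring lra.
Set Implicit Arguments.
Unset Strict Implicit.
Unset Printing Implicit Defensive.
Import Order.TTheory GRing.Theory Num.Theory.
Import numFieldNormedType.Exports.
Local Open Scope classical_set_scope.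
Local Open Scope ring_scope.

(** * Off-diagonal decay of matrices *)

(** The three cases differ only in the class of decaying matrices, so the argument is written once
    over the interface [decay_algebra]. Its one hard field is [decay_powers], a quantitative form of
    inverse-closedness. For polynomial decay, plain interpolation would lower the exponent, while
    submultiplicativity alone gives constants that may grow with the power; hence the separate
    argument there. Only absolute values of matrix entries matter, and products of infinite matrices
    are never formed: a bound on all partial sums stands for the value of a series. Two obstacles
    shape the rest. The bijection that defines a Riesz basis is bounded, but the boundedness of its
    inverse is not part of the definition; the lower frame bound of G therefore rests on uniform
    boundedness. And a sequence of l^p_mu need not be square summable, so HG may fail to be
    complete; the conclusions are therefore proved in abstract coordinates and instantiated twice,
    in H and in a completion. *)

Section OffDiagonalDecay.
Context {R : realType}.
Implicit Types (A B M : nat -> nat -> R) (f : nat -> R).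

(** For nonnegative [f] this bounds the sum of the series by [D], with neither limits nor extended
    reals. *)
Definition sums_le f (D : R) := forall L : nat, \sum_(0 <= k < L) f k <= D.

(* [M] is entrywise at most the product of [A] and [B]; no entry of that
   product is required to be finite. *)
Definition comp_le A B M :=
  forall m n D, sums_le (fun k => A m k * B k n) D -> M m n <= D.

Definition gap (m n : nat) : R := `|m%:R - n%:R|.

Lemma gap_ge0 m n : 0 <= gap m n. Proof. exact: normr_ge0. Qed.

Lemma gapC m n : gap m n = gap n m. Proof. exact: distrC. Qed.

Lemma gapnn m : gap m m = 0. Proof. by rewrite /gap subrr normr0. Qed.

Lemma gap_triangle k m n : gap m n <= gap m k + gap k n.
Proof. exact: ler_distD. Qed.

Lemma gap_nat m n : gap m n = ((m - n) + (n - m))%N%:R.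
Proof.
rewrite /gap; have [mn|nm] := leqP m n.
  rewrite distrC (_ : (_ + _)%N = (n - m)%N); last by lia.
  by rewrite natrB // ger0_norm// subr_ge0 ler_nat.
rewrite (_ : (_ + _)%N = (m - n)%N); last by lia.
by rewrite natrB ?(ltnW nm)// ger0_norm// subr_ge0 ler_nat ltnW.
Qed.

Lemma sums_le_mono f g D : (forall k, f k <= g k) -> sums_le g D -> sums_le f D.
Proof. by move=> fg h L; apply: le_trans (h L); apply: ler_sum_nat. Qed.

Lemma sums_leZ f a D : 0 <= a -> sums_le f D -> sums_le (fun k => a * f k) (a * D).
Proof. by move=> a0 h L; rewrite -mulr_sumr ler_wpM2l. Qed.

Lemma sums_leD f g D E : sums_le f D -> sums_le g E ->
  sums_le (fun k => f k + g k) (D + E).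
Proof. by move=> hf hg L; rewrite big_split lerD. Qed.

Lemma sums_le_ge0 f D : sums_le f D -> 0 <= D.
Proof. by move/(_ 0%N); rewrite big_geq. Qed.

(** Each distance to [m] is attained at most twice, once on either side of [m]. *)
Lemma sums_le_gap f D : (forall k, 0 <= f k) -> sums_le f D ->
  forall m, sums_le (fun k => f ((m - k) + (k - m))%N) (D + D).
Proof.
move=> f0 fD m L.
apply: (@le_trans _ _ (\sum_(0 <= k < m + L) f ((m - k) + (k - m))%N)).
  rewrite [leRHS](@big_cat_nat _ _ _ L) ?leq_addl//= lerDl.
  by apply: sumr_ge0.
rewrite (@big_cat_nat _ _ _ m) ?leq_addr//=; apply: lerD.
  (* Read backwards, the indices below [m] have distances 1, ..., m; adding the term [f 0] completes
     an initial segment. *)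
  rewrite big_nat_rev/=.
  apply: le_trans (fD m.+1); rewrite big_nat_recl//= -[leLHS]add0r lerD//.
  apply: ler_sum_nat => k km; rewrite le_eqVlt; apply/orP; left; apply/eqP.
  congr f; lia.
rewrite -{1}(add0n m) big_addn addKn.
apply: le_trans (fD L); apply: ler_sum_nat => k _.
by rewrite (_ : (_ + _)%N = k)//; lia.
Qed.

Definition wpoly (s t : R) : R := (1 + t) `^ (- s).

Definition wexp (b c t : R) : R := expR (- c * t `^ b).

Lemma wpoly_gt0 s t : 0 <= t -> 0 < wpoly s t.
Proof. by move=> t0; apply: powR_gt0; lra. Qed.

(** The right-hand side is the integral of [t^(-s)] over [[x - 1, x]]. After division by [x^(1 - s)]
    the claim becomes Bernoulli's inequality [(1 - 1/x)^(1 - s) >= 1 + (s - 1)/x], a consequence of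
    [exp y >= 1 + y] and [ln (1 + y) <= y]. *)
Lemma wpoly_telescope (s x : R) : 1 < s -> 1 < x ->
  x `^ (- s) <= ((x - 1) `^ (1 - s) - x `^ (1 - s)) / (s - 1).
Proof.
move=> s1 x1; rewrite ler_pdivlMr; last lra.
have x0 : 0 < x by lra.
have xs : x `^ (- s) = x `^ (1 - s) / x.
  rewrite -[in RHS](powR_inv1 (ltW x0)) -powRD; last by rewrite (gt_eqF x0) implybT.
  by congr powR; lra.
have y0 : 0 < 1 - x^-1 by rewrite subr_gt0 invf_lt1.
have -> : x - 1 = x * (1 - x^-1) by rewrite mulrBr mulfV ?gt_eqF// mulr1.
rewrite powRM ?(ltW x0) ?(ltW y0)// xs.
rewrite -[X in _ <= _ - X]mulr1 -mulrBr -mulrA.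
rewrite ler_wpM2l ?powR_ge0// lerBrDl.
have -> : (1 - x^-1) `^ (1 - s) = expR ((1 - s) * ln (1 - x^-1)).
  by rewrite -ln_powR lnK// posrE powR_gt0.
apply: le_trans (expR_ge1Dx _).
have : ln (1 - x^-1) <= - x^-1 by apply: le_ln1Dx; rewrite ltrN2 invf_lt1.
by nra.
Qed.

Lemma wpoly_summable (s : R) : 1 < s ->
  exists2 D, 0 < D & forall m, sums_le (fun k => wpoly s (gap m k)) D.
Proof.
(* The term at distance 0 is 1; the others telescope to at most [1/(s - 1)]. *)
move=> s1; pose D := 1 + (s - 1)^-1.
have s10 : 0 < s - 1 by lra.
have D0 : 0 < D by rewrite addr_gt0// invr_gt0.
have h : sums_le (fun k => wpoly s k%:R) D.
  move=> L; apply: (@le_trans _ _ (\sum_(0 <= k < L.+1) wpoly s k%:R)).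
    by rewrite big_nat_recr//= lerDl ltW// wpoly_gt0.
  rewrite big_nat_recl//= {1}/wpoly addr0 powR1 /D lerD2l.
  apply: (@le_trans _ _ ((1 - (1 + L%:R) `^ (1 - s)) / (s - 1))); last first.
    rewrite -[X in _ <= X]div1r; apply: ler_wpM2r; first by rewrite invr_ge0 ltW.
    by rewrite gerBl powR_ge0.
  elim: L => [|L ih]; first by rewrite big_geq// addr0 powR1 subrr mul0r.
  rewrite big_nat_recr//=.
  have := @wpoly_telescope s (1 + L.+1%:R) s1; rewrite /wpoly.
  have L0 : 0 <= L%:R :> R by [].
  have -> : 1 + L.+1%:R - 1 = 1 + L%:R :> R by rewrite -natr1; lra.
  have x1 : 1 < 1 + L.+1%:R :> R by rewrite -natr1; lra.
  move=> /(_ x1).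
  move: ih; rewrite !mulrBl /wpoly; lra.
exists (D + D); first exact: addr_gt0.
move=> m; have := @sums_le_gap (fun k => wpoly s k%:R) D _ h m.
move=> H L; under eq_bigr do rewrite gap_nat; apply: H => k.
by rewrite ltW// wpoly_gt0.
Qed.

End OffDiagonalDecay.

Section DecayAlgebras.
Context {R : realType}.
Implicit Types (A B M X : nat -> nat -> R).

(** A fraction [q] in [0, 1] satisfies [q <= q^b]; apply this to [x/(x + y)] and [y/(x + y)], which
    add up to 1. *)
Lemma powR_subadditive (b x y : R) : 0 <= b <= 1 -> 0 <= x -> 0 <= y ->
  (x + y) `^ b <= x `^ b + y `^ b.
Proof.
move=> /andP[b0 b1] x0 y0.
have [s0|s0] := leP (x + y) 0.
  have -> : x = 0 by lra.
  have -> : y = 0 by lra.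
  by rewrite addr0 lerDl powR_ge0.
have frac z : 0 <= z -> z <= x + y -> z / (x + y) * (x + y) `^ b <= z `^ b.
  rewrite le_eqVlt => /predU1P[<-|z0] zs; first by rewrite !mul0r powR_ge0.
  have q0 : 0 < z / (x + y) by rewrite divr_gt0.
  have q1 : z / (x + y) <= 1 by rewrite ler_pdivrMr// mul1r.
  rewrite -[in leRHS](divfK (lt0r_neq0 s0) z) powRM ?(ltW q0) ?(ltW s0)//.
  by rewrite ler_wpM2r ?powR_ge0// ger1_powR ?q0.
rewrite -[leLHS]mul1r -[X in X * _](divff (lt0r_neq0 s0)) 2!mulrDl.
by apply: lerD; apply: frac => //; lra.
Qed.

(** The two sides cross at [T], where [d T^a = c T^b]: beyond [T] the higher power wins, and below
    [T] the constant [d T^a] suffices. *)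
Lemma powR_absorb (a b c d : R) : 0 < a < b -> 0 < c -> 0 <= d ->
  exists C, forall t, 0 <= t -> d * t `^ a <= c * t `^ b + C.
Proof.
move=> /andP[a0 ab] c0 d0; pose T := (d / c) `^ (b - a)^-1.
exists (d * T `^ a) => t t0; have [tT|tT] := leP t T.
  rewrite -[leLHS]add0r lerD ?mulr_ge0 ?powR_ge0 ?(ltW c0)// ler_wpM2l//.
  by apply: ge0_ler_powR; rewrite ?nnegrE ?powR_ge0// ltW.
rewrite -[leLHS]addr0 lerD ?mulr_ge0 ?powR_ge0//.
rewrite (_ : b = (b - a) + a); last by rewrite subrK.
rewrite powRD; last by rewrite subrK gt_eqF ?(lt_trans a0).
rewrite mulrA ler_wpM2r ?powR_ge0// mulrC -ler_pdivrMr//.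
have ba0 : 0 < b - a by lra.
have -> : d / c = T `^ (b - a).
  by rewrite -powRrM mulVf ?gt_eqF// powRr1// divr_ge0// ltW.
by apply: ge0_ler_powR; rewrite ?nnegrE ?powR_ge0// ltW.
Qed.

Lemma ln1D_absorb (b c s : R) : 0 < b <= 1 -> 0 < c -> 0 <= s ->
  exists C, forall t, 0 <= t -> s * ln (1 + t) <= c * t `^ b + C.
Proof.
(* By [ln y < y] at [y = (1 + t)^a], the logarithm is at most [(1 + t^a)/a]; taking [a] strictly
   below [b] leaves room for [powR_absorb]. *)
move=> /andP[b0 b1] c0 s0; pose a := b / 2.
have a0 : 0 < a by rewrite /a; lra.
have [||C CP] := @powR_absorb a b c (s / a) _ c0 _.
- by rewrite a0/= /a; lra.
- by rewrite divr_ge0// ltW.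
exists (s / a + C) => t t0; rewrite addrCA.
apply: le_trans (_ : s / a + s / a * t `^ a <= _); last by rewrite lerD2l CP.
have -> : s / a + s / a * t `^ a = s * ((1 + t `^ a) / a) by field; lra.
rewrite ler_wpM2l// ler_pdivlMr// mulrC -ln_powR.
apply: le_trans (ltW (ln_sublinear _)) _; first by apply: powR_gt0; lra.
have := @powR_subadditive a 1 t; rewrite powR1; apply => //.
by apply/andP; split; rewrite /a; lra.
Qed.

(** (Sub)exponential decay beats every power, so summability questions for [wexp] reduce to
    [wpoly]. *)
Lemma wexp_wpoly (b c s : R) : 0 < b <= 1 -> 0 < c -> 0 <= s ->
  exists2 C, 0 < C & forall t, 0 <= t -> wexp b c t <= C * wpoly s t.
Proof.
move=> b01 c0 s0; have [C CP] := ln1D_absorb b01 c0 s0.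
exists (expR C); first exact: expR_gt0.
move=> t t0; rewrite /wexp /wpoly -[(1 + t) `^ _]lnK ?posrE; last by apply: powR_gt0; lra.
by rewrite ln_powR -expRD ler_expR !mulNr; have := CP t t0; lra.
Qed.

Definition dominated_by (w : R -> R) M :=
  exists C : R, forall m n, M m n <= C * w (gap m n).

(** Subconvolutivity, with three weights because [wexp] keeps its rate under products only against a
    factor of strictly larger rate. *)
Definition conv_le (w1 w2 w : R -> R) (D : R) :=
  forall m n, sums_le (fun k => w1 (gap m k) * w2 (gap k n)) (D * w (gap m n)).

Lemma comp_dominated w1 w2 w D a b A B M :
  conv_le w1 w2 w D -> 0 <= a -> 0 <= b ->
  (forall m n, 0 <= A m n <= a * w1 (gap m n)) ->
  (forall m n, 0 <= B m n <= b * w2 (gap m n)) ->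
  comp_le A B M -> forall m n, M m n <= a * b * D * w (gap m n).
Proof.
move=> cD a0 b0 hA hB cM m n; apply: cM => L.
apply: le_trans (_ : a * b * \sum_(0 <= k < L) w1 (gap m k) * w2 (gap k n) <= _).
  rewrite mulr_sumr; apply: ler_sum_nat => k _.
  have /andP[A0 Aa] := hA m k; have /andP[B0 Bb] := hB k n.
  by rewrite mulrACA ler_pM.
by rewrite -[leRHS]mulrA ler_wpM2l ?mulr_ge0//; exact: cD.
Qed.

Lemma dominated_gt0 w M : (forall t, 0 <= t -> 0 <= w t) -> dominated_by w M ->
  exists2 C, 0 < C & forall m n, M m n <= C * w (gap m n).
Proof.
move=> w0 [C CP]; exists (Num.max C 1); first by rewrite lt_max ltr01 orbT.
move=> m n; apply: le_trans (CP m n) _.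
by rewrite ler_wpM2r ?w0 ?gap_ge0// le_max lexx.
Qed.

(* The triangle inequality forces |m-k| or |k-n| to be at least |m-n|/2. *)
Lemma wpoly_split (s : R) m k n : 0 <= s ->
  Num.min (wpoly s (gap m k)) (wpoly s (gap k n)) <= 2 `^ s * wpoly s (gap m n).
Proof.
move=> s0; set x := gap m k; set y := gap k n; set z := gap m n.
have xyz : z <= x + y by exact: gap_triangle.
have [x0 y0 z0] : [/\ 0 <= x, 0 <= y & 0 <= z] by split; exact: gap_ge0.
have half u : 0 <= u -> z <= 2 * u -> wpoly s u <= 2 `^ s * wpoly s z.
  move=> u0 zu; rewrite /wpoly !powRN ler_pdivlMr; last by apply: powR_gt0; lra.
  rewrite mulrC ler_pdivrMr; last by apply: powR_gt0; lra.
  rewrite -powRM; [|lra..].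
  by apply: ge0_ler_powR; rewrite ?nnegrE//; lra.
rewrite ge_min; have [xy|yx] := leP x y.
  by rewrite [X in _ || X]half ?orbT//; lra.
by rewrite half//; lra.
Qed.

(** The product of two weights is their minimum times their maximum. The minimum yields the decay in
    [|m - n|], and the maximum is at most the sum, which is summable in [k]. *)
Lemma wpoly_conv (s : R) : 1 < s ->
  exists2 D, 0 < D & conv_le (wpoly s) (wpoly s) (wpoly s) D.
Proof.
move=> s1; have [D D0 DP] := wpoly_summable s1.
have s0 : 0 <= s by lra.
exists (2 `^ s * (D + D)); first by rewrite mulr_gt0 ?powR_gt0// addr_gt0.
move=> m n L; rewrite mulrAC.
apply: le_trans (_ : 2 `^ s * wpoly s (gap m n) *
  \sum_(0 <= k < L) (wpoly s (gap m k) + wpoly s (gap n k)) <= _); last first.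
  rewrite ler_wpM2l ?mulr_ge0 ?powR_ge0//.
  exact: (sums_leD (DP m) (DP n)).
rewrite mulr_sumr; apply: ler_sum_nat => k _.
have := wpoly_split m k n s0.
have x0 := wpoly_gt0 s (gap_ge0 m k); have y0 := wpoly_gt0 s (gap_ge0 k n).
rewrite (gapC n k).
rewrite minElt; case: ifP => _; nra.
Qed.

(** By the triangle inequality and subadditivity of [t^b], the rate [c] is spent on passing from [m]
    to [n]; the surplus [d - c] on the second factor makes the sum over [k] finite. *)
Lemma wexp_conv (b c d : R) : 0 < b <= 1 -> c < d -> 0 <= c ->
  exists2 D, 0 < D & conv_le (wexp b c) (wexp b d) (wexp b c) D.
Proof.
move=> b01 cd c0; have dc0 : 0 < d - c by lra.
have [C C0 CP] := wexp_wpoly b01 dc0 (ler0n R 2).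
have [D D0 DP] := @wpoly_summable R 2 (ltr1n R 2).
exists (C * D); first exact: mulr_gt0.
move=> m n L.
apply: le_trans (_ : C * wexp b c (gap m n) *
  \sum_(0 <= k < L) wpoly 2 (gap n k) <= _); last first.
  by rewrite [leRHS]mulrAC ler_wpM2l ?mulr_ge0 ?expR_ge0 ?(ltW C0)//; exact: DP.
rewrite mulr_sumr; apply: ler_sum_nat => k _.
rewrite (gapC n k) -mulrA mulrCA.
apply: le_trans (_ : wexp b c (gap m n) * wexp b (d - c) (gap k n) <= _).
  rewrite /wexp -!expRD ler_expR.
  have := @powR_subadditive b (gap m k) (gap k n).
  have /andP[b0 b1] := b01; rewrite (ltW b0) b1 => /(_ isT (gap_ge0 _ _) (gap_ge0 _ _)).
  have : gap m n `^ b <= (gap m k + gap k n) `^ b.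
    apply: ge0_ler_powR; rewrite ?nnegrE ?gap_ge0 ?addr_ge0 ?gap_ge0 ?(ltW b0)//.
    exact: gap_triangle.
  nra.
by rewrite ler_wpM2l ?expR_ge0//; apply: CP; exact: gap_ge0.
Qed.

(* The matrices [q j] play the role of the absolute values of the entries of
   the powers of an operator of norm at most [r]. *)
Definition power_family (q : nat -> nat -> nat -> R) (K r : R) :=
  [/\ forall j m n, 0 <= q j m n <= K * r ^+ j,
      forall i j, comp_le (q i) (q j) (q (i + j)%N) &
      forall m n, q 0%N m n = (m == n)%:R * q 0%N m n].

(** [dec] is a bare predicate rather than a norm, so a class may let its rates worsen. The last
    field is what makes Neumann series converge inside the class: a geometric bound on operator
    norms improves to a geometric bound with one fixed off-diagonal profile [X]. *)
Record decay_algebra (dec : (nat -> nat -> R) -> Prop) : Prop := {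
  decay_le : forall A B, (forall m n, A m n <= B m n) -> dec B -> dec A;
  decay_diag : forall (C : R) A, (forall m n, A m n <= (m == n)%:R * C) -> dec A;
  decayD : forall A B, dec A -> dec B -> dec (fun m n => A m n + B m n);
  decayZ : forall (a : R) A, 0 <= a -> dec A -> dec (fun m n => a * A m n);
  decay_tr : forall A, dec A -> dec (fun m n => A n m);
  decay_comp : forall A B M, (forall m n, 0 <= A m n) -> (forall m n, 0 <= B m n) ->
    comp_le A B M -> dec A -> dec B -> dec M;
  decay_powers : forall q K r, 0 < r < 1 -> power_family q K r -> dec (q 1%N) ->
    exists rho X, [/\ 0 < rho < 1, dec X & forall j m n, q j m n <= rho ^+ j * X m n]
}.

Definition poly_decay (s : R) M := dominated_by (wpoly s) M.

(** The rate [c] is existential because products and interpolation lower it. Exponential decay is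
    the endpoint [b = 1]. *)
Definition exp_decay (b : R) M := exists2 c, 0 < c & dominated_by (wexp b c) M.

End DecayAlgebras.

(** * Exponential and sub-exponential decay *)

Section DecayInstances.
Context {R : realType}.
Implicit Types (A B M X : nat -> nat -> R).

Lemma interpolation (th x a b : R) : 0 <= th <= 1 -> 0 <= x -> x <= a -> x <= b ->
  x <= a `^ (1 - th) * b `^ th.
Proof.
move=> /andP[t0 t1] x0 xa xb.
have -> : x = x `^ (1 - th) * x `^ th.
  by rewrite -powRD ?subrK ?powRr1// oner_eq0.
apply: ler_pM; rewrite ?powR_ge0//; apply: ge0_ler_powR; rewrite ?nnegrE; lra.
Qed.

Section Dominated.
Variable w : R -> R.
Hypotheses (w0 : w 0 = 1) (w_gt0 : forall t, 0 <= t -> 0 < w t).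

Let w_ge0 t : 0 <= t -> 0 <= w t. Proof. by move=> /w_gt0/ltW. Qed.

Lemma dominated_diag C A : (forall m n, A m n <= (m == n)%:R * C) ->
  0 <= C -> forall m n, A m n <= C * w (gap m n).
Proof.
move=> AC C0 m n; apply: le_trans (AC m n) _; case: eqVneq => [->|_].
  by rewrite gapnn w0 mulr1 mul1r.
by rewrite mul0r mulr_ge0// w_ge0// gap_ge0.
Qed.

Lemma dominatedD A B : dominated_by w A -> dominated_by w B ->
  dominated_by w (fun m n => A m n + B m n).
Proof.
move=> [a ha] [b hb]; exists (a + b) => m n.
by rewrite mulrDl lerD.
Qed.

Lemma dominatedZ a A : 0 <= a -> dominated_by w A ->
  dominated_by w (fun m n => a * A m n).
Proof. by move=> a0 [b hb]; exists (a * b) => m n; rewrite -mulrA ler_wpM2l. Qed.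

Lemma dominated_tr A : dominated_by w A -> dominated_by w (fun m n => A n m).
Proof. by move=> [a ha]; exists a => m n; rewrite gapC. Qed.

Lemma dominated_le A B : (forall m n, A m n <= B m n) -> dominated_by w B ->
  dominated_by w A.
Proof. by move=> AB [b hb]; exists b => m n; apply: le_trans (AB m n) _. Qed.

End Dominated.

Lemma wpoly0 (s : R) : wpoly s 0 = 1. Proof. by rewrite /wpoly addr0 powR1. Qed.

Lemma wexp0 (b c : R) : b != 0 -> wexp b c 0 = 1.
Proof. by move=> b0; rewrite /wexp powR0// mulr0 expR0. Qed.

Lemma wexp_mono (b c d t : R) : c <= d -> wexp b d t <= wexp b c t.
Proof. by move=> cd; rewrite /wexp ler_expR ler_wpM2r ?powR_ge0// lerN2. Qed.

Lemma dominated_wexp (b c d : R) M : c <= d -> dominated_by (wexp b d) M ->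
  dominated_by (wexp b c) M.
Proof.
move=> cd h; have [|C C0 CP] := dominated_gt0 _ h.
  by move=> t _; exact: expR_ge0.
by exists C => m n; apply: le_trans (CP m n) _; rewrite ler_wpM2l ?(ltW C0) ?wexp_mono.
Qed.

Lemma power_family_ge0 q (K r : R) : power_family q K r -> 0 <= K.
Proof.
move=> [qK _ _]; have /andP[h1 h2] := qK 0%N 0%N 0%N.
by move: (le_trans h1 h2); rewrite expr0 mulr1.
Qed.

Lemma exp_decay_powers (b : R) q K r : 0 < b <= 1 -> 0 < r < 1 ->
  power_family q K r -> exp_decay b (q 1%N) ->
  exists rho X, [/\ 0 < rho < 1, exp_decay b X & forall j m n, q j m n <= rho ^+ j * X m n].
Proof.
move=> b01 /andP[r0 r1] qf [c c0 dq1]; have K0 := power_family_ge0 qf.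
have [qK qM qid] := qf.
have [|C C0 CP] := dominated_gt0 _ dq1; first by move=> t _; exact: expR_ge0.
(* Multiplying a matrix of rate [c'] by [q 1], of the larger rate [c], keeps the rate [c']; the
   powers thus share one rate and only their constants grow. *)
pose c' := c / 2.
have [||D D0 cD] := @wexp_conv R b c' c b01 _ _; [by rewrite /c'; lra..|].
have wb0 : wexp b c' 0 = 1 by apply: wexp0; rewrite gt_eqF//; lra.
have b0 : b != 0 by rewrite gt_eqF//; lra.
pose E := C * D + 1; have E1 : 1 < E by rewrite ltrDr mulr_gt0.
have E0 : 0 < E by lra.
have qE j m n : q j m n <= (K + 1) * E ^+ j * wexp b c' (gap m n).
  elim: j m n => [|j ih] m n.
    rewrite expr0 mulr1; apply: dominated_diag => //; last lra.
      by move=> t _; exact: expR_gt0.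
    move=> {}m {}n; rewrite qid ler_wpM2l//.
    by have /andP[_] := qK 0%N m n; rewrite expr0; lra.
  rewrite -addn1; apply: le_trans (_ : (K + 1) * E ^+ j * C * D * wexp b c' (gap m n) <= _).
  apply: (comp_dominated cD _ _ _ _ (qM j 1%N)).
  - by rewrite mulr_ge0 ?exprn_ge0//; lra.
  - lra.
  - by move=> {}m {}n; rewrite ih andbT; have /andP[] := qK j m n.
  - by move=> {}m {}n; rewrite CP andbT; have /andP[] := qK 1%N m n.
  rewrite addn1 exprSr -!mulrA; apply: ler_wpM2l; first by lra.
  apply: ler_wpM2l; first by rewrite exprn_ge0// ltW.
  rewrite !mulrA; apply: ler_wpM2r; first exact: expR_ge0.
  by rewrite /E; lra.
(* Chosen so that [(1 - th) ln r + th ln E = (ln r)/2]: the interpolated ratio [rho] is the square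
   root of [r]. *)
pose th := - ln r / (2 * (ln E - ln r)).
have lr0 : ln r < 0 by rewrite ln_lt0// r0.
have lE0 : 0 < ln E by exact: ln_gt0.
have dE0 : 0 < 2 * (ln E - ln r) by lra.
have th0 : 0 < th by rewrite divr_gt0// oppr_gt0.
have th1 : th < 1 by rewrite ltr_pdivrMr//; lra.
have thE : th * (ln E - ln r) = - ln r / 2 by rewrite /th; field; lra.
pose rho := r `^ (1 - th) * E `^ th.
have rho0 : 0 < rho by rewrite mulr_gt0 ?powR_gt0.
have rho1 : rho < 1.
  rewrite -ltr_ln ?posrE ?ltr01// ln1 lnM ?posrE ?powR_gt0// !ln_powR; lra.
exists rho, (fun m n => (K + 1) * wexp b (th * c') (gap m n)); split.
- by rewrite rho0.
- exists (th * c'); first by rewrite mulr_gt0// /c'; lra.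
  by exists (K + 1).
move=> j m n; have /andP[q0 qr] := qK j m n.
have qr' : q j m n <= (K + 1) * r ^+ j.
  by apply: le_trans qr _; rewrite ler_wpM2r ?exprn_ge0 ?(ltW r0)//; lra.
apply: le_trans (@interpolation th _ _ _ _ q0 qr' (qE j m n)) _; first by lra.
have K10 : 0 <= K + 1 by lra.
have [rj Ej] : 0 <= r ^+ j /\ 0 <= E ^+ j by rewrite !exprn_ge0//; lra.
rewrite -mulrA !powRM ?mulr_ge0 ?expR_ge0//.
have -> : wexp b c' (gap m n) `^ th = wexp b (th * c') (gap m n).
  by rewrite /wexp -expRM; congr expR; ring.
rewrite [leLHS](_ : _ = ((K + 1) `^ (1 - th) * (K + 1) `^ th) *
  ((r ^+ j) `^ (1 - th) * (E ^+ j) `^ th) * wexp b (th * c') (gap m n)); last by ring.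
rewrite -powRD; last by rewrite subrK oner_eq0.
rewrite subrK powRr1// -!(powR_mulrn _ (ltW r0)) -!(powR_mulrn _ (ltW E0)).
rewrite !(powRAC _ j%:R) -powRM ?powR_ge0// powR_mulrn; last exact: ltW.
by rewrite -/rho [leRHS]mulrCA mulrA.
Qed.

Lemma exp_decay_algebra (b : R) : 0 < b <= 1 -> decay_algebra (exp_decay b).
Proof.
move=> b01; have b0 : b != 0 by rewrite gt_eqF//; lra.
split.
- by move=> A B AB [c c0 h]; exists c => //; exact: dominated_le h.
- move=> C A AC; exists 1 => //; exists `|C|; apply: dominated_diag => //.
  + exact: wexp0.
  + by move=> t _; exact: expR_gt0.
  + by move=> m n; apply: le_trans (AC m n) _; rewrite ler_wpM2l// ler_norm.
- move=> A B [c c0 hA] [d d0 hB]; exists (Num.min c d); first by rewrite lt_min c0.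
  by apply: dominatedD; [apply: dominated_wexp hA|apply: dominated_wexp hB];
    rewrite ge_min lexx ?orbT.
- by move=> a A a0 [c c0 hA]; exists c => //; exact: dominatedZ.
- by move=> A [c c0 hA]; exists c => //; exact: dominated_tr.
- move=> A B M A0 B0 cM [c c0 hA] [d d0 hB].
  (* Halving makes [f] strictly smaller than the rate of the second factor, as [wexp_conv]
     requires. *)
  pose f := Num.min c d / 2.
  have m0 : 0 < Num.min c d by rewrite lt_min c0.
  have [fc fd] : f <= c /\ f < d.
    have : Num.min c d <= c by rewrite ge_min lexx.
    have : Num.min c d <= d by rewrite ge_min lexx orbT.
    by rewrite /f; lra.
  have f0 : 0 < f by rewrite divr_gt0.
  have [D D0 cD] := wexp_conv b01 fd (ltW f0).
  have [|a a0 ha] := dominated_gt0 _ (dominated_wexp fc hA).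
    by move=> t _; exact: expR_ge0.
  have [|e e0 he] := dominated_gt0 _ hB; first by move=> t _; exact: expR_ge0.
  exists f => //; exists (a * e * D) => m n.
  apply: (comp_dominated cD (ltW a0) (ltW e0) _ _ cM).
  + by move=> m2 n2; rewrite A0 ha.
  + by move=> m2 n2; rewrite B0 he.
- by move=> q K r r01 qf dq; exact: (exp_decay_powers b01 r01 qf dq).
Qed.

End DecayInstances.

(** * Polynomial decay without loss of exponent *)

Section PolynomialDecay.
Context {R : realType}.
Implicit Types (A B M X : nat -> nat -> R).

(* Brandenburg's trick: interpolating between the operator norm and the decay
   norm of [q j] makes the decay norm of [q (2 j)] grow like a power
   [1 + th < 2] of that of [q j]. *)
Lemma poly_decay_doubling (s k t : R) q : 1 < s -> 0 < t ->
  power_family q (expR k) (expR (- t)) ->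
  exists th d, [/\ 0 < th < 1, 0 <= d & forall j l,
    (forall m n, q j m n <= expR l * wpoly s (gap m n)) ->
    forall m n, q (j + j)%N m n <=
      expR (d + (1 + th) * l - (1 - th) * t * j%:R) * wpoly s (gap m n)].
Proof.
(* Two demands meet here: [th < 1] gives the gain, and [th s = (s + 1)/2 > 1] keeps the interpolated
   weight summable. *)
move=> s1 t0 [qK qM _]; pose th := (1 + s^-1) / 2.
have s0 : 0 < s by lra.
have sV : s^-1 < 1 by rewrite invf_lt1.
have sV0 : 0 < s^-1 by rewrite invr_gt0.
have th01 : 0 < th < 1 by rewrite /th; lra.
have ths : 1 < th * s.
  have : th * s = (s + 1) / 2 by rewrite /th; field; lra.
  lra.
have [D D0 DP] := wpoly_summable ths.
exists th, `|ln (2 `^ s * (D + D)) + (1 - th) * k|; split=> // j l ql m n.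
(* The logarithm of the constant obtained by interpolating the norm bound [expR (k - t j)] with the
   decay bound [expR l]. *)
pose y := (1 - th) * (k - t * j%:R) + th * l.
have qy m' n' : q j m' n' <= expR y * wpoly (th * s) (gap m' n').
  have /andP[q0 qr] := qK j m' n'.
  have th01' : 0 <= th <= 1 by lra.
  apply: le_trans (interpolation th01' q0 qr (ql m' n')) _.
  rewrite -expRM_natr -expRD -expRM powRM ?expR_ge0 ?powR_ge0// -expRM.
  rewrite /wpoly -powRrM mulrA -expRD.
  rewrite (_ : - s * th = - (th * s)); last by ring.
  rewrite (_ : _ + _ = y)//; rewrite /y; ring.
apply: (qM) => L.
(* In each product, the factor with the larger gap takes the full bound of exponent [s], which
   yields the decay in [|m - n|]. The other factor takes the interpolated bound, still summable over
   [i]. *)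
apply: le_trans (_ : 2 `^ s * expR (l + y) * wpoly s (gap m n) *
  \sum_(0 <= i < L) (wpoly (th * s) (gap m i) + wpoly (th * s) (gap n i)) <= _).
  rewrite mulr_sumr; apply: ler_sum_nat => i _.
  have /andP[q1 _] := qK j m i; have /andP[q2 _] := qK j i n.
  have h1 := ql m i; have h2 := ql i n; have y1 := qy m i; have y2 := qy i n.
  rewrite (gapC n i) expRD; have := wpoly_split m i n (ltW s0).
  have w1 := wpoly_gt0 (th * s) (gap_ge0 m i).
  have w2 := wpoly_gt0 (th * s) (gap_ge0 i n).
  have w3 := wpoly_gt0 s (gap_ge0 m n).
  set W := 2 `^ s * wpoly s (gap m n); have W0 : 0 < W by rewrite mulr_gt0// powR_gt0.
  have e1 := expR_gt0 l; have e2 := expR_gt0 y.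
  have -> : 2 `^ s * (expR l * expR y) * wpoly s (gap m n) = expR l * W * expR y.
    by rewrite /W; ring.
  rewrite minElt; case: ifP => _ wW.
    have a1 : q j m i <= expR l * W by apply: le_trans h1 _; rewrite ler_wpM2l ?(ltW e1).
    apply: le_trans (ler_pM q1 q2 a1 y2) _.
    rewrite -[leRHS]mulrA; apply: ler_wpM2l; first by rewrite mulr_ge0// ltW.
    by apply: ler_wpM2l; lra.
  have a2 : q j i n <= expR l * W by apply: le_trans h2 _; rewrite ler_wpM2l ?(ltW e1).
  apply: le_trans (ler_pM q1 q2 y1 a2) _.
  rewrite mulrC -[leRHS]mulrA; apply: ler_wpM2l; first by rewrite mulr_ge0// ltW.
  by apply: ler_wpM2l; lra.
have DD0 : 0 < D + D by lra.
apply: le_trans (_ : 2 `^ s * expR (l + y) * wpoly s (gap m n) * (D + D) <= _).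
  rewrite ler_wpM2l ?mulr_ge0 ?powR_ge0 ?expR_ge0//.
  exact: (sums_leD (DP m) (DP n)).
rewrite mulrAC ler_wpM2r ?powR_ge0// mulrAC.
rewrite -[X in X * _ <= _]lnK; last by rewrite posrE mulr_gt0// powR_gt0.
rewrite -expRD ler_expR.
have := ler_norm (ln (2 `^ s * (D + D)) + (1 - th) * k).
rewrite /y; nra.
Qed.

Lemma poly_decay_small (s k t : R) q (D : R) : 1 < s -> 0 < t -> 0 < D ->
  power_family q (expR k) (expR (- t)) -> poly_decay s (q 1%N) ->
  exists2 J, (0 < J)%N & forall m n,
    q J m n <= expR (- t / 2 * J%:R) / D * wpoly s (gap m n).
Proof.
move=> s1 t0 D0 qf q1.
have [th [d [th01 d0 dbl]]] := poly_decay_doubling s1 t0 qf.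
have [|C C0 CP] := dominated_gt0 _ q1; first by move=> u u0; rewrite ltW// wpoly_gt0.
(* The midpoint of [(1 + th)/2] and 1. Doubling multiplies the excess per step by [(1 + th)/2];
   relaxing this ratio to [z] frees [(1 - th)/2 * Z], enough to absorb [d] by the choice of [Z], and
   [Z z^i] still tends to 0. The other term of [Z] starts the induction. *)
pose z := (3 + th) / 4.
pose Z := Num.max `|ln C + t| (2 * d / (1 - th)).
have z0 : 0 < z by rewrite /z; lra.
have z1 : z < 1 by rewrite /z; lra.
have Z1 : ln C + t <= Z by rewrite /Z le_max ler_norm.
have Z2 : 2 * d / (1 - th) <= Z by rewrite /Z le_max lexx orbT.
have Z0 : 0 <= Z by rewrite /Z le_max normr_ge0.
have claim i m n : q (2 ^ i)%N m n <=
    expR (2 ^+ i * (- t + Z * z ^+ i)) * wpoly s (gap m n).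
  elim: i m n => [|i ih] m n.
    rewrite expn0 !expr0 mul1r mulr1; apply: le_trans (CP m n) _.
    rewrite ler_wpM2r ?powR_ge0// -[leLHS]lnK ?posrE// ler_expR; lra.
  rewrite expnS mul2n -addnn; apply: le_trans (dbl _ _ ih m n) _.
  rewrite ler_wpM2r ?powR_ge0// ler_expR natrX !exprS.
  set P := 2 ^+ i; set Q := z ^+ i.
  have PQ : 1 <= P * Q.
    rewrite /P /Q -exprMn exprn_ege1//; rewrite /z; lra.
  have dZ : d <= (1 - th) / 2 * Z.
    move: Z2; rewrite ler_pdivrMr; [nra|lra].
  have : (1 - th) / 2 * Z * 1 <= (1 - th) / 2 * Z * (P * Q).
    by rewrite ler_wpM2l// mulr_ge0//; lra.
  rewrite (_ : z = (3 + th) / 4)//; nra.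
have zcvg : Z * z ^+ i @[i --> \oo] --> 0.
  rewrite -[X in _ --> X](mulr0 Z); apply: cvgMr.
  by apply: cvg_expr; rewrite ger0_norm// ltW.
(* Of the rate [t], one quarter pays for the excess [Z z^i] and one quarter for the factor [1/D];
   half remains. *)
have [i [iz iD]] : exists i, Z * z ^+ i <= t / 4 /\ ln D <= 2 ^+ i * (t / 4).
  have t4 : 0 < t / 4 by lra.
  have [N _ HN] := cvgr_le _ zcvg _ t4.
  pose N' := Num.bound (`|ln D| / (t / 4)).
  exists (maxn N N'); split; first by apply: HN; exact: leq_maxl.
  rewrite -ler_pdivrMr//; apply: le_trans (_ : N'%:R <= _).
    apply: le_trans (ler_norm _) _; rewrite normrM (gtr0_norm (x := (t/4)^-1)) ?invr_gt0//.
    by apply/ltW/archi_boundP; rewrite divr_ge0// ltW.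
  rewrite -natrX ler_nat; apply: leq_trans (leq_maxr N N') _.
  exact/ltnW/ltn_expl.
exists (2 ^ i)%N; first by rewrite expn_gt0.
move=> m n; apply: le_trans (claim i m n) _; rewrite ler_wpM2r ?powR_ge0//.
rewrite -[X in _ / X]lnK ?posrE// -expRN -expRD ler_expR natrX.
have : 0 < 2 ^+ i :> R by rewrite exprn_gt0.
nra.
Qed.

(** The power [J] is taken so large that its decay constant is [rho^J / D], where [D] is the
    convolution constant of the weight. Multiplying by [q J] then costs exactly [rho^J], and
    induction in steps of [J] leaves only the powers below [J], for which any bounds [a j] will
    do. *)
Lemma poly_decay_powers (s : R) q K r : 1 < s -> 0 < r < 1 ->
  power_family q K r -> poly_decay s (q 1%N) ->
  exists rho X, [/\ 0 < rho < 1, poly_decay s X & forall j m n, q j m n <= rho ^+ j * X m n].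
Proof.
move=> s1 /andP[r0 r1] qf q1; have K0 := power_family_ge0 qf.
have [D D0 cD] := wpoly_conv s1.
pose k := ln (K + 1); pose t := - ln r.
have t0 : 0 < t by rewrite oppr_gt0 ln_lt0// r0.
have qf' : power_family q (expR k) (expR (- t)).
  have [qK qM qid] := qf; split=> // j m n; have /andP[-> qr] := qK j m n.
  apply: le_trans qr _; rewrite opprK !lnK ?posrE//; last lra.
  by rewrite ler_wpM2r ?exprn_ge0 ?(ltW r0)//; lra.
have [J J0 qJ] := poly_decay_small s1 t0 D0 qf' q1.
have [qK qM qid] := qf.
have w0 u : 0 <= u -> 0 < wpoly s u by exact: wpoly_gt0.
have [C C0 CP] : exists2 C, 0 < C & forall m n, q 1%N m n <= C * wpoly s (gap m n).
  by apply: dominated_gt0 q1 => u /w0/ltW.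
have [a ha] : exists a : nat -> R, forall j, 0 <= a j /\
    forall m n, q j m n <= a j * wpoly s (gap m n).
  suff H j : exists a, 0 <= a /\ forall m n, q j m n <= a * wpoly s (gap m n).
    by have [a aP] := choice H; exists a.
  elim: j => [|j [a [a0 ih]]].
    exists K; split=> //; apply: (dominated_diag (wpoly0 s) w0) => // m n.
    by rewrite qid ler_wpM2l//; have /andP[_] := qK 0%N m n; rewrite expr0 mulr1.
  exists (a * C * D); split; first by rewrite !mulr_ge0// ltW.
  rewrite -addn1; apply: (comp_dominated cD _ _ _ _ (qM j 1%N)) => //; first exact: ltW.
    by move=> m n; rewrite ih andbT; have /andP[] := qK j m n.
  by move=> m n; rewrite CP andbT; have /andP[] := qK 1%N m n.
pose rho := expR (- t / 2).
have rho0 : 0 < rho by exact: expR_gt0.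
have rhoJ : expR (- t / 2 * J%:R) = rho ^+ J by rewrite expRM_natr.
(* Ensures [a j <= c rho^j] for every [j < J], the base cases of the induction. *)
pose c := \sum_(0 <= j < J) a j / rho ^+ j.
have aj0 j : 0 <= a j / rho ^+ j by rewrite divr_ge0 ?exprn_ge0 ?(ltW rho0)//; case: (ha j).
have c0 : 0 <= c by rewrite sumr_ge0.
exists rho, (fun m n => c * wpoly s (gap m n)); split.
- by rewrite rho0 /rho expR_lt1; lra.
- by exists c.
elim/ltn_ind => j ih m n; have [jJ|Jj] := ltnP j J.
  apply: le_trans ((ha j).2 m n) _; rewrite mulrA ler_wpM2r ?powR_ge0//.
  rewrite -ler_pdivrMl ?exprn_gt0// mulrC /c big_mkord (bigD1 (Ordinal jJ))//=.
  by rewrite lerDl sumr_ge0.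
have -> : j = ((j - J) + J)%N by rewrite subnK.
apply: le_trans (_ : rho ^+ (j - J) * c * (rho ^+ J / D) * D * wpoly s (gap m n) <= _).
  apply: (comp_dominated cD _ _ _ _ (qM _ J)).
  - by rewrite mulr_ge0// exprn_ge0// ltW.
  - by rewrite divr_ge0 ?exprn_ge0 ?ltW.
  - move=> {}m {}n; have /andP[-> _] := qK (j - J)%N m n; rewrite -mulrA ih//.
    by rewrite ltn_subrL J0 (leq_trans J0 Jj).
  - by move=> {}m {}n; have /andP[-> _] := qK J m n; rewrite -rhoJ qJ.
rewrite -[X in X * wpoly _ _ <= _]mulrA divfK ?gt_eqF// exprD.
by rewrite [leRHS]mulrA ler_wpM2r ?powR_ge0// mulrAC.
Qed.

Lemma poly_decay_algebra (s : R) : 1 < s -> decay_algebra (poly_decay s).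
Proof.
move=> s1; have w0 u : 0 <= u -> 0 < wpoly s u by exact: wpoly_gt0.
have w0' u : 0 <= u -> 0 <= wpoly s u by move=> /w0/ltW.
split.
- by move=> A B; exact: dominated_le.
- move=> C A AC; exists `|C|; apply: (dominated_diag (wpoly0 s) w0) => //.
  by move=> m n; apply: le_trans (AC m n) _; rewrite ler_wpM2l// ler_norm.
- by move=> A B; exact: dominatedD.
- by move=> a A; exact: dominatedZ.
- by move=> A; exact: dominated_tr.
- move=> A B M A0 B0 cM hA hB; have [D D0 cD] := wpoly_conv s1.
  have [a a0 ha] := dominated_gt0 w0' hA.
  have [b b0 hb] := dominated_gt0 w0' hB.
  exists (a * b * D) => m n.
  apply: (comp_dominated cD (ltW a0) (ltW b0) _ _ cM) => m' n'.
  + by rewrite A0 ha.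
  + by rewrite B0 hb.
- by move=> q K r r01 qf dq; exact: (poly_decay_powers s1 r01 qf dq).
Qed.

End PolynomialDecay.

(** * Weighted l^p norms and the Schur test *)

Section WeightedSchur.
Context {R : realType}.
Implicit Types (A : nat -> nat -> R) (v : nat -> R).

(** Row and column sums of [diag(v) A diag(1/v)], whose action on unweighted l^p is that of [A] on
    the space with weight [v]. *)
Definition schur_bounded v A (D : R) :=
  (forall m, sums_le (fun n => A m n * (v m / v n)) D) /\
  (forall n, sums_le (fun m => A m n * (v m / v n)) D).

Lemma wpoly_schur (s C : R) v A : 1 < s ->
  (forall m n, A m n * (v m / v n) <= C * wpoly s (gap m n)) ->
  exists2 D, 0 < D & schur_bounded v A D.
Proof.
move=> s1 h; have [D D0 DP] := wpoly_summable s1.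
have C0 : 0 <= `|C| by [].
have h' m n : A m n * (v m / v n) <= `|C| * wpoly s (gap m n).
  by apply: le_trans (h m n) _; rewrite ler_wpM2r ?powR_ge0// ler_norm.
have CD L k : \sum_(0 <= i < L) `|C| * wpoly s (gap k i) <= `|C| * D + 1.
  by apply: le_trans (sums_leZ C0 (DP k) L) _; rewrite lerDl.
exists (`|C| * D + 1); first by rewrite ltr_wpDl// mulr_ge0// ltW.
split=> k L; apply: le_trans (CD L k); apply: ler_sum_nat => i _ //.
by rewrite gapC.
Qed.

Lemma moderate_ratio (w : R -> R) (mu : R -> R) (C : R) : weight mu ->
  (forall t x, mu (t + x) <= C * w `|t| * mu x) ->
  forall m n : nat, mu m.+1%:R / mu n.+1%:R <= C * w (gap m n).
Proof.
move=> [mu0 _] h m n; rewrite ler_pdivrMr//.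
have -> : m.+1%:R = (m%:R - n%:R) + n.+1%:R :> R by rewrite -!natr1; ring.
exact: h.
Qed.

(** The weight ratio costs [k] powers of [1 + |m - n|]; the exponent [1 + eps] that remains is just
    summable. This is the origin of [k + 1 + eps]. *)
Lemma poly_decay_schur (k eps : R) mu A : 0 <= k -> 0 < eps -> moderate k mu ->
  (forall m n, 0 <= A m n) -> poly_decay (k + 1 + eps) A ->
  exists2 D, 0 < D & schur_bounded (fun n => mu n.+1%:R) A D.
Proof.
move=> k0 e0 [wmu [C C0 CP]] A0 [B BP].
have r := @moderate_ratio (fun t => (1 + t) `^ k) mu C wmu CP.
have e1 : 1 < 1 + eps by lra.
apply: (@wpoly_schur (1 + eps) (B * C)) => // m n.
have /(ler_pM (A0 m n)) := BP m n => /(_ _ _ _ (r m n))/le_trans; apply.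
  by rewrite divr_ge0// ltW//; case: wmu.
rewrite mulrACA ler_wpM2l//; last first.
  rewrite -powRD; last by apply/implyP => _; rewrite gt_eqF// ltr_pwDl ?gap_ge0.
  by rewrite /wpoly (_ : - (k + 1 + eps) + k = - (1 + eps))//; ring.
rewrite mulr_ge0 ?(ltW C0)//.
have := le_trans (A0 0%N 0%N) (BP 0%N 0%N).
by rewrite gapnn wpoly0 mulr1.
Qed.

(** Half of the rate absorbs the growth of the weight, thanks to [bm < b]; the other half gives
    quadratic decay. *)
Lemma exp_decay_schur (b bm : R) mu A : 0 < bm < b -> b <= 1 -> subexp_weight bm mu ->
  (forall m n, 0 <= A m n) -> exp_decay b A ->
  exists2 D, 0 < D & schur_bounded (fun n => mu n.+1%:R) A D.
Proof.
move=> bmb b1 [wmu [C [g [C0 g0 CP]]]] A0 [c c0 [B BP]].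
have r := @moderate_ratio (fun t => expR (g * t `^ bm)) mu C wmu CP.
have c20 : 0 < c / 2 by lra.
have [E EP] := powR_absorb bmb c20 (ltW g0).
have b01 : 0 < b <= 1 by rewrite b1 andbT; lra.
have [F F0 FP] := wexp_wpoly b01 c20 (ler0n R 2).
have B0 : 0 <= B.
  have := le_trans (A0 0%N 0%N) (BP 0%N 0%N).
  by rewrite gapnn wexp0 ?mulr1// gt_eqF//; lra.
have s1 : 1 < 2%:R :> R by rewrite ltr1n.
apply: (@wpoly_schur 2 (B * C * expR E * F)) => // m n.
have /(ler_pM (A0 m n)) := BP m n => /(_ _ _ _ (r m n))/le_trans; apply.
  by rewrite divr_ge0// ltW//; case: wmu.
rewrite mulrACA.
apply: le_trans (_ : B * C * (expR E * (F * wpoly 2 (gap m n))) <= _); last by rewrite !mulrA.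
apply: ler_wpM2l; first by rewrite mulr_ge0// ltW.
have /(ler_wpM2l (expR_ge0 E)) := FP _ (gap_ge0 m n); apply: le_trans.
rewrite /wexp -!expRD ler_expR; have := EP _ (gap_ge0 m n); lra.
Qed.

End WeightedSchur.

Section RealLp.
Context {R : realType}.
Variables (p : R) (p1 : 1 <= p).
Implicit Types (b c : nat -> R) (M : R).

Definition lple b M := sums_le (fun n => b n `^ p) (M `^ p).

Let p0 : 0 < p. Proof. by rewrite (lt_le_trans ltr01). Qed.
Let pn0 : p != 0. Proof. by rewrite gt_eqF. Qed.

(** The convex function [x^p] lies above its tangent at [y]. It is Young's inequality for the
    exponents [p] and [p/(p - 1)], with [p = 1] treated apart. Both Minkowski's inequality and the
    Schur test are derived from this linearization. *)
Lemma powR_tangent (x y : R) : 0 <= x -> 0 <= y ->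
  p * x * y `^ (p - 1) <= x `^ p + (p - 1) * y `^ p.
Proof.
move=> x0 y0; move: p1; rewrite le_eqVlt => /predU1P[<-|p1'].
  by rewrite subrr powRr0 mul0r addr0 powRr1// mul1r mulr1.
have q0 : 0 < p / (p - 1) by rewrite divr_gt0//; lra.
have := @conjugate_powR R x (y `^ (p - 1)) p (p / (p - 1)) x0 (powR_ge0 _ _) p0 q0.
rewrite -powRrM (_ : (p - 1) * (p / (p - 1)) = p); last by field; lra.
have -> : p^-1 + (p / (p - 1))^-1 = 1 by field; rewrite !gt_eqF//; lra.
move=> /(_ erefl)/(ler_wpM2l (ltW p0)).
rewrite mulrA => /le_trans; apply; rewrite le_eqVlt; apply/orP; left; apply/eqP.
by field; rewrite !gt_eqF//; lra.
Qed.

Lemma powR_le_inv (x y : R) : 0 <= x -> 0 <= y -> x `^ p <= y `^ p -> x <= y.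
Proof.
move=> x0 y0; apply: contraTT; rewrite -!ltNge => yx.
by apply: gt0_ltr_powR.
Qed.

Lemma lple_entry b M n : (forall n, 0 <= b n) -> 0 <= M -> lple b M -> b n <= M.
Proof.
move=> b0 M0 /(_ n.+1) h; apply: powR_le_inv => //; apply: le_trans h.
by rewrite big_nat_recr//= lerDr sumr_ge0// => i _; exact: powR_ge0.
Qed.

Lemma lple_mono b c M : (forall n, 0 <= b n <= c n) -> lple c M -> lple b M.
Proof.
move=> bc; apply: sums_le_mono => n; have /andP[b0 bcn] := bc n.
by apply: ge0_ler_powR; rewrite ?nnegrE ?(ltW p0)// (le_trans b0).
Qed.

Lemma lple_leM b M N : 0 <= M -> M <= N -> lple b M -> lple b N.
Proof.
move=> M0 MN h L; apply: le_trans (h L) _.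
by apply: ge0_ler_powR; rewrite ?nnegrE ?(ltW p0)// (le_trans M0).
Qed.

Lemma lpleZ a b M : 0 <= a -> 0 <= M -> (forall n, 0 <= b n) -> lple b M ->
  lple (fun n => a * b n) (a * M).
Proof.
move=> a0 M0 b0 h L; rewrite powRM//.
by under eq_bigr do rewrite powRM//; exact: sums_leZ (powR_ge0 _ _) h L.
Qed.

Lemma lple_eq0 b : (forall n, 0 <= b n) -> lple b 0 -> forall n, b n = 0.
Proof. by move=> b0 h n; apply/le_anti; rewrite b0 andbT lple_entry. Qed.

Lemma lple0 M : lple (fun=> 0) M.
Proof. by move=> L; rewrite big1 ?powR_ge0// => i _; rewrite powR0. Qed.

(** Minkowski's inequality: [z] is the convex combination of [b n / M] and [c n / N] with weights
    [M/(M + N)] and [N/(M + N)]; apply convexity of the p-th power and sum. The cases [M = 0] and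
    [N = 0] come first because of the divisions. *)
Lemma lpleD b c M N : (forall n, 0 <= b n) -> (forall n, 0 <= c n) ->
  0 <= M -> 0 <= N -> lple b M -> lple c N -> lple (fun n => b n + c n) (M + N).
Proof.
move=> b0 c0; rewrite le_eqVlt => /predU1P[<-|M0].
  move=> N0 hb hc; rewrite add0r; have -> // : (fun n => b n + c n) = c.
  by apply/funext => n; rewrite (lple_eq0 b0 hb) add0r.
rewrite le_eqVlt => /predU1P[<-|N0] hb hc.
  rewrite addr0; have -> // : (fun n => b n + c n) = b.
  by apply/funext => n; rewrite (lple_eq0 c0 hc) addr0.
have s0 : 0 < M + N by rewrite addr_gt0.
have divp x y : 0 <= x -> 0 < y -> x `^ p / y `^ p = (x / y) `^ p.
  move=> x0 y0; rewrite powRM ?invr_ge0 ?(ltW y0)//; congr (_ * _).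
  by rewrite -[in RHS](powR_inv1 (ltW y0)) powRAC powR_inv1 ?powR_ge0.
have convex n : (b n + c n) `^ p <= (M + N) `^ p * ((M / (M + N)) * (b n `^ p / M `^ p)
    + (N / (M + N)) * (c n `^ p / N `^ p)).
  pose u := b n / M; pose w := c n / N; pose z := (b n + c n) / (M + N).
  have u0 : 0 <= u by rewrite divr_ge0// ltW.
  have w0 : 0 <= w by rewrite divr_ge0// ltW.
  have z0 : 0 <= z by rewrite divr_ge0 ?addr_ge0// ltW.
  have -> : (b n + c n) `^ p = (M + N) `^ p * z `^ p.
    by rewrite -powRM ?(ltW s0)// /z mulrC divfK// gt_eqF.
  rewrite ler_wpM2l ?powR_ge0//.
  have -> : b n `^ p / M `^ p = u `^ p.
    exact: divp.
  have -> : c n `^ p / N `^ p = w `^ p.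
    exact: divp.
  have l1 : 0 <= M / (M + N) by rewrite divr_ge0// ltW.
  have l2 : 0 <= N / (M + N) by rewrite divr_ge0// ltW.
  have l12 : M / (M + N) + N / (M + N) = 1 by rewrite -mulrDl divff// gt_eqF.
  have zE : z = M / (M + N) * u + N / (M + N) * w.
    by rewrite /z /u /w; field; rewrite !gt_eqF.
  have := ler_wpM2l l1 (powR_tangent u0 z0).
  have := ler_wpM2l l2 (powR_tangent w0 z0).
  have := mulr_powRB1 z0 p0.
  move: (M / (M + N)) (N / (M + N)) l12 zE => x y l12 zE hz h2 h1.
  have : z `^ p = p * z * z `^ (p - 1) - (p - 1) * z `^ p by rewrite -mulrA hz; ring.
  have -> : p * z * z `^ (p - 1) =
     x * (p * u * z `^ (p - 1)) + y * (p * w * z `^ (p - 1)) by rewrite [X in _ * X * _]zE; ring.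
  have yE : y = 1 - x by lra.
  by move: h1 h2; rewrite yE; lra.
move=> L; apply: le_trans (_ : (M + N) `^ p * (M / (M + N) * (M `^ p / M `^ p)
    + N / (M + N) * (N `^ p / N `^ p)) <= _); last first.
  rewrite !divff ?gt_eqF ?powR_gt0// !mulr1 -mulrDl divff ?gt_eqF// mulr1.
  exact: lexx.
apply: le_trans (_ : \sum_(0 <= n < L) (M + N) `^ p * ((M / (M + N)) * (b n `^ p / M `^ p)
    + (N / (M + N)) * (c n `^ p / N `^ p)) <= _); first exact: ler_sum_nat.
rewrite -mulr_sumr ler_wpM2l ?powR_ge0// big_split -!mulr_sumr -!mulr_suml.
have ph x : 0 <= (x `^ p)^-1 by rewrite invr_ge0 powR_ge0.
by apply: lerD; (apply: ler_wpM2l; first by rewrite divr_ge0// ltW);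
  apply: ler_wpM2r => //.
Qed.

(** Stated for every [c] below [b] that vanishes before [N], rather than for the tail of [b] alone,
    so that it applies to partial sums taken in any order. *)
Lemma lple_tail b M : (forall n, 0 <= b n) -> lple b M ->
  forall eps, 0 < eps -> exists N, forall c,
    (forall n, 0 <= c n <= b n) -> (forall n, (n < N)%N -> c n = 0) -> lple c eps.
Proof.
move=> b0 h eps e0; pose u K := \sum_(0 <= n < K) b n `^ p.
have hs : has_sup (range u).
  split; first by exists (u 0%N), 0%N.
  by exists (M `^ p) => _ [K _ <-]; exact: h.
have ep : 0 < eps `^ p by rewrite powR_gt0.
have [_ [N _ <-] uN] := sup_adherent ep hs.
exists N => c cb c0 K.
have uK L : u L <= sup (range u).
  by apply: ub_le_sup; [exact: hs.2|exists L].
apply: le_trans (_ : \sum_(0 <= n < N + K) c n `^ p <= _).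
  rewrite (addnC N) [leRHS](@big_cat_nat _ _ _ K) ?leq_addr//= lerDl sumr_ge0// => i _.
  exact: powR_ge0.
rewrite (@big_cat_nat _ _ _ N) ?leq_addr//= big_nat big1 ?add0r; last first.
  by move=> i /andP[_ iN]; rewrite c0// powR0.
apply: le_trans (_ : u (N + K)%N - u N <= _); last by have := uK (N + K)%N; lra.
rewrite /u [X in X - _](@big_cat_nat _ _ _ N) ?leq_addr//= addrAC subrr add0r.
apply: ler_sum_nat => n _; have /andP[cn0 cbn] := cb n.
by apply: ge0_ler_powR; rewrite ?nnegrE ?(ltW p0)// (le_trans cn0).
Qed.

(** Discrete monotone convergence: the [S m] are the limits of the [f m], and a finite sum of limits
    is the limit of the sums. *)
Lemma sum_sup (f : nat -> nat -> R) L D : (forall m N, 0 <= f m N) ->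
  (forall m, nondecreasing_seq (f m)) ->
  (forall N, \sum_(0 <= m < L) f m N <= D) ->
  exists2 S, (forall m N, (m < L)%N -> f m N <= S m) & \sum_(0 <= m < L) S m <= D.
Proof.
move=> f0 fnd fD; have fm m N : (m < L)%N -> f m N <= D.
  move=> mL; apply: le_trans (fD N); rewrite big_mkord (bigD1 (Ordinal mL))//=.
  by rewrite lerDl sumr_ge0.
have fc m : (m < L)%N -> cvgn (f m).
  move=> mL; apply: nondecreasing_is_cvgn => //.
  by exists D => _ [N _ <-]; exact: fm.
exists (fun m => limn (f m)) => [m N mL|]; first exact: (nondecreasing_cvgn_le (fnd m) (fc m mL) N).
rewrite big_mkord.
have lc : \sum_(m < L) f m N @[N --> \oo] --> \sum_(m < L) limn (f m).
  by apply: cvg_big => [|i _]; [exact: add_continuous|exact: fc].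
rewrite -(cvg_lim _ lc)//; apply: limr_le; first by apply/cvg_ex; exists (\sum_(m < L) limn (f m)).
by apply: nearW => N; have := fD N; rewrite big_mkord.
Qed.

(** The Schur test for [c <= K b]. If [S m] bounds the sum of [K m n b n^p] over [n], the row sums
    give [c m^p <= D^(p - 1) S m], and the column sums bound the total of the [S m] by [D M^p]. *)
Lemma lple_schur (K : nat -> nat -> R) b c D M : 0 < D -> 0 <= M ->
  (forall m n, 0 <= K m n) -> (forall n, 0 <= b n) -> (forall n, 0 <= c n) ->
  (forall m, sums_le (K m) D) -> (forall n, sums_le (K^~ n) D) ->
  (forall m B, sums_le (fun n => K m n * b n) B -> c m <= B) ->
  lple b M -> lple c (D * M).
Proof.
move=> D0 M0 K0 b0 c0 rK cK cKb hb L.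
pose f m N := \sum_(0 <= n < N) K m n * b n `^ p.
have [||N|S fS SD] := @sum_sup f L (D * M `^ p).
- by move=> m N; rewrite sumr_ge0// => i _; rewrite mulr_ge0 ?powR_ge0.
- move=> m; apply/nondecreasing_seqP => N; rewrite /f big_nat_recr//= lerDl.
  by rewrite mulr_ge0 ?powR_ge0.
- rewrite /f exchange_big/=.
  apply: le_trans (_ : D * \sum_(0 <= n < N) b n `^ p <= _); last first.
    by rewrite ler_wpM2l ?(ltW D0)//; exact: hb.
  rewrite mulr_sumr; apply: ler_sum_nat => n _.
  by rewrite -mulr_suml ler_wpM2r ?powR_ge0//; exact: cK.
rewrite powRM ?(ltW D0)// -(mulr_powRB1 (ltW D0) p0) mulrAC mulrC.
apply: le_trans (_ : D `^ (p - 1) * \sum_(0 <= m < L) S m <= _); last first.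
  by rewrite ler_wpM2l ?powR_ge0.
rewrite mulr_sumr; apply: ler_sum_nat => m /andP[_ mL].
have := c0 m; rewrite le_eqVlt => /predU1P[<-|cm0].
  rewrite powR0// mulr_ge0 ?powR_ge0//; apply: le_trans (fS m 0%N mL).
  by rewrite /f big_geq.
(* Linearizing at this self-referential point closes the estimate: [p D y^p <= S m + (p - 1) D y^p],
   that is, [D y^p <= S m]. *)
pose y := c m / D; have y0 : 0 < y by rewrite divr_gt0.
have cE : c m = D * y by rewrite /y mulrC divfK// gt_eqF.
have yp0 : 0 < y `^ (p - 1) by rewrite powR_gt0.
have : c m <= (S m + (p - 1) * y `^ p * D) / (p * y `^ (p - 1)).
  apply: cKb => N; rewrite ler_pdivlMr ?mulr_gt0// mulr_suml.
  apply: le_trans (_ : \sum_(0 <= n < N) (K m n * b n `^ p + (p - 1) * y `^ p * K m n) <= _).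
    apply: ler_sum_nat => n _.
    have := ler_wpM2l (K0 m n) (powR_tangent (b0 n) (ltW y0)).
    by move: (b n `^ p) (y `^ p) (y `^ (p - 1)) => u1 u2 u3; lra.
  rewrite big_split/= lerD//; first exact: fS.
  rewrite -mulr_sumr; apply: ler_wpM2l; last exact: rK.
  by rewrite mulr_ge0 ?powR_ge0// subr_ge0.
clearbody y.
rewrite ler_pdivlMr ?mulr_gt0// cE (powRM _ (ltW D0) (ltW y0)).
have yE := mulr_powRB1 (ltW y0) p0; have DE := mulr_powRB1 (ltW D0) p0.
have -> : D * y * (p * y `^ (p - 1)) = p * D * y `^ p by rewrite -yE; ring.
rewrite -DE => h.
have h' : D * y `^ p <= S m by lra.
have := ler_wpM2l (powR_ge0 D (p - 1)) h'.
by rewrite mulrA [D `^ _ * D]mulrC.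
Qed.

End RealLp.

(** * Convergence in normed spaces over R[i] *)

Section RealNorm.
Context {R : realType}.

Section Zmod.
Context {V : normedZmodType R[i]}.
Implicit Types (x y : V) (u v : nat -> V).

Lemma rnormE x : `|x| = (rnorm x)%:C%C.
Proof. by rewrite /rnorm RRe_real// normr_real. Qed.

Lemma le_rnorm x (M : R) : (`|x| <= M%:C%C) = (rnorm x <= M).
Proof. by rewrite rnormE lecR. Qed.

Lemma rnorm_ge0 x : 0 <= rnorm x.
Proof. by rewrite -lecR -rnormE normr_ge0. Qed.

Lemma rnormD x y : rnorm (x + y) <= rnorm x + rnorm y.
Proof.
rewrite -le_rnorm (_ : (rnorm x + rnorm y)%:C%C = `|x| + `|y|) ?ler_normD//.
by rewrite !rnormE -rmorphD.
Qed.

Lemma rnormN x : rnorm (- x) = rnorm x. Proof. by rewrite /rnorm normrN. Qed.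

Lemma rnorm0 : rnorm (0 : V) = 0. Proof. by rewrite /rnorm normr0. Qed.

Lemma rnorm_dist x y : rnorm (x - y) = rnorm (y - x).
Proof. by rewrite -rnormN opprB. Qed.

Lemma rnormB x y : rnorm (x - y) <= rnorm x + rnorm y.
Proof. by rewrite -(rnormN y) rnormD. Qed.

Lemma rnorm_eq0 x : rnorm x <= 0 -> x = 0.
Proof. by rewrite -le_rnorm normr_le0 => /eqP. Qed.

Lemma rnorm_distD y x z : rnorm (x - z) <= rnorm (x - y) + rnorm (y - z).
Proof. by rewrite (_ : x - z = (x - y) + (y - z)) ?rnormD// addrA subrK. Qed.

Lemma rnorm_sum (f : nat -> V) m n :
  rnorm (\sum_(m <= i < n) f i) <= \sum_(m <= i < n) rnorm (f i).
Proof.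
apply: (big_ind2 (fun (x : V) (a : R) => rnorm x <= a)) => [|x a y b xa yb|//].
  by rewrite rnorm0.
by apply: le_trans (rnormD x y) _; rewrite lerD.
Qed.

Lemma rnorm_sub_ge x y : rnorm x - rnorm y <= rnorm (x - y).
Proof. by rewrite lerBlDr -[in leLHS](subrK y x) rnormD. Qed.

(* Convergence for the real-valued norm, so that [H], [X] and the scalar field
   [R[i]] can be treated alike. *)
Definition tends u x := forall e : R, 0 < e -> exists N, forall n, (N <= n)%N ->
  rnorm (u n - x) <= e.

Definition rcauchy u := forall e : R, 0 < e -> exists N, forall m n,
  (N <= m)%N -> (N <= n)%N -> rnorm (u m - u n) <= e.

Lemma tends_unique u x y : tends u x -> tends u y -> x = y.
Proof.
move=> ux uy; apply/eqP; rewrite -subr_eq0; apply/eqP/rnorm_eq0.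
apply/ler_addgt0Pr => e e0; rewrite add0r.
have e2 : 0 < e / 2 by rewrite divr_gt0.
have [N HN] := ux _ e2; have [N' HN'] := uy _ e2.
have := HN _ (leq_maxl N N'); have := HN' _ (leq_maxr N N').
set n := maxn _ _; have := rnorm_distD (u n) x y.
by rewrite (rnorm_dist x (u n)); lra.
Qed.

Lemma tends_cst x : tends (fun=> x) x.
Proof. by move=> e e0; exists 0%N => n _; rewrite subrr rnorm0 ltW. Qed.

Lemma tends_rcauchy u x : tends u x -> rcauchy u.
Proof.
move=> ux e e0; have e2 : 0 < e / 2 by rewrite divr_gt0.
have [N HN] := ux _ e2; exists N => m n Nm Nn.
have := rnorm_distD x (u m) (u n); rewrite (rnorm_dist x (u n)).
have := HN _ Nm; have := HN _ Nn; lra.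
Qed.

Lemma tends_ler u x (M : R) N : tends u x -> (forall n, (N <= n)%N -> rnorm (u n) <= M) ->
  rnorm x <= M.
Proof.
move=> ux uM; apply/ler_addgt0Pr => e e0; have [N' HN'] := ux _ e0.
have := HN' _ (leq_maxr N N'); have := uM _ (leq_maxl N N').
have := rnorm_sub_ge x (u (maxn N N')); rewrite rnorm_dist; lra.
Qed.

Lemma tendsD u v x y : tends u x -> tends v y -> tends (fun n => u n + v n) (x + y).
Proof.
move=> ux vy e e0; have e2 : 0 < e / 2 by rewrite divr_gt0.
have [N HN] := ux _ e2; have [N' HN'] := vy _ e2.
exists (maxn N N') => n; rewrite geq_max => /andP[/HN h /HN' h'].
by rewrite opprD addrACA; have := rnormD (u n - x) (v n - y); lra.
Qed.

Lemma tends_shift u x k : tends u x -> tends (fun n => u (n + k)%N) x.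
Proof.
move=> ux e e0; have [N HN] := ux _ e0; exists N => n Nn; apply: HN.
by rewrite (leq_trans Nn)// leq_addr.
Qed.

End Zmod.

Lemma tends_lip (V W : normedZmodType R[i]) (u : nat -> V) (v : nat -> W) x y (C : R) N :
  0 <= C -> (forall n, (N <= n)%N -> rnorm (v n - y) <= C * rnorm (u n - x)) ->
  tends u x -> tends v y.
Proof.
move=> C0 h ux e e0; have C1 : 0 < C + 1 by lra.
have [N' HN'] := ux (e / (C + 1)) (divr_gt0 e0 C1).
exists (maxn N N') => n; rewrite geq_max => /andP[Nn /HN' hn].
apply: le_trans (h n Nn) _.
apply: le_trans (_ : (C + 1) * rnorm (u n - x) <= _).
  by apply: ler_wpM2r; [exact: rnorm_ge0|lra].
by rewrite mulrC -ler_pdivlMr.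
Qed.

Lemma rcauchy_lip (V W : normedZmodType R[i]) (u : nat -> V) (v : nat -> W) (C : R) :
  0 <= C -> (forall m n, rnorm (v m - v n) <= C * rnorm (u m - u n)) ->
  rcauchy u -> rcauchy v.
Proof.
move=> C0 h uc e e0; have C1 : 0 < C + 1 by lra.
have [N HN] := uc (e / (C + 1)) (divr_gt0 e0 C1).
exists N => m n Nm Nn; apply: le_trans (h m n) _.
apply: le_trans (_ : (C + 1) * rnorm (u m - u n) <= _).
  by apply: ler_wpM2r; [exact: rnorm_ge0|lra].
by rewrite mulrC -ler_pdivlMr// HN.
Qed.

Lemma rnormM (a b : R[i]) : rnorm (a * b) = rnorm a * rnorm b.
Proof. by apply: complexI; rewrite rmorphM/= -!rnormE normrM. Qed.

Lemma rnormJ (a : R[i]) : rnorm (Num.conj a) = rnorm a.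
Proof. by apply: complexI; rewrite -!rnormE norm_conjC. Qed.

Lemma rnormC (a : R) : rnorm (a%:C%C : R[i]) = `|a|.
Proof. by rewrite /rnorm normc_def/= expr0n addr0 sqrtr_sqr. Qed.

Lemma rnorm1 : rnorm (1 : R[i]) = 1.
Proof. by rewrite -(rmorph1 (real_complex R)) rnormC normr1. Qed.

Lemma rnorm_Re (a : R[i]) : `|complex.Re a| <= rnorm a.
Proof. by rewrite -lecR -rnormE normc_ge_Re. Qed.

Lemma rnorm_Im (a : R[i]) : `|complex.Im a| <= rnorm a.
Proof.
by rewrite /rnorm normc_def/= -sqrtr_sqr; apply: ler_wsqrtr; rewrite lerDr sqr_ge0.
Qed.

Lemma rnorm_ReIm (a : R[i]) : rnorm a <= `|complex.Re a| + `|complex.Im a|.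
Proof.
case: a => x y; rewrite /rnorm normc_def/=.
rewrite -[leRHS]ger0_norm ?addr_ge0//.
rewrite -sqrtr_sqr; apply: ler_wsqrtr; rewrite sqrrD !real_normK ?num_real//.
by rewrite [leRHS]addrAC lerDl mulrn_wge0// mulr_ge0.
Qed.

Lemma rcauchy_real (u : nat -> R) : (forall e, 0 < e -> exists N, forall m n,
  (N <= m)%N -> (N <= n)%N -> `|u m - u n| <= e) -> cvgn u.
Proof.
move=> uc; apply/cauchy_cvgP/cauchy_exP => e e0.
have e2 : 0 < e / 2 by rewrite divr_gt0.
have [N HN] := uc _ e2; exists (u N); exists N => // n /= Nn.
rewrite /ball/= (le_lt_trans (HN N n _ _))//; lra.
Qed.

Lemma rcauchy_complex (u : nat -> R[i]) : rcauchy u -> exists x, tends u x.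
Proof.
move=> uc.
have cRe : cvgn (fun n => complex.Re (u n)).
  apply: rcauchy_real => e e0; have [N HN] := uc e e0; exists N => m n Nm Nn.
  by rewrite (le_trans _ (HN m n Nm Nn))// -raddfB rnorm_Re.
have cIm : cvgn (fun n => complex.Im (u n)).
  apply: rcauchy_real => e e0; have [N HN] := uc e e0; exists N => m n Nm Nn.
  by rewrite (le_trans _ (HN m n Nm Nn))// -raddfB rnorm_Im.
exists (Complex (limn (fun n => complex.Re (u n))) (limn (fun n => complex.Im (u n)))) => e e0.
have e2 : 0 < e / 2 by rewrite divr_gt0.
have [N _ HN] := (cvgrPdist_le _ _).1 cRe _ e2.
have [N' _ HN'] := (cvgrPdist_le _ _).1 cIm _ e2.
exists (maxn N N') => n; rewrite geq_max => /andP[/HN/= h /HN'/= h'].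
rewrite rnorm_dist; apply: le_trans (rnorm_ReIm _) _.
by move: h h'; case: (u n) => x y /=; lra.
Qed.

Section NormedMod.
Context {V : normedModType R[i]}.
Implicit Types (x y : V) (u v : nat -> V).

Lemma rnormZ (a : R[i]) x : rnorm (a *: x) = rnorm a * rnorm x.
Proof. by apply: complexI; rewrite rmorphM/= -!rnormE normrZ. Qed.

Lemma tends_cvg u x : u @ \oo --> x <-> tends u x.
Proof.
split=> [/cvgrPdistC_le ux e e0|ux].
  have [|N _ HN] := ux e%:C%C; first by rewrite ltcR.
  by exists N => n /HN; rewrite le_rnorm.
(* A positive element of [R[i]] has zero imaginary part, so complex radii reduce to real ones. *)
apply/cvgrPdistC_le => e; rewrite ltcE/= => /andP[/eqP ei e0].
have [N HN] := ux _ e0; exists N => // n /HN; rewrite -le_rnorm => /le_trans; apply.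
by rewrite lecE/= ei eqxx lexx.
Qed.

Lemma tends_limn u x : tends u x -> limn u = x.
Proof. by move/tends_cvg => /cvg_lim; apply. Qed.

Lemma tends_cvgn u x : tends u x -> cvgn u.
Proof. by move/tends_cvg => ux; apply/cvg_ex; exists x. Qed.

Lemma tendsZ (a : R[i]) u x : tends u x -> tends (fun n => a *: u n) (a *: x).
Proof.
apply: (tends_lip (C := rnorm a) (N := 0%N)) => [|n _]; first exact: rnorm_ge0.
by rewrite -scalerBr rnormZ.
Qed.

End NormedMod.

Lemma rcauchy_cvg (V : completeNormedModType R[i]) (u : nat -> V) : rcauchy u -> exists x, tends u x.
Proof.
move=> uc; suff /cvg_ex[x /tends_cvg ux] : cvgn u by exists x.
apply/cauchy_cvgP/cauchy_exP => e; rewrite ltcE/= => /andP[/eqP ei e0].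
have e2 : 0 < complex.Re e / 2 by rewrite divr_gt0.
have [N HN] := uc _ e2; exists (u N); exists N => // n /= Nn.
rewrite /fmapE -ball_normE /ball_/= rnormE ltcE/= ei eqxx/=.
by apply: le_lt_trans (HN N n _ _) _ => //; lra.
Qed.

End RealNorm.

Section LpNorm.
Context {R : realType}.
Variables (p : R) (p1 : 1 <= p) (mu : R -> R) (mu_ge0 : forall n : nat, 0 <= mu n.+1%:R).
Implicit Types (a : nat -> R[i]) (M : R).

Definition wabs a n : R := rnorm (a n) * mu n.+1%:R.

Lemma wabs_ge0 a n : 0 <= wabs a n. Proof. by rewrite mulr_ge0 ?rnorm_ge0. Qed.

Let p0 : 0 < p. Proof. by rewrite (lt_le_trans ltr01). Qed.

Lemma lp_normE a : lp_norm p mu a = ((\sum_(0 <= n <oo) (wabs a n `^ p)%:E) `^ p^-1)%E.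
Proof.
rewrite /lp_norm; congr (_ `^ _)%E; apply: eq_eseriesr => n _.
by rewrite /wabs powRM ?rnorm_ge0.
Qed.

Lemma lp_norm_ge0 a : (0 <= lp_norm p mu a)%E.
Proof. exact: poweR_ge0. Qed.

Lemma lp_norm_le a M : 0 <= M -> (lp_norm p mu a <= M%:E)%E <-> lple p (wabs a) M.
Proof.
move=> M0; rewrite lp_normE.
have s0 : (0 <= \sum_(0 <= n <oo) (wabs a n `^ p)%:E)%E.
  by apply: nneseries_ge0 => n _ _; rewrite lee_fin powR_ge0.
have e1 : ((\sum_(0 <= n <oo) (wabs a n `^ p)%:E) `^ p^-1 <= M%:E)%E <->
   (\sum_(0 <= n <oo) (wabs a n `^ p)%:E <= (M `^ p)%:E)%E.
  split=> h.
    have := @gt0_ler_poweR R p (ltW p0) _ _ _ _ h.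
    rewrite !in_itv/= !leey !andbT poweR_ge0 lee_fin M0 => /(_ isT isT).
    by rewrite -poweRrM mulVf ?gt_eqF// poweRe1.
  have p0' : 0 <= p^-1 by rewrite invr_ge0 ltW.
  have := @gt0_ler_poweR R p^-1 p0' _ _ _ _ h.
  rewrite !in_itv/= !leey !andbT s0 lee_fin powR_ge0 => /(_ isT isT).
  by rewrite -powRrM mulfV ?gt_eqF// powRr1.
rewrite e1; split=> [h L|h].
  rewrite -lee_fin -sumEFin; apply: le_trans h.
  by apply: nneseries_lim_ge => n _ _; rewrite lee_fin powR_ge0.
apply: lime_le; first by apply: is_cvg_nneseries => n _ _; rewrite lee_fin powR_ge0.
by apply: nearW => L; rewrite sumEFin lee_fin; exact: h.
Qed.

Lemma lp_norm_fin a : (lp_norm p mu a < +oo)%E ->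
  exists M, [/\ 0 <= M, lp_norm p mu a = M%:E & lple p (wabs a) M].
Proof.
have := lp_norm_ge0 a; case E : (lp_norm p mu a) => [M| |]// M0 _.
by exists M; split=> //; apply/lp_norm_le => //; rewrite E.
Qed.

Lemma lp_norm_lty a M : 0 <= M -> lple p (wabs a) M -> (lp_norm p mu a < +oo)%E.
Proof. by move=> M0 /lp_norm_le h; apply: le_lt_trans (h M0) (ltry _). Qed.

End LpNorm.

(** * Frames and Riesz bases *)

Section Dot.
Context {R : realType} {H : completeNormedModType R[i]}.
Variable dot : {dot H for Num.conj}.
Hypothesis dotE : forall x : H, `|x| ^+ 2 = dot x x.
Implicit Types (x y f h : H) (e : nat -> H) (c : nat -> R[i]).

Lemma dotDl x y z : dot (x + y) z = dot x z + dot y z.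
Proof. exact: linearDl. Qed.

Lemma dotZl a x z : dot (a *: x) z = a * dot x z.
Proof. exact: linearZl_LR. Qed.

Lemma dotC x y : dot x y = Num.conj (dot y x).
Proof. by rewrite hermC expr0 mul1r. Qed.

Lemma dotZr a x z : dot z (a *: x) = Num.conj a * dot z x.
Proof. exact: linearZr_LR. Qed.

Lemma dotBl x y z : dot (x - y) z = dot x z - dot y z.
Proof. exact: linearBl. Qed.

Lemma dotBr x y z : dot z (x - y) = dot z x - dot z y.
Proof. exact: linearBr. Qed.

Lemma dot_suml (F : nat -> H) m n z :
  dot (\sum_(m <= i < n) F i) z = \sum_(m <= i < n) dot (F i) z.
Proof. exact: linear_sumlz. Qed.

Lemma rnorm_dotC x y : rnorm (dot x y) = rnorm (dot y x).
Proof. by rewrite dotC rnormJ. Qed.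

Lemma rnorm_sqr x : ((rnorm x) ^+ 2)%:C%C = dot x x.
Proof. by rewrite rmorphXn/= -rnormE dotE. Qed.

Lemma rnorm_mulJ (a : R[i]) : a * Num.conj a = (rnorm a ^+ 2)%:C%C.
Proof. by rewrite rmorphXn/= -rnormE normCK. Qed.

Lemma conj_real (a : R) : Num.conj (a%:C%C) = a%:C%C :> R[i].
Proof. by apply: CrealP; rewrite complex_real. Qed.

(** Expand the squared norm of [|y|^2 x - <x, y> y], which involves no division. *)
Lemma cauchy_schwarz x y : rnorm (dot x y) <= rnorm x * rnorm y.
Proof.
have [y0|y0] := leP (rnorm y) 0.
  by rewrite (rnorm_eq0 y0) linear0r !rnorm0 mulr0.
pose a := dot x y; pose z := ((rnorm y ^+ 2)%:C)%C *: x - a *: y.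
have : (rnorm z ^+ 2)%:C%C = (rnorm y ^+ 2 * (rnorm y ^+ 2 * rnorm x ^+ 2 - rnorm a ^+ 2))%:C%C :> R[i].
  rewrite rnorm_sqr /z dotBl !dotBr !dotZl !dotZr -!rnorm_sqr conj_real.
  have toC u v w : (u * (u * v - w))%:C%C = u%:C%C * (u%:C%C * v%:C%C - w%:C%C) :> R[i].
    by rewrite -rmorphM -rmorphB -rmorphM.
  rewrite (dotC y x) -/a toC -rnorm_mulJ.
  by move: (Num.conj a) => b; ring.
move=> /complexI zE.
have : 0 <= rnorm y ^+ 2 * rnorm x ^+ 2 - rnorm a ^+ 2.
  by rewrite -(pmulr_rge0 _ (exprn_gt0 2 y0)) -zE sqr_ge0.
rewrite subr_ge0 -exprMn mulrC ler_pXn2r// ?nnegrE ?mulr_ge0 ?rnorm_ge0//.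
Qed.

Lemma dot_tendsl (u : nat -> H) x y : tends u x -> tends (fun n => dot (u n) y) (dot x y).
Proof.
apply: (tends_lip (C := rnorm y) (N := 0%N)) => [|n _]; first exact: rnorm_ge0.
by rewrite -dotBl mulrC cauchy_schwarz.
Qed.

Lemma dot_tendsr (u : nat -> H) x y : tends u x -> tends (fun n => dot y (u n)) (dot y x).
Proof.
apply: (tends_lip (C := rnorm y) (N := 0%N)) => [|n _]; first exact: rnorm_ge0.
by rewrite -dotBr cauchy_schwarz.
Qed.

Definition energy c n : R := rnorm (c n) ^+ 2.

Definition bessel e (B : R) :=
  forall f, sums_le (energy (analysis dot e f)) (B * rnorm f ^+ 2).

Definition synth_bound e (B : R) := forall c m n,
  rnorm (\sum_(m <= i < n) c i *: e i) ^+ 2 <= B * \sum_(m <= i < n) energy c i.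

Lemma dot_synth c e m n h :
  dot (\sum_(m <= i < n) c i *: e i) h = \sum_(m <= i < n) c i * dot (e i) h.
Proof. by rewrite dot_suml; apply: eq_bigr => i _; rewrite dotZl. Qed.

(** Write [|h|^2] as the sum of [c i <e i, h>]. The weight [B] in the arithmetic-geometric mean
    inequality makes the second half at most [|h|^2 / 2], which is absorbed on the left. *)
Lemma bessel_synth e B : 0 < B -> bessel e B -> synth_bound e B.
Proof.
move=> B0 eB c m n; set h := \sum_(_ <= _ < _) _.
have : rnorm h ^+ 2 <= \sum_(m <= i < n) (B * energy c i + B^-1 * rnorm (dot h (e i)) ^+ 2) / 2.
  rewrite -(ger0_norm (sqr_ge0 (rnorm h))) -rnormC rnorm_sqr {1}/h dot_synth.
  apply: le_trans (rnorm_sum _ _ _) _; apply: ler_sum => i _.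
  rewrite rnormM (rnorm_dotC (e i)) /energy.
  set x := rnorm (c i); set y := rnorm _.
  have := sqr_ge0 (B * x - y); rewrite -(pmulr_rge0 _ (x := B^-1)) ?invr_gt0//.
  have -> : B^-1 * (B * x - y) ^+ 2 = B * x ^+ 2 + B^-1 * y ^+ 2 - 2 * (x * y).
    by field; rewrite gt_eqF.
  lra.
rewrite -mulr_suml big_split/= -!mulr_sumr.
have : \sum_(m <= i < n) rnorm (dot h (e i)) ^+ 2 <= B * rnorm h ^+ 2.
  have [nm|/ltnW mn] := leqP n m; first by rewrite big_geq// mulr_ge0 ?sqr_ge0// ltW.
  apply: le_trans (eB h n); rewrite [leRHS](@big_cat_nat _ _ _ m)//= lerDr.
  by apply: sumr_ge0 => i _; exact: sqr_ge0.
rewrite -(ler_pM2l (x := B^-1)) ?invr_gt0// mulKf ?gt_eqF//; lra.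
Qed.

(** Synthesize from the coefficients of [f] itself: their energy [s] equals [<h, f>], while
    [|h|^2 <= B s]. *)
Lemma synth_bessel e B : 0 < B -> synth_bound e B -> bessel e B.
Proof.
move=> B0 eB f L; set s := \sum_(_ <= _ < _) _.
have := eB (analysis dot e f) 0%N L; rewrite -/s; set h := \sum_(_ <= _ < _) _ => hB.
have sh : s <= rnorm f * rnorm h.
  apply: le_trans (cauchy_schwarz f h).
  rewrite rnorm_dotC /h dot_synth.
  rewrite (_ : \sum_(_ <= _ < _) _ = s%:C%C); first by rewrite rnormC ler_norm.
  rewrite /s raddf_sum/=; apply: eq_bigr => i _.
  by rewrite (dotC (e i)) rnorm_mulJ.
have f0 := rnorm_ge0 f; have h0 := rnorm_ge0 h.
have := sqr_ge0 (B * rnorm f - rnorm h); nra.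
Qed.

Lemma sums_le_cauchy (b : nat -> R) D : (forall n, 0 <= b n) -> sums_le b D ->
  forall eps, 0 < eps -> exists N, forall m n, (N <= m)%N -> \sum_(m <= i < n) b i <= eps.
Proof.
move=> b0 bD eps e0.
have [|N HN] := @lple_tail R 1 (lexx 1) b D b0 _ eps e0.
  have D0 := sums_le_ge0 bD.
  by move=> L; rewrite powRr1//; under eq_bigr do rewrite powRr1//; exact: bD.
exists N => m n Nm.
have [nm|mn] := leqP n m; first by rewrite big_geq// ltW.
have := HN (fun i => if (m <= i)%N then b i else 0) _ _ n.
rewrite powRr1 ?(ltW e0)//.
have -> : \sum_(0 <= k < n) (if (m <= k)%N then b k else 0) `^ 1 = \sum_(m <= i < n) b i.
  rewrite (@big_cat_nat _ _ _ m) ?(ltnW mn)//= big_nat big1 ?add0r; last first.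
    by move=> i /andP[_ im]; rewrite leqNgt im/= powRr1.
  by apply: eq_big_nat => i /andP[mi _]; rewrite mi powRr1.
apply=> i; first by case: ifP; rewrite ?lexx b0.
by move=> iN; rewrite leqNgt (leq_trans iN Nm).
Qed.

Lemma sum_tail (F : nat -> H) m n : (m <= n)%N ->
  series F n - series F m = \sum_(m <= i < n) F i.
Proof. by move=> mn; rewrite sub_series_geq. Qed.

Lemma synth_cvg e B c D : 0 <= B -> synth_bound e B -> sums_le (energy c) D ->
  exists x, tends (series (fun n => c n *: e n)) x.
Proof.
move=> B0 eB cD; apply: rcauchy_cvg => eps e0.
have e1 : 0 < eps ^+ 2 / (B + 1) by rewrite divr_gt0 ?exprn_gt0//; lra.
have [|N HN] := sums_le_cauchy _ cD e1; first by move=> n; rewrite sqr_ge0.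
have key m n : (N <= m)%N -> (m <= n)%N ->
    rnorm (series (fun n => c n *: e n) n - series (fun n => c n *: e n) m) <= eps.
  move=> Nm mn; rewrite sum_tail// -(@ler_pXn2r _ 2)// ?nnegrE ?rnorm_ge0 ?(ltW e0)//.
  apply: le_trans (eB c m n) _; have := HN m n Nm.
  rewrite ler_pdivlMr; last lra.
  have : 0 <= \sum_(m <= i < n) energy c i by apply: sumr_ge0 => i _; exact: sqr_ge0.
  by nra.
exists N => m n Nm Nn; have [mn|/ltnW nm] := leqP m n.
  by rewrite rnorm_dist key.
exact: key.
Qed.

(* Sokal's form of the uniform boundedness principle: the vectors
   [x (n+1) = x n +- 3^(-n) f n / |f n|] can be chosen so that
   [<x (n+1), f n>] is at least [3^(-n) |f n|] in absolute value. *)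
Lemma weakly_bounded (F : set H) :
  (forall h, exists M, forall f, F f -> rnorm (dot h f) <= M) ->
  exists M, forall f, F f -> rnorm f <= M.
Proof.
move=> wb; apply: contrapT => nb.
have /choice[f fP] : forall n : nat, exists f, F f /\ 4 ^+ n < rnorm f.
  move=> n; apply: contrapT => nf; apply: nb; exists (4 ^+ n) => f Ff.
  by rewrite leNgt; apply/negP => fn; apply: nf; exists f.
have f0 n : 0 < rnorm (f n) by apply: lt_trans (fP n).2; rewrite exprn_gt0.
pose v n : H := ((3 ^- n / rnorm (f n))%:C)%C *: f n.
have vn n : rnorm (v n) = 3 ^- n.
  rewrite /v rnormZ rnormC ger0_norm; first by rewrite divfK// gt_eqF.
  by rewrite divr_ge0 ?invr_ge0 ?exprn_ge0// ltW.
have vf n : rnorm (dot (v n) (f n)) = 3 ^- n * rnorm (f n).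
  rewrite /v dotZl -rnorm_sqr -rmorphM rnormC ger0_norm.
    by rewrite expr2 mulrA divfK// gt_eqF.
  by rewrite mulr_ge0 ?sqr_ge0// divr_ge0 ?invr_ge0 ?exprn_ge0// ltW.
pose step n x := if 3 ^- n * rnorm (f n) <= rnorm (dot (x + v n) (f n))
                 then x + v n else x - v n.
pose x := fix x n := if n is k.+1 then step k (x k) else 0.
have xS n : x n.+1 = step n (x n) by [].
have stepd n : rnorm (x n.+1 - x n) = 3 ^- n.
  rewrite xS /step; case: ifP => _; first by rewrite addrAC subrr add0r.
  by rewrite addrAC subrr add0r rnormN.
have stepf n : 3 ^- n * rnorm (f n) <= rnorm (dot (x n.+1) (f n)).
  rewrite xS /step; case: ifPn => //; rewrite -ltNge => lt.
  (* The two candidates differ by [2 v n], so their products with [f n] cannot both be small. *)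
  have := rnormB (dot (x n + v n) (f n)) (dot (x n - v n) (f n)).
  rewrite -dotBl (_ : x n + v n - (x n - v n) = 2%:R *: v n); last first.
    by rewrite opprD opprK addrACA subrr add0r scaler_nat mulr2n.
  rewrite dotZl rnormM vf (_ : rnorm (2%:R : R[i]) = 2); last first.
    by rewrite -(rmorph_nat (real_complex R)) rnormC ger0_norm.
  lra.
have p3 n : 3 ^- n.+1 = 3 ^- n / 3 :> R by rewrite exprSr invfM.
have xd m n : (m <= n)%N -> rnorm (x n - x m) <= 3 ^- m * (3 / 2).
  move=> mn; have : rnorm (x n - x m) <= (3 ^- m - 3 ^- n) * (3 / 2).
    elim: n mn => [|n ih]; first by rewrite leqn0 => /eqP->; rewrite !subrr rnorm0 mul0r.
    rewrite leq_eqVlt => /predU1P[->|]; first by rewrite !subrr rnorm0 mul0r.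
    rewrite ltnS => /ih {}ih.
    have := rnorm_distD (x n) (x n.+1) (x m); rewrite stepd.
    by rewrite p3; lra.
  have : 0 < 3 ^- n :> R by rewrite invr_gt0 exprn_gt0.
  lra.
have x3 (e : R) : 0 < e -> exists N, forall m, (N <= m)%N -> 3 ^- m * (3 / 2) <= e.
  move=> e0.
  have h : (3^-1) ^+ n * (3 / 2) @[n --> \oo] --> (0 : R).
    rewrite -[X in _ --> X](mul0r (3 / 2)); apply: cvgMl.
    by apply: cvg_expr; rewrite ger0_norm//; lra.
  have [N _ HN] := cvgr_le _ h _ e0.
  by exists N => m /HN; rewrite exprVn.
have [y xy] : exists y, tends x y.
  apply: rcauchy_cvg => e /x3[N HN]; exists N => m n Nm Nn.
  have [mn|/ltnW nm] := leqP m n; last exact: le_trans (xd _ _ nm) (HN _ Nn).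
  by rewrite rnorm_dist; exact: le_trans (xd _ _ mn) (HN _ Nm).
have [M HM] := wb y.
(* All later corrections together have norm at most [3^(-n) / 2], so half of the gain made at stage
   [n] survives in the limit [y]. *)
have low n : (4 / 3) ^+ n / 2 <= M.
  apply: le_trans (HM _ (fP n).1).
  have yx : rnorm (y - x n.+1) <= 3 ^- n.+1 * (3 / 2).
    have := tends_shift n.+1 xy => /(tendsD (tends_cst (- x n.+1))).
    rewrite (addrC _ y); move/(tends_ler (N := 0%N)); apply=> k _.
    by rewrite addrC; apply: xd; rewrite leq_addl.
  have := rnorm_sub_ge (dot (x n.+1) (f n)) (dot y (f n)).
  rewrite -dotBl => h.
  have := cauchy_schwarz (f n) (x n.+1 - y); rewrite (rnorm_dist (x n.+1)) rnorm_dotC.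
  have s := stepf n.
  have : rnorm (f n) * rnorm (y - x n.+1) <= rnorm (f n) * (3 ^- n.+1 * (3 / 2)).
    by rewrite ler_wpM2l// ltW.
  have -> : rnorm (f n) * (3 ^- n.+1 * (3 / 2)) = 3 ^- n * rnorm (f n) / 2 :> R.
    by rewrite p3; field.
  have : (4 / 3) ^+ n <= 3 ^- n * rnorm (f n).
    rewrite expr_div_n mulrC ler_wpM2l ?invr_ge0 ?exprn_ge0//.
    exact: ltW (fP n).2.
  by lra.
have : \forall n \near \oo, (2 * `|M| + 1) <= (4 / 3) ^+ n :> R.
  have h : (3 / 4) ^+ n @[n --> \oo] --> (0 : R).
    by apply: cvg_expr; rewrite ger0_norm//; lra.
  have e1 : 0 < 2 * `|M| + 1 by rewrite ltr_wpDl// mulr_ge0.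
  have e0 : 0 < (2 * `|M| + 1)^-1 by rewrite invr_gt0.
  have h43 n : 0 < (4 / 3) ^+ n :> R by rewrite exprn_gt0//; lra.
  near=> n.
  have : (3 / 4) ^+ n <= (2 * `|M| + 1)^-1 by near: n; exact: cvgr_le h _ e0.
  by rewrite -[3 / 4]invf_div exprVn lef_pV2 ?posrE.
move=> [n _ /(_ n (leqnn n))/= hn].
by have := low n; have := ler_norm M; lra.
Unshelve. all: by end_near. Qed.

End Dot.

Section Frames.
Context {R : realType} {H : completeNormedModType R[i]}.
Variable dot : {dot H for Num.conj}.
Hypothesis dotE : forall x : H, `|x| ^+ 2 = dot x x.
Implicit Types (x y f h : H).

Definition lower_bound (e : nat -> H) (A : R) :=
  forall f D, sums_le (energy (analysis dot e f)) D -> A * rnorm f ^+ 2 <= D.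

Lemma frame_bounds (e : nat -> H) : frame dot e ->
  exists A B, [/\ 0 < A, 0 < B, bessel dot e B & lower_bound e A].
Proof.
move=> [A [B [A0 B0 AB]]]; exists A, B; split=> // f.
  move=> L; rewrite -lee_fin; apply: le_trans (AB f).2; rewrite -sumEFin.
  by apply: nneseries_lim_ge => n _ _; rewrite lee_fin sqr_ge0.
move=> D fD; rewrite -lee_fin; apply: le_trans (AB f).1 _.
apply: lime_le; first by apply: is_cvg_nneseries => n _ _; rewrite lee_fin sqr_ge0.
by apply: nearW => L; rewrite sumEFin lee_fin; exact: fD.
Qed.

Section Frame.
Variables (e : nat -> H) (A B : R).
Hypotheses (A0 : 0 < A) (B0 : 0 < B) (eB : bessel dot e B) (eA : lower_bound e A).

Let U := analysis dot e.
Let S := frame_operator dot e.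

Let synB : synth_bound e B. Proof. exact: bessel_synth. Qed.

Lemma frame_operator_tends f : tends (series (fun n => U f n *: e n)) (S f).
Proof.
have [x fx] := synth_cvg (ltW B0) synB (eB f).
by rewrite /S /frame_operator /synthesis (tends_limn fx).
Qed.

Lemma frame_operator_lin a f h : S (a *: f + h) = a *: S f + S h.
Proof.
apply: tends_unique (frame_operator_tends _) _.
have := tendsD (tendsZ a (frame_operator_tends f)) (frame_operator_tends h).
congr tends; apply/funext => n; rewrite /series/= scaler_sumr -big_split/=.
by apply: eq_bigr => i _; rewrite /U /analysis dotDl dotZl scalerDl scalerA.
Qed.

Lemma frame_operatorB x y : S (x - y) = S x - S y.
Proof.
have := frame_operator_lin (-1) y x.
by rewrite !scaleN1r (addrC (- y)) (addrC (- S y)).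
Qed.

Lemma frame_operator_dot f h :
  tends (fun n => \sum_(0 <= i < n) dot f (e i) * dot (e i) h) (dot (S f) h).
Proof.
have := dot_tendsl dotE h (frame_operator_tends f).
by congr tends; apply/funext => n; rewrite /series/= dot_synth.
Qed.

Lemma frame_operator_sym f h : dot (S f) h = dot f (S h).
Proof.
apply: tends_unique (frame_operator_dot f h) _.
have := dot_tendsr dotE f (frame_operator_tends h); congr tends; apply/funext => n.
rewrite /series/= dotC dot_synth rmorph_sum; apply: eq_bigr => i _.
by rewrite rmorphM/= /U /analysis -!dotC mulrC.
Qed.

Let q f := complex.Re (dot (S f) f).

Lemma frame_operator_energy f : sums_le (energy (U f)) (q f).
Proof.
move=> L; apply/ler_addgt0Pr => eps e0.
have [N HN] := frame_operator_dot f f e0; have := HN (maxn L N) (leq_maxr _ _).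
have -> : \sum_(0 <= i < maxn L N) dot f (e i) * dot (e i) f =
   (\sum_(0 <= i < maxn L N) energy (U f) i)%:C%C.
  by rewrite raddf_sum/=; apply: eq_bigr => i _; rewrite (dotC dot (e i)) rnorm_mulJ.
move=> /(le_trans (rnorm_Re _)); rewrite raddfB/= -/(q f) => h.
have : \sum_(0 <= i < L) energy (U f) i <= \sum_(0 <= i < maxn L N) energy (U f) i.
  rewrite [leRHS](@big_cat_nat _ _ _ L) ?leq_maxl//= lerDl sumr_ge0// => i _.
  exact: sqr_ge0.
have := ler_norm (\sum_(0 <= i < maxn L N) energy (U f) i - q f); lra.
Qed.

Lemma frame_operator_lower f : A * rnorm f ^+ 2 <= q f.
Proof. exact/eA/frame_operator_energy. Qed.

Let q_ge0 f : 0 <= q f. Proof. exact: sums_le_ge0 (frame_operator_energy f). Qed.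

Lemma frame_operator_upper f : rnorm (S f) ^+ 2 <= B * q f.
Proof.
have Bq : 0 <= B * q f by rewrite mulr_ge0 ?q_ge0// ltW.
rewrite -(sqr_sqrtr Bq) ler_pXn2r ?nnegrE ?rnorm_ge0 ?sqrtr_ge0//.
apply: (tends_ler (N := 0%N) (frame_operator_tends f)) => n _.
rewrite -(ler_pXn2r (n := 2)) ?nnegrE ?rnorm_ge0 ?sqrtr_ge0// sqr_sqrtr//.
apply: le_trans (synB _ _ _) _.
by rewrite ler_wpM2l ?(ltW B0)//; exact: frame_operator_energy.
Qed.

Definition frame_residual f : H := f - (B^-1)%:C%C *: S f.

Let Q := frame_residual.

Lemma rnorm_sqrE x : rnorm x ^+ 2 = complex.Re (dot x x).
Proof. by rewrite -(rnorm_sqr dotE). Qed.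

(** Contraction without spectral theory: [|Q f|^2 = |f|^2 - 2 q f / B + |S f|^2 / B^2], where
    [|S f|^2 <= B q f] and [q f >= A |f|^2], is at most [(1 - A/B) |f|^2]. *)
Lemma frame_residual_le : exists2 r, 0 < r < 1 & forall f, rnorm (Q f) <= r * rnorm f.
Proof.
(* The maximum with 1/4 keeps the ratio positive, even for a tight frame. *)
pose s := Num.max (1 - A / B) (4^-1).
have AB : 0 < A / B by rewrite divr_gt0.
have s0 : 0 < s by rewrite /s lt_max [X in _ || X](_ : _ = true) ?orbT//; lra.
have s1 : s < 1 by rewrite /s gt_max; apply/andP; split; lra.
have s2 : 1 - A / B <= s by rewrite /s le_max lexx.
exists (Num.sqrt s).
  by rewrite sqrtr_gt0 s0 /= -[X in _ < X]sqrtr1 ltr_sqrt.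
move=> f; rewrite -(ler_pXn2r (n := 2)) ?nnegrE ?mulr_ge0 ?rnorm_ge0 ?sqrtr_ge0//.
rewrite exprMn sqr_sqrtr ?(ltW s0)//.
have toC (u v w b : R) : u%:C%C - b%:C%C * v%:C%C - (b%:C%C * v%:C%C - b%:C%C * (b%:C%C * w%:C%C)) =
    (u - 2 * b * v + b ^+ 2 * w)%:C%C :> R[i].
  rewrite (_ : u - 2 * b * v + b ^+ 2 * w = u - b * v - (b * v - b * (b * w))); last by ring.
  by rewrite !(rmorphB (real_complex R)) !(rmorphM (real_complex R)).
have -> : rnorm (Q f) ^+ 2 = rnorm f ^+ 2 - 2 * B^-1 * q f + B^-1 ^+ 2 * rnorm (S f) ^+ 2.
  apply: complexI; rewrite (rnorm_sqr dotE) /Q /frame_residual dotBl !dotBr !dotZl !dotZr.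
  rewrite conj_real -frame_operator_sym -!(rnorm_sqr dotE).
  have -> : dot (S f) f = (q f)%:C%C.
    rewrite /q RRe_real//; apply/CrealP; rewrite -dotC.
    by rewrite frame_operator_sym.
  exact: toC.
have := frame_operator_upper f; have := frame_operator_lower f.
have Bi : 0 < B^-1 by rewrite invr_gt0.
move=> lo up.
have up' : B^-1 ^+ 2 * rnorm (S f) ^+ 2 <= B^-1 * q f.
  apply: le_trans (_ : B^-1 ^+ 2 * (B * q f) <= _); first by rewrite ler_wpM2l ?sqr_ge0.
  by rewrite expr2 -mulrA mulKf ?gt_eqF.
have lo' : A / B * rnorm f ^+ 2 <= B^-1 * q f.
  by rewrite mulrAC -mulrC [X in _ <= X]mulrC mulrC ler_wpM2r ?(ltW Bi).
have := ler_wpM2r (sqr_ge0 (rnorm f)) s2.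
by lra.
Qed.

Lemma frame_residual_lin a f h : Q (a *: f + h) = a *: Q f + Q h.
Proof.
rewrite /Q /frame_residual frame_operator_lin scalerDr scalerBr opprD addrACA.
by rewrite !scalerA mulrC.
Qed.

Lemma frame_residual_iter_lin n a f h :
  iter n Q (a *: f + h) = a *: iter n Q f + iter n Q h.
Proof. by elim: n => [|n ih] //=; rewrite ih frame_residual_lin. Qed.

Lemma frame_residual_iter (r : R) (r01 : 0 < r < 1) (Qr : forall f, rnorm (Q f) <= r * rnorm f) n f :
  rnorm (iter n Q f) <= r ^+ n * rnorm f.
Proof.
elim: n => [|n ih] /=; first by rewrite expr0 mul1r.
apply: le_trans (Qr _) _; rewrite exprS -mulrA; apply: ler_wpM2l => //; lra.
Qed.

Lemma frame_operator_below (r : R) (r01 : 0 < r < 1) (Qr : forall f, rnorm (Q f) <= r * rnorm f) f :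
  (1 - r) * B * rnorm f <= rnorm (S f).
Proof.
have h : rnorm f - rnorm (Q f) <= B^-1 * rnorm (S f).
  apply: le_trans (rnorm_sub_ge _ _) _.
  rewrite /Q /frame_residual subKr rnormZ rnormC ger0_norm ?invr_ge0 ?(ltW B0)//.
have : (1 - r) * rnorm f <= B^-1 * rnorm (S f) by have := Qr f; lra.
by rewrite ler_pdivlMl// mulrCA mulrA.
Qed.

Lemma frame_operator_le f : rnorm (S f) <= 2 * B * rnorm f.
Proof.
have [r r01 Qr] := frame_residual_le.
have := rnormB f (Q f); rewrite /Q /frame_residual subKr rnormZ rnormC.
rewrite ger0_norm ?invr_ge0 ?(ltW B0)// -/(Q f) => h.
have rf : r * rnorm f <= rnorm f by rewrite ler_piMl ?rnorm_ge0//; lra.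
have : B^-1 * rnorm (S f) <= 2 * rnorm f by have := Qr f; lra.
by rewrite ler_pdivrMl// mulrCA mulrA.
Qed.

Lemma neumann_series (r : R) (r01 : 0 < r < 1) (Qr : forall f, rnorm (Q f) <= r * rnorm f) y : exists2 x, S x = y &
  tends (fun K => (B^-1)%:C%C *: \sum_(0 <= j < K) iter j Q y) x.
Proof.
have [r0 r1] : 0 < r /\ r < 1 by apply/andP.
have geo m n : \sum_(m <= j < n) r ^+ j <= r ^+ m / (1 - r).
  have [nm|mn] := leqP n m.
    by rewrite big_geq// divr_ge0 ?exprn_ge0 ?(ltW r0)//; lra.
  have -> : \sum_(m <= j < n) r ^+ j = (r ^+ m - r ^+ n) / (1 - r).
    elim: n mn => // n ih; rewrite ltnS leq_eqVlt => /predU1P[->|mn].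
      by rewrite big_nat1 exprS; field; lra.
    by rewrite big_nat_recr ?(ltnW mn)//= ih// exprS; field; lra.
  apply: ler_wpM2r; first by rewrite invr_ge0; lra.
  by rewrite gerBl exprn_ge0// ltW.
have [x yx] : exists x, tends (fun K => \sum_(0 <= j < K) iter j Q y) x.
  apply: rcauchy_cvg => eps e0.
  have h : r ^+ n * (rnorm y / (1 - r)) @[n --> \oo] --> (0 : R).
    rewrite -[X in _ --> X](mul0r (rnorm y / (1 - r))); apply: cvgMl.
    by apply: cvg_expr; rewrite ger0_norm// ltW.
  have [N _ HN] := cvgr_le _ h _ e0.
  have key m n : (N <= m)%N -> (m <= n)%N ->
     rnorm (series (fun j => iter j Q y) n - series (fun j => iter j Q y) m) <= eps.
    move=> Nm mn; rewrite sum_tail//; apply: le_trans (rnorm_sum _ _ _) _.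
    apply: le_trans (_ : \sum_(m <= j < n) r ^+ j * rnorm y <= _).
      by apply: ler_sum => j _; exact: (frame_residual_iter r01 Qr).
    rewrite -mulr_suml; apply: le_trans (HN m Nm) => /=.
    by rewrite [leRHS]mulrCA [leLHS]mulrC; apply: ler_wpM2l; [exact: rnorm_ge0|exact: geo].
  exists N => m n Nm Nn; have [mn|/ltnW nm] := leqP m n.
    by rewrite rnorm_dist; exact: key.
  exact: key.
exists ((B^-1)%:C%C *: x); last exact: tendsZ.
(* The sum telescopes because [S / B = 1 - Q]. *)
have SN K : S ((B^-1)%:C%C *: \sum_(0 <= j < K) iter j Q y) = y - iter K Q y.
  have S0 : S 0 = 0.
    by have := frame_operator_lin (-1) 0 0; rewrite scaler0 addr0 scaleN1r addNr.
  elim: K => [|K ih]; first by rewrite big_geq// scaler0 S0 subrr.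
  rewrite big_nat_recr//= scalerDr -[X in S (X + _)]scale1r frame_operator_lin scale1r ih.
  rewrite -[X in S X]addr0 frame_operator_lin S0 addr0.
  have -> : Q (iter K Q y) = iter K Q y - (B^-1)%:C%C *: S (iter K Q y) by [].
  by rewrite opprB -addrA (addrC (- _)).
have Qy : tends (fun K => iter K Q y) 0.
  move=> eps e0.
  have h : r ^+ n * rnorm y @[n --> \oo] --> (0 : R).
    rewrite -[X in _ --> X](mul0r (rnorm y)); apply: cvgMl.
    by apply: cvg_expr; rewrite ger0_norm// ltW.
  have [N _ HN] := cvgr_le _ h _ e0.
  exists N => n /HN /=; rewrite subr0; apply: le_trans.
  exact: (frame_residual_iter r01 Qr).
have t1 : tends (fun K => S ((B^-1)%:C%C *: \sum_(0 <= j < K) iter j Q y)) (S ((B^-1)%:C%C *: x)).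
  apply: (tends_lip (C := 2 * B) (N := 0%N)) (tendsZ (B^-1)%:C%C yx) => [|n _].
    by rewrite mulr_ge0// ltW.
  by rewrite -frame_operatorB; exact: frame_operator_le.
apply: tends_unique t1 _.
have := tendsD (tends_cst y) (tendsZ (-1) Qy); rewrite scaler0 addr0.
by congr tends; apply/funext => K; rewrite SN scaleN1r.
Qed.

(** Has the shape of [canonical_dual], so that the dual frame is [S^-1 (e n)] by conversion. *)
Definition frame_inverse y : H := xget 0 [set x | S x = y].

Let T := frame_inverse.

Lemma canonical_dualE n : canonical_dual dot e n = T (e n).
Proof. by []. Qed.

Lemma frame_operator_inj : injective S.
Proof.
have [r r01 Qr] := frame_residual_le.
move=> x y Sxy; apply/eqP; rewrite -subr_eq0; apply/eqP/rnorm_eq0.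
have := frame_operator_below r01 Qr (x - y).
have -> : S (x - y) = 0 by rewrite frame_operatorB Sxy subrr.
have c0 : 0 < (1 - r) * B by rewrite mulr_gt0//; lra.
by rewrite rnorm0 pmulr_rle0.
Qed.

Lemma frame_inverseK y : S (T y) = y.
Proof.
have [r r01 Qr] := frame_residual_le.
have [x xy _] := neumann_series r01 Qr y.
by rewrite /T /frame_inverse; case: xgetP => [z _ ->//|/(_ x)].
Qed.

Lemma frame_operatorK x : T (S x) = x.
Proof. by apply: frame_operator_inj; rewrite frame_inverseK. Qed.

Lemma frame_inverse_lin a f h : T (a *: f + h) = a *: T f + T h.
Proof. by apply: frame_operator_inj; rewrite frame_operator_lin !frame_inverseK. Qed.

Lemma frame_inverse_sym f h : dot (T f) h = dot f (T h).
Proof. by rewrite -{1}(frame_inverseK h) -frame_operator_sym frame_inverseK. Qed.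

Lemma frame_inverse_le : exists2 C, 0 < C & forall f, rnorm (T f) <= C * rnorm f.
Proof.
have [r r01 Qr] := frame_residual_le.
have c0 : 0 < (1 - r) * B by rewrite mulr_gt0//; lra.
exists ((1 - r) * B)^-1; first by rewrite invr_gt0.
move=> f; rewrite ler_pdivlMl// -{2}(frame_inverseK f).
exact: (frame_operator_below r01 Qr).
Qed.

Lemma frame_inverse_neumann : exists r, [/\ 0 < r < 1,
  forall n f, rnorm (iter n Q f) <= r ^+ n * rnorm f &
  forall y, tends (fun K => (B^-1)%:C%C *: \sum_(0 <= j < K) iter j Q y) (T y)].
Proof.
have [r r01 Qr] := frame_residual_le; exists r; split=> //.
  by move=> n f; exact: (frame_residual_iter r01 Qr).
move=> y; have [x xy xt] := neumann_series r01 Qr y.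
by rewrite -xy frame_operatorK xy.
Qed.

Let d := canonical_dual dot e.

Lemma dot_dual f n : dot f (d n) = dot (T f) (e n).
Proof. by rewrite frame_inverse_sym. Qed.

Lemma bessel_dual : exists2 D, 0 < D & bessel dot d D.
Proof.
have [C C0 TC] := frame_inverse_le.
exists (B * C ^+ 2); first by rewrite mulr_gt0// exprn_gt0.
move=> f L; apply: le_trans (_ : B * rnorm (T f) ^+ 2 <= _).
  apply: le_trans (eB (T f) L); rewrite le_eqVlt; apply/orP; left; apply/eqP.
  by apply: eq_bigr => i _; rewrite /energy /analysis dot_dual.
rewrite -mulrA ler_wpM2l ?(ltW B0)// -exprMn ler_pXn2r// ?nnegrE ?rnorm_ge0//.
by rewrite mulr_ge0 ?rnorm_ge0// ltW.
Qed.

Lemma frame_expansion f : tends (series (fun n => dot f (d n) *: e n)) f.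
Proof.
have := frame_operator_tends (T f); rewrite frame_inverseK; congr tends.
by congr series; apply/funext => n; rewrite dot_dual.
Qed.

Lemma tends_frame_inverse (u : nat -> H) x : tends u x -> tends (fun n => T (u n)) (T x).
Proof.
have [C C0 TC] := frame_inverse_le.
apply: (tends_lip (C := C) (N := 0%N)) => [|n _]; first exact: ltW.
rewrite (_ : T (u n) - T x = T (u n - x)) ?TC//.
have := frame_inverse_lin (-1) x (u n).
by rewrite !scaleN1r (addrC (- x)) (addrC (- T x)) => ->.
Qed.

Lemma frame_inverse0 : T 0 = 0.
Proof. by have := frame_inverse_lin (-1) 0 0; rewrite scaler0 addr0 scaleN1r addNr. Qed.

Lemma dual_frame_expansion f : tends (series (fun n => dot f (e n) *: d n)) f.
Proof.
have := tends_frame_inverse (frame_operator_tends f); rewrite frame_operatorK.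
congr tends; apply/funext => n; rewrite /series/=; elim: n => [|n ih].
  by rewrite !big_geq// frame_inverse0.
by rewrite !big_nat_recr//= addrC frame_inverse_lin ih addrC.
Qed.

End Frame.
End Frames.

(** * Riesz bases, and decay of the inverse frame operator *)

Section Riesz.
Context {R : realType} {H : completeNormedModType R[i]}.
Variable dot : {dot H for Num.conj}.
Hypothesis dotE : forall x : H, `|x| ^+ 2 = dot x x.
Implicit Types (x y f h : H).

Lemma sum_delta (K : nzRingType) (c : nat -> K) i m n : (m <= i < n)%N ->
  \sum_(m <= j < n) c j * (j == i)%:R = c i.
Proof.
move=> imn; rewrite (bigD1_seq i) ?mem_index_iota ?iota_uniq//= eqxx mulr1.
by rewrite big1 ?addr0// => j /negbTE ->; rewrite mulr0.
Qed.

Lemma orthonormal_synth (o : nat -> H) : (forall m n, dot (o m) (o n) = (m == n)%:R) ->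
  synth_bound o 1.
Proof.
move=> oo c m n; rewrite mul1r (rnorm_sqrE dotE); set h := \sum_(_ <= _ < _) _.
have -> : dot h h = (\sum_(m <= i < n) energy c i)%:C%C; last exact: lexx.
rewrite {1}/h dot_synth raddf_sum/=; apply: eq_big_nat => i imn.
rewrite dotC -(rnorm_mulJ (c i)); congr (_ * Num.conj _).
rewrite /h dot_synth -[RHS](sum_delta c imn).
by apply: eq_bigr => j _; rewrite oo.
Qed.

Section RieszBasis.
Variables (g o : nat -> H) (T : {linear H -> H}) (M : R).
Hypotheses (onb : orthonormal_basis dot o) (TM : forall x, rnorm (T x) <= M * rnorm x)
  (Tbij : bijective T) (gE : forall n, g n = T (o n)).

Let oo : forall m n, dot (o m) (o n) = (m == n)%:R. Proof. exact: onb.1. Qed.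

Let tends_T (u : nat -> H) x : tends u x -> tends (fun n => T (u n)) (T x).
Proof.
apply: (tends_lip (C := `|M|) (N := 0%N)) => [//|n _].
rewrite -linearB; apply: le_trans (TM _) _.
by rewrite ler_wpM2r ?rnorm_ge0// ler_norm.
Qed.

Let T_synth (c : nat -> R[i]) m n :
  T (\sum_(m <= i < n) c i *: o i) = \sum_(m <= i < n) c i *: g i.
Proof. by rewrite linear_sum; apply: eq_bigr => i _; rewrite linearZ gE. Qed.

Lemma riesz_synth : synth_bound g (M ^+ 2 + 1).
Proof.
move=> c m n; rewrite -T_synth.
have := orthonormal_synth oo c m n; rewrite mul1r => h.
apply: le_trans (_ : (M * rnorm (\sum_(m <= i < n) c i *: o i)) ^+ 2 <= _).
  by rewrite ler_pXn2r// ?nnegrE ?rnorm_ge0// (le_trans _ (TM _))// rnorm_ge0.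
rewrite exprMn; apply: ler_pM => //; rewrite ?sqr_ge0//; lra.
Qed.

Lemma riesz_bessel : bessel dot g (M ^+ 2 + 1).
Proof. by apply: synth_bessel riesz_synth => //; rewrite ltr_wpDl ?sqr_ge0. Qed.

(** The set of [f] whose coefficients against G have energy at most 1 is weakly bounded: every [h]
    is [T u], and [<T u, f>] is the sum of [<u, o n> <g n, f>]. Uniform boundedness makes it bounded
    in norm, and scaling gives the lower bound. *)
Lemma riesz_lower : exists2 A, 0 < A & lower_bound dot g A.
Proof.
have [|M' HM'] := weakly_bounded dotE (F := [set f | sums_le (energy (analysis dot g f)) 1]).
  move=> h; have [T' TK T'K] := Tbij; pose u := T' h.
  exists ((rnorm u ^+ 2 + 1) / 2) => f fF.
  have := dot_tendsl dotE f (tends_T ((tends_cvg _ _).1 (onb.2 u))).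
  rewrite T'K => th; apply: (tends_ler (N := 0%N) th) => n _.
  rewrite /series/= T_synth dot_synth; apply: le_trans (rnorm_sum _ _ _) _.
  apply: le_trans (_ : \sum_(0 <= i < n) (energy (analysis dot o u) i +
     energy (analysis dot g f) i) / 2 <= _).
    apply: ler_sum => i _; rewrite rnormM (rnorm_dotC dot (g i)) /energy /analysis.
    set a := rnorm _; set b := rnorm _.
    by have := sqr_ge0 (a - b); lra.
  rewrite -mulr_suml big_split/= ler_pM2r//; apply: lerD; last exact: (fF n).
  have := synth_bessel dotE ltr01 (orthonormal_synth oo) u n; rewrite mul1r; exact.
pose N := `|M'| + 1; have N0 : 0 < N by rewrite ltr_wpDl.
exists (N ^-2); first by rewrite invr_gt0 exprn_gt0.
move=> f D fD; apply/ler_addgt0Pr => eps e0.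
have D0 := sums_le_ge0 fD.
have De : 0 < D + eps by lra.
(* Dividing [f] by [s] puts it into the bounded set; [eps] avoids division by zero when [D = 0]. *)
pose s := Num.sqrt (D + eps); have s0 : 0 < s by rewrite sqrtr_gt0.
have s2 : s ^+ 2 = D + eps by rewrite sqr_sqrtr// ltW.
have : rnorm ((s^-1)%:C%C *: f) <= M'.
  apply: HM' => L /=.
  apply: le_trans (_ : \sum_(0 <= k < L) s ^- 2 * energy (analysis dot g f) k <= _).
    apply: ler_sum => k _; rewrite /energy /analysis dotZl rnormM rnormC.
    by rewrite ger0_norm ?invr_ge0 ?(ltW s0)// exprMn exprVn.
  rewrite -mulr_sumr s2 ler_pdivrMl// mulr1; apply: le_trans (fD L) _; lra.
rewrite rnormZ rnormC ger0_norm ?invr_ge0 ?(ltW s0)// ler_pdivrMl// => fs.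
have fN : rnorm f <= s * N.
  apply: le_trans fs _; rewrite ler_wpM2l ?(ltW s0)//.
  by have := ler_norm M'; rewrite /N; lra.
rewrite ler_pdivrMl ?exprn_gt0// -s2 mulrC -exprMn.
by rewrite ler_pXn2r// ?nnegrE ?rnorm_ge0// mulr_ge0// ltW.
Qed.

(** If [d] is the dual vector, then [T (o n) = g n = S d] is the image under [T] of the sum of
    [<d, g i> o i]. Injectivity of [T] identifies that sum with [o n], and the coordinates are
    compared. *)
Lemma riesz_image_biorthogonal m n : dot (g m) (canonical_dual dot g n) = (m == n)%:R.
Proof.
have [A A0 gA] := riesz_lower; have B0 : 0 < M ^+ 2 + 1 by rewrite ltr_wpDl ?sqr_ge0.
set d := canonical_dual dot g n.
have Sd := frame_inverseK dotE A0 B0 riesz_bessel gA (g n).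
rewrite -/(canonical_dual dot g n) -/d in Sd.
have [x xt] := synth_cvg ler01 (orthonormal_synth oo) (riesz_bessel d).
have xo : x = o n.
  apply: (bij_inj Tbij); rewrite -gE -Sd.
  have := frame_operator_tends dotE B0 riesz_bessel d.
  apply: tends_unique; have := tends_T xt; congr tends; apply/funext => k.
  by rewrite /series/= T_synth.
have : dot x (o m) = dot d (g m).
  apply: tends_unique (dot_tendsl dotE (o m) xt) _ => eps e0.
  exists m.+1 => k mk; rewrite /series/= dot_synth.
  under eq_bigr do rewrite oo.
  by rewrite sum_delta ?subrr ?rnorm0 ?ltW.
rewrite xo oo => h; rewrite dotC -h eq_sym.
by rewrite rmorph_nat.
Qed.

End RieszBasis.

Variable g : nat -> H.
Hypothesis rieszG : riesz_basis dot g.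
Local Notation gd := (canonical_dual dot g).

Lemma riesz_frame : exists A B, [/\ 0 < A, 0 < B, bessel dot g B & lower_bound dot g A].
Proof.
have [b [T [onb [M TM] Tb gE]]] := rieszG.
have [A A0 gA] := riesz_lower onb TM Tb gE.
exists A, (M ^+ 2 + 1); split=> //; first by rewrite ltr_wpDl ?sqr_ge0.
exact: riesz_bessel gE.
Qed.

Lemma riesz_biorthogonal m n : dot (g m) (gd n) = (m == n)%:R.
Proof.
have [b [T [onb [M TM] Tb gE]]] := rieszG.
exact: (riesz_image_biorthogonal onb TM Tb gE m n).
Qed.

Lemma riesz_expansion f : tends (series (fun n => dot f (gd n) *: g n)) f.
Proof. by have [A [B [A0 B0 gB gA]]] := riesz_frame; exact: (frame_expansion dotE A0 B0 gB gA f). Qed.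

Lemma riesz_bessel_dual : exists2 B, 0 < B & bessel dot gd B.
Proof. by have [A [B [A0 B0 gB gA]]] := riesz_frame; exact: (bessel_dual dotE A0 B0 gB gA). Qed.

Lemma riesz_inj f : (forall n, dot f (gd n) = 0) -> f = 0.
Proof.
move=> f0; apply: tends_unique (riesz_expansion f) _ => eps e0.
exists 0%N => n _; rewrite /series/= big1 ?subrr ?rnorm0 ?ltW// => i _.
by rewrite f0 scale0r.
Qed.

Lemma synth_bound_norm (v : nat -> H) B : synth_bound v B -> forall n, rnorm (v n) ^+ 2 <= B.
Proof.
move=> vB n; have := vB (fun=> 1) n n.+1.
by rewrite !big_nat1 scale1r /energy rnorm1 expr1n mulr1.
Qed.

Lemma tends_functional (c : nat -> R[i]) (v : nat -> H) f (phi : H -> R[i]) (C : R) :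
  tends (series (fun n => c n *: v n)) f ->
  (forall a x y, phi (a *: x + y) = a * phi x + phi y) ->
  (forall x, rnorm (phi x) <= C * rnorm x) ->
  tends (series (fun n => c n * phi (v n))) (phi f).
Proof.
move=> cf phil phiC.
have phi0 : phi 0 = 0 by have := phil (-1) 0 0; rewrite scaler0 addr0 mulN1r addNr.
have phiB x y : phi (x - y) = phi x - phi y.
  by have := phil (-1) y x; rewrite scaleN1r mulN1r (addrC (- y)) (addrC (- phi y)).
have -> : series (fun n => c n * phi (v n)) =
    (fun n => phi (series (fun n => c n *: v n) n)).
  apply/funext => n; rewrite /series/=; elim: n => [|n ih]; first by rewrite !big_geq.
  by rewrite !big_nat_recr//= ih [in RHS]addrC phil addrC.
apply: (tends_lip (C := `|C|) (N := 0%N)) cf => [//|n _].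
rewrite -phiB; apply: le_trans (phiC _) _.
by rewrite ler_wpM2r ?rnorm_ge0// ler_norm.
Qed.

(** The source of all [comp_le] facts: a bounded functional is applied termwise to an expansion, and
    any bound [D] on the absolute sums passes to the value. *)
Lemma functional_le (c : nat -> R[i]) (v : nat -> H) f (phi : H -> R[i]) (C D : R) :
  tends (series (fun n => c n *: v n)) f ->
  (forall a x y, phi (a *: x + y) = a * phi x + phi y) ->
  (forall x, rnorm (phi x) <= C * rnorm x) ->
  sums_le (fun n => rnorm (c n) * rnorm (phi (v n))) D -> rnorm (phi f) <= D.
Proof.
move=> cf phil phiC cD; apply: (tends_ler (N := 0%N) (tends_functional cf phil phiC)).
move=> n _; apply: le_trans (rnorm_sum _ _ _) _; apply: le_trans (cD n).
by apply: ler_sum => i _; rewrite rnormM.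
Qed.

Variable e : nat -> H.
Hypothesis frameE : frame dot e.
Local Notation ed := (canonical_dual dot e).

Section DualDecay.
Variable dec : (nat -> nat -> R) -> Prop.
Hypothesis decA : decay_algebra dec.
Hypothesis decG : dec (fun m n => rnorm (dot (e m) (g n))).
Hypothesis decGd : dec (fun m n => rnorm (dot (e m) (gd n))).

(** The row index is the coordinate, so these are the entries of the matrix of [S^-1] in the basis
    G. The Neumann series is summed entrywise, at the cost of the constant [B^-1 / (1 - rho)]. *)
Lemma inverse_decay : dec (fun m n => rnorm (dot (frame_inverse dot e (g n)) (gd m))).
Proof.
have [A [B [A0 B0 eB eA]]] := frame_bounds frameE.
have [r [r01 Qr Qt]] := frame_inverse_neumann dotE A0 B0 eB eA.
pose Q := frame_residual dot e B.
have [Ag [Bg [Ag0 Bg0 gB gA]]] := riesz_frame.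
have [Bd Bd0 gdB] := riesz_bessel_dual.
have gn := synth_bound_norm (bessel_synth dotE Bg0 gB).
have gdn := synth_bound_norm (bessel_synth dotE Bd0 gdB).
pose q j m n := rnorm (dot (iter j Q (g n)) (gd m)).
have [r0 r1] : 0 < r /\ r < 1 by apply/andP.
have qf : power_family q (Bg + Bd) r.
  split.
  - move=> j m n; rewrite rnorm_ge0/=; apply: le_trans (cauchy_schwarz dotE _ _) _.
    apply: le_trans (_ : r ^+ j * (rnorm (g n) * rnorm (gd m)) <= _).
      by rewrite mulrA ler_wpM2r ?rnorm_ge0//; exact: Qr.
    rewrite mulrC ler_wpM2r ?exprn_ge0 ?(ltW r0)//.
    have := gn n; have := gdn m; have := sqr_ge0 (rnorm (g n) - rnorm (gd m)).
    have := sqr_ge0 (rnorm (g n) + rnorm (gd m)).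
    by move: (rnorm (g n)) (rnorm (gd m)) => u w; nra.
  (* Expand [Q^j (g n)] in the basis G and apply [Q^i] followed by the [m]-th coordinate. *)
  - move=> i j m n D qD; rewrite /q iterD.
    apply: (functional_le (riesz_expansion (iter j Q (g n)))
      (phi := fun x => dot (iter i Q x) (gd m)) (C := r ^+ i * rnorm (gd m))).
    + by move=> a x y; rewrite (frame_residual_iter_lin dotE B0 eB) dotDl dotZl.
    + move=> x; apply: le_trans (cauchy_schwarz dotE _ _) _.
      by rewrite mulrAC ler_wpM2r ?rnorm_ge0//; exact: Qr.
    + by apply: sums_le_mono qD => k; rewrite mulrC.
  - move=> m n; rewrite /q /= riesz_biorthogonal eq_sym; case: eqVneq => _.
      by rewrite mul1r.
    by rewrite mul0r rnorm0.
(* The matrix of [S] is the synthesis matrix of [e] times its analysis matrix; the two localization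
   hypotheses bound one factor each. *)
have decS : dec (fun m n => rnorm (dot (frame_operator dot e (g n)) (gd m))).
  apply: (decay_comp decA (A := fun m n => rnorm (dot (e n) (gd m)))
     (B := fun m n => rnorm (dot (e m) (g n)))) => //.
  - by move=> m n; exact: rnorm_ge0.
  - by move=> m n; exact: rnorm_ge0.
  - move=> m n D hD; apply: (functional_le (frame_operator_tends dotE B0 eB (g n))
      (phi := fun x => dot x (gd m)) (C := rnorm (gd m))).
    + by move=> a x y; rewrite dotDl dotZl.
    + by move=> x; rewrite mulrC; exact: cauchy_schwarz.
    + apply: sums_le_mono hD => k.
      by rewrite mulrC /analysis (rnorm_dotC dot (g n)).
  - exact: (decay_tr decA decGd).
have decQ : dec (q 1%N).
  apply: (decay_le decA (B := fun m n => (m == n)%:R +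
     B^-1 * rnorm (dot (frame_operator dot e (g n)) (gd m)))).
    move=> m n; rewrite /q /= /Q /frame_residual dotBl dotZl.
    apply: le_trans (rnormB _ _) _; apply: lerD.
      by rewrite riesz_biorthogonal eq_sym; case: eqVneq => _; rewrite ?rnorm1 ?rnorm0.
    by rewrite rnormM rnormC ger0_norm// invr_ge0 ltW.
  apply: (decayD decA).
    by apply: (decay_diag decA (C := 1)) => m n; rewrite mulr1.
  by apply: (decayZ decA) => //; rewrite invr_ge0 ltW.
have [rho [X [/andP[p0 p1] decX qX]]] := decay_powers decA r01 qf decQ.
apply: (decay_le decA (B := fun m n => (B^-1 * (1 - rho)^-1) * X m n)); last first.
  apply: (decayZ decA) => //; rewrite mulr_ge0// invr_ge0 ?(ltW B0)//.
  by rewrite subr_ge0 ltW.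
move=> m n; have X0 : 0 <= X m n.
  by apply: le_trans (le_trans (rnorm_ge0 _) (qX 0%N m n)) _; rewrite expr0 mul1r.
apply: (tends_ler (N := 0%N) (dot_tendsl dotE (gd m) (Qt (g n)))) => K _.
rewrite dotZl rnormM rnormC ger0_norm ?invr_ge0 ?(ltW B0)// -mulrA.
apply: ler_wpM2l; first by rewrite invr_ge0 ltW.
rewrite dot_suml; apply: le_trans (rnorm_sum _ _ _) _.
apply: le_trans (_ : \sum_(0 <= j < K) rho ^+ j * X m n <= _).
  by apply: ler_sum => j _; exact: qX.
rewrite -mulr_suml ler_wpM2r//.
have -> : \sum_(0 <= j < K) rho ^+ j = (1 - rho ^+ K) / (1 - rho).
  elim: K => [|K ih]; first by rewrite big_geq// expr0 subrr mul0r.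
  by rewrite big_nat_recr//= ih exprS; field; lra.
rewrite -[X in _ <= X]div1r ler_wpM2r ?invr_ge0 ?subr_ge0 ?(ltW p1)//.
by rewrite gerBl exprn_ge0// ltW.
Qed.

(** Expand [e m] in the basis G before applying [S^-1]. *)
Lemma dual_decay_dual : dec (fun m n => rnorm (dot (ed m) (gd n))).
Proof.
have [A [B [A0 B0 eB eA]]] := frame_bounds frameE.
have [C C0 TC] := frame_inverse_le dotE A0 B0 eB eA.
apply: (decay_comp decA (A := fun m n => rnorm (dot (e m) (gd n)))
  (B := fun m n => rnorm (dot (frame_inverse dot e (g m)) (gd n)))) => //.
- by move=> m n; exact: rnorm_ge0.
- by move=> m n; exact: rnorm_ge0.
- move=> m n D hD; apply: (functional_le (riesz_expansion (e m))
    (phi := fun x => dot (frame_inverse dot e x) (gd n)) (C := C * rnorm (gd n))) => //.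
  + by move=> a x y; rewrite (frame_inverse_lin dotE A0 B0 eB eA) dotDl dotZl.
  + move=> x; apply: le_trans (cauchy_schwarz dotE _ _) _.
    by rewrite mulrAC ler_wpM2r ?rnorm_ge0//; exact: TC.
- exact: (decay_tr decA inverse_decay).
Qed.

(** Since [S^-1] is symmetric it can be moved onto [g n], and [S^-1 (g n)] is then expanded in G. *)
Lemma dual_decay_basis : dec (fun m n => rnorm (dot (ed m) (g n))).
Proof.
have [A [B [A0 B0 eB eA]]] := frame_bounds frameE.
apply: (decay_comp decA (A := fun m n => rnorm (dot (e m) (g n)))
  (B := fun m n => rnorm (dot (frame_inverse dot e (g n)) (gd m)))) => //.
- by move=> m n; exact: rnorm_ge0.
- by move=> m n; exact: rnorm_ge0.
- move=> m n D hD; rewrite canonical_dualE (frame_inverse_sym dotE A0 B0 eB eA) rnorm_dotC.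
  apply: (functional_le (riesz_expansion (frame_inverse dot e (g n)))
    (phi := fun x => dot x (e m)) (C := rnorm (e m))).
  + by move=> a x y; rewrite dotDl dotZl.
  + by move=> x; rewrite mulrC; exact: cauchy_schwarz.
  + by apply: sums_le_mono hD => k; rewrite mulrC (rnorm_dotC dot (g k)).
- exact: inverse_decay.
Qed.

End DualDecay.
End Riesz.

(** * Operators on weighted l^p spaces *)

Section SequenceOperators.
Context {R : realType}.
Variables (p : R) (p1 : 1 <= p) (mu : R -> R) (mu_gt0 : forall n : nat, 0 < mu n.+1%:R).
Local Notation seqC := (nat -> R[i]).
Implicit Types (c : seqC) (A : nat -> nat -> R[i]) (F : seqC -> seqC).

Definition lpb c (M : R) := 0 <= M /\ lple p (wabs mu c) M.

Let mu_ge0 n : 0 <= mu n.+1%:R. Proof. exact: ltW. Qed.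
Let p0 : 0 < p. Proof. by rewrite (lt_le_trans ltr01). Qed.

Lemma lp_spaceP c : lp_space p mu c <-> exists M, lpb c M.
Proof.
split=> [/(lp_norm_fin p1 mu_ge0)[M [M0 _ h]]|[M [M0 h]]]; first by exists M.
exact: lp_norm_lty M0 h.
Qed.

Lemma lpb_norm c M : lpb c M -> (lp_norm p mu c <= M%:E)%E.
Proof. by move=> [M0 h]; apply/lp_norm_le. Qed.

Lemma lpb_finite c : lp_space p mu c -> exists M, lp_norm p mu c = M%:E /\ lpb c M.
Proof. by move=> /(lp_norm_fin p1 mu_ge0)[M [M0 h1 h2]]; exists M. Qed.

Lemma wabs_add c c' n : wabs mu (fun n => c n + c' n) n <= wabs mu c n + wabs mu c' n.
Proof. by rewrite /wabs -mulrDl ler_wpM2r ?rnormD. Qed.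

Lemma lpbD c c' M M' : lpb c M -> lpb c' M' -> lpb (fun n => c n + c' n) (M + M').
Proof.
move=> [M0 h] [M0' h']; split; first exact: addr_ge0.
apply: (lple_mono p1) (lpleD p1 _ _ M0 M0' h h') => n; last 2 first.
- exact: wabs_ge0.
- exact: wabs_ge0.
by rewrite wabs_ge0//= wabs_add.
Qed.

Lemma lpbZ a c M : lpb c M -> lpb (fun n => a * c n) (rnorm a * M).
Proof.
move=> [M0 h]; split; first by rewrite mulr_ge0 ?rnorm_ge0.
have := lpleZ (rnorm_ge0 a) M0 (wabs_ge0 mu_ge0 c) h.
by apply: sums_le_mono => n; rewrite /wabs rnormM mulrA.
Qed.

Lemma lpb_entry c M n : lpb c M -> wabs mu c n <= M.
Proof. by move=> [M0 h]; apply: (lple_entry p1) h => // k; exact: wabs_ge0. Qed.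

Lemma lpb_le c M N : M <= N -> lpb c M -> lpb c N.
Proof. by move=> MN [M0 h]; split; [exact: le_trans MN|exact: lple_leM h]. Qed.

Lemma abs_cvg (u : seqC) D : sums_le (fun n => rnorm (u n)) D ->
  exists s, tends (series u) s.
Proof.
move=> uD; apply: rcauchy_complex => eps e0.
have [N HN] := sums_le_cauchy (fun n => rnorm_ge0 (u n)) uD e0.
have key m n : (N <= m)%N -> (m <= n)%N -> rnorm (series u n - series u m) <= eps.
  move=> Nm mn; rewrite sub_series_geq//; apply: le_trans (rnorm_sum _ _ _) _.
  exact: HN.
exists N => m n Nm Nn; have [mn|/ltnW nm] := leqP m n.
  by rewrite rnorm_dist; exact: key.
exact: key.
Qed.

Definition mact A c m : R[i] := xget 0 [set s | tends (series (fun n => A m n * c n)) s].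

Lemma mactE A c m s : tends (series (fun n => A m n * c n)) s -> mact A c m = s.
Proof.
move=> h; rewrite /mact; case: xgetP => [x _ /= hx|/(_ s)//].
exact: tends_unique hx h.
Qed.

(** Linearity is asked for only on l^p_mu: [mact] takes the value 0 where its series diverges, and
    is not linear there. *)
Definition lp_operator F (D : R) :=
  [/\ 0 < D, forall c M, lpb c M -> lpb (F c) (D * M) &
   forall a c c' M M', lpb c M -> lpb c' M' ->
     F (fun n => a * c n + c' n) = (fun n => a * F c n + F c' n)].

Section Schur.
Variables (A : nat -> nat -> R[i]) (D : R).
Hypotheses (D0 : 0 < D)
  (AD : schur_bounded (fun n => mu n.+1%:R) (fun m n => rnorm (A m n)) D).

Lemma mact_tends c M m : lpb c M -> tends (series (fun n => A m n * c n)) (mact A c m).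
Proof.
move=> cM; have M0 := cM.1.
suff [s hs] : exists s, tends (series (fun n => A m n * c n)) s by rewrite (mactE hs).
apply: (@abs_cvg _ ((M / mu m.+1%:R) * D)).
apply: (@sums_le_mono R _ (fun n => (M / mu m.+1%:R) * (rnorm (A m n) * (mu m.+1%:R / mu n.+1%:R)))).
  move=> n; rewrite rnormM.
  have -> : M / mu m.+1%:R * (rnorm (A m n) * (mu m.+1%:R / mu n.+1%:R)) =
    rnorm (A m n) * (M / mu n.+1%:R) by field; rewrite !gt_eqF.
  rewrite ler_wpM2l ?rnorm_ge0// ler_pdivlMr//; exact: lpb_entry.
by apply: sums_leZ; [rewrite divr_ge0|exact: AD.1].
Qed.

Lemma lp_operator_mact : lp_operator (mact A) D.
Proof.
split=> //.
  move=> c M cM; have [M0 h] := cM; split; first by rewrite mulr_ge0// ltW.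
  pose K m n := rnorm (A m n) * (mu m.+1%:R / mu n.+1%:R).
  apply: (@lple_schur R p p1 K (wabs mu c) (wabs mu (mact A c)) D M) => //.
  - by move=> m n; rewrite mulr_ge0 ?rnorm_ge0// divr_ge0.
  - exact: wabs_ge0.
  - exact: wabs_ge0.
  - exact: AD.1.
  - exact: AD.2.
  move=> m B hB; rewrite /wabs -ler_pdivlMr//.
  apply: (tends_ler (N := 0%N) (mact_tends m cM)) => L _.
  apply: le_trans (rnorm_sum _ _ _) _; rewrite ler_pdivlMr// mulr_suml.
  apply: le_trans (hB L); apply: ler_sum => n _; rewrite rnormM /K /wabs.
  rewrite le_eqVlt; apply/orP; left; apply/eqP; field.
  by rewrite !gt_eqF.
move=> a c c' M M' cM cM'; apply/funext => m; apply: mactE.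
have := tendsD (tendsZ (V := R[i]^o) a (mact_tends m cM)) (mact_tends m cM').
congr tends; apply/funext => k; rewrite /series/= scaler_sumr -big_split/=.
by apply: eq_bigr => i _; rewrite mulrDr -mulrCA.
Qed.

End Schur.

Lemma lp_operator_comp F G D E : lp_operator F D -> lp_operator G E -> lp_operator (F \o G) (D * E).
Proof.
move=> [D0 FD Fl] [E0 GE Gl]; split; first exact: mulr_gt0.
  by move=> c M cM; rewrite -mulrA; exact/FD/GE.
by move=> a c c' M M' cM cM' /=; rewrite (Gl _ _ _ _ _ cM cM') (Fl _ _ _ _ _ (GE _ _ cM) (GE _ _ cM')).
Qed.

Lemma lp_operator_id : lp_operator id 1.
Proof. by split=> // c M; rewrite mul1r. Qed.

Definition delta n : seqC := fun m => (m == n)%:R.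

Definition partial (s : nat -> nat) K c : seqC :=
  fun n => \sum_(0 <= k < K) c (s k) * delta (s k) n.

Lemma lpb0 : lpb (fun=> 0) 0.
Proof.
split=> //; have := @lple0 R p p1 0; apply: sums_le_mono => n.
by rewrite /wabs rnorm0 mul0r.
Qed.

Lemma lpb_delta n : exists M, lpb (delta n) M.
Proof.
exists (mu n.+1%:R); split=> // L.
apply: le_trans (_ : \sum_(0 <= k < maxn L n.+1) (if k == n then mu n.+1%:R `^ p else 0) <= _).
  apply: le_trans (_ : \sum_(0 <= k < L) (if k == n then mu n.+1%:R `^ p else 0) <= _).
    apply: ler_sum => k _; rewrite /wabs /delta; case: eqVneq => [->|_].
      by rewrite rnorm1 mul1r.
    by rewrite rnorm0 mul0r powR0// gt_eqF.
  rewrite [leRHS](@big_cat_nat _ _ _ L) ?leq_maxl//= lerDl sumr_ge0// => i _.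
  by case: ifP => // _; exact: powR_ge0.
rewrite (bigD1_seq n) ?mem_index_iota ?iota_uniq//= ?leq_maxr// eqxx big1 ?addr0//.
by move=> i /negbTE ->.
Qed.

Lemma lpb_partial s K c : exists M, lpb (partial s K c) M.
Proof.
elim: K => [|K [M hM]].
  exists 0; rewrite (_ : partial s 0 c = fun=> 0); first exact: lpb0.
  by apply/funext => n; rewrite /partial big_geq.
have [M' hM'] := lpb_delta (s K).
exists (rnorm (c (s K)) * M' + M).
rewrite (_ : partial s K.+1 c = fun n => c (s K) * delta (s K) n + partial s K c n).
  by apply: lpbD hM; exact: lpbZ.
by apply/funext => n; rewrite /partial big_nat_recr//= addrC.
Qed.

Lemma lp_operator0 F D : lp_operator F D -> F (fun=> 0) = fun=> 0.
Proof.
move=> [_ _ Fl]; have := Fl (-1) _ _ _ _ lpb0 lpb0.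
rewrite (_ : (fun n => _) = fun=> 0); last by apply/funext => n; rewrite mulr0 addr0.
by move=> ->; apply/funext => n; rewrite mulN1r addNr.
Qed.

Lemma lp_operator_partial F D s K c : lp_operator F D ->
  F (partial s K c) = fun n => \sum_(0 <= k < K) c (s k) * F (delta (s k)) n.
Proof.
move=> FD; elim: K => [|K ih].
  rewrite (_ : partial s 0 c = fun=> 0); last by apply/funext => n; rewrite /partial big_geq.
  by rewrite (lp_operator0 FD); apply/funext => n; rewrite big_geq.
rewrite (_ : partial s K.+1 c = fun n => c (s K) * delta (s K) n + partial s K c n); last first.
  by apply/funext => n; rewrite /partial big_nat_recr//= addrC.
have [M hM] := lpb_delta (s K); have [M' hM'] := lpb_partial s K c.
have [_ _ Fl] := FD; rewrite (Fl _ _ _ _ _ hM hM') ih.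
by apply/funext => n; rewrite big_nat_recr//= addrC.
Qed.

Lemma partial_in s K c k : injective s -> (k < K)%N -> partial s K c (s k) = c (s k).
Proof.
move=> si kK; rewrite /partial (bigD1_seq k) ?mem_index_iota ?iota_uniq//=.
rewrite /delta eqxx mulr1 big1 ?addr0// => j jk.
by rewrite (inj_eq si) eq_sym (negbTE jk) mulr0.
Qed.

Lemma partial_out s K c n : (forall k, (k < K)%N -> s k != n) -> partial s K c n = 0.
Proof.
move=> h; rewrite /partial big_nat big1// => k /andP[_ /h sk].
by rewrite /delta eq_sym (negbTE sk) mulr0.
Qed.

(** Once [s] has enumerated all indices below [N], the error is dominated by [c] and vanishes there.
    The order of enumeration is irrelevant, which is the source of unconditional convergence. *)
Lemma partial_cvg s c M : bijective s -> lpb c M -> forall eps, 0 < eps ->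
  exists K0, forall K, (K0 <= K)%N -> lpb (fun n => partial s K c n - c n) eps.
Proof.
move=> sb [M0 cM] eps e0; have si := bij_inj sb; have [s' sK s'K] := sb.
have [N HN] := lple_tail p1 (wabs_ge0 mu_ge0 c) cM e0.
exists (\max_(n < N) s' n).+1 => K K0K; split; first exact: ltW.
apply: HN => n.
  rewrite wabs_ge0//=; have [nK|nK] := ltnP (s' n) K.
    have := partial_in c si nK; rewrite s'K /wabs => ->.
    by rewrite subrr rnorm0 mul0r mulr_ge0 ?rnorm_ge0.
  rewrite /wabs partial_out ?sub0r ?rnormN// => k kK.
  by apply/eqP => skn; move: nK; rewrite -skn sK leqNgt kK.
move=> nN; have nK : (s' n < K)%N.
  by apply: leq_trans K0K; rewrite ltnS; exact: (leq_bigmax (Ordinal nN)).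
by have := partial_in c si nK; rewrite s'K /wabs => ->; rewrite subrr rnorm0 mul0r.
Qed.

Lemma lp_operatorB F D c c' M M' : lp_operator F D -> lpb c M -> lpb c' M' ->
  F (fun n => c n - c' n) = fun n => F c n - F c' n.
Proof.
move=> [_ _ Fl] cM cM'; have := Fl (-1) _ _ _ _ cM' cM.
rewrite (_ : (fun n => -1 * c' n + c n) = fun n => c n - c' n); last first.
  by apply/funext => n; rewrite mulN1r addrC.
by move=> ->; apply/funext => n; rewrite mulN1r addrC.
Qed.

(* Finitely supported sequences are dense, so bounded operators are determined
   by their values on the unit sequences. *)
Lemma lp_operator_ext F G D E c M : lp_operator F D -> lp_operator G E -> (forall n, F (delta n) = G (delta n)) ->
  lpb c M -> F c = G c.
Proof.
move=> FD GE FG cM; apply/funext => m; apply/eqP; rewrite -subr_eq0; apply/eqP/rnorm_eq0.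
suff : rnorm (F c m - G c m) * mu m.+1%:R <= 0 by rewrite pmulr_lle0.
apply/ler_addgt0Pr => eps e0; rewrite add0r.
have [D0 FD' _] := FD; have [E0 GE' _] := GE.
have DE0 : 0 < D + E by rewrite addr_gt0.
have idb : bijective (id : nat -> nat) by exists id.
have [K0 /(_ _ (leqnn _)) hK] := partial_cvg idb cM (divr_gt0 e0 DE0).
set r := partial id K0 c in hK; have [M' rM'] := lpb_partial id K0 c.
have hF := lpb_entry m (FD' _ _ hK); have hG := lpb_entry m (GE' _ _ hK).
rewrite (lp_operatorB FD rM' cM) in hF; rewrite (lp_operatorB GE rM' cM) in hG.
have FGr : F r m = G r m.
  rewrite /r (lp_operator_partial _ _ _ FD) (lp_operator_partial _ _ _ GE).
  by apply: eq_bigr => k _; rewrite FG.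
have -> : eps = D * (eps / (D + E)) + E * (eps / (D + E)).
  by rewrite -mulrDl mulrCA mulfV ?gt_eqF// mulr1.
apply: le_trans (lerD hF hG); rewrite /wabs -mulrDl ler_wpM2r//.
by rewrite FGr (rnorm_dist (G r m) (F c m)); exact: rnorm_distD.
Qed.

End SequenceOperators.

(** * The conclusions in abstract l^p coordinates *)

Section ItemsTheorem.
Context {R : realType}.
Variables (p : R) (p1 : 1 <= p) (mu : R -> R) (mu_gt0 : forall n : nat, 0 < mu n.+1%:R).
Local Notation seqC := (nat -> R[i]).
Local Notation lpb := (lpb p mu).
Local Notation lp_operator := (lp_operator p mu).

Section Coordinates.
Variables (V : normedModType R[i]) (N : V -> \bar R) (kap : V -> seqC).
Hypothesis kap_lin : forall a x y n, kap (a *: x + y) n = a * kap x n + kap y n.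
Hypothesis N_kap : forall x, N x = lp_norm p mu (kap x).

Let mu_ge0 n : 0 <= mu n.+1%:R. Proof. exact: ltW. Qed.

Lemma kapB x y : kap (x - y) = fun n => kap x n - kap y n.
Proof.
apply/funext => n; have := kap_lin (-1) y x n.
by rewrite scaleN1r mulN1r (addrC (- y)) (addrC (- kap y n)).
Qed.

Lemma kap0 : kap 0 = fun=> 0.
Proof.
by apply/funext => n; have := kap_lin (-1) 0 0 n; rewrite scaler0 addr0 mulN1r addNr.
Qed.

Lemma kap_series (v : nat -> V) (s : nat -> nat) F D (c : seqC) K : lp_operator F D ->
  (forall n, kap (v n) = F (delta n)) ->
  kap (series ((fun n => c n *: v n) \o s) K) = F (partial s K c).
Proof.
move=> FD vF; rewrite (lp_operator_partial p1 mu_gt0 s K c FD); apply/funext => n.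
rewrite /series/=; elim: K => [|K ih]; first by rewrite !big_geq// kap0.
by rewrite !big_nat_recr//= addrC kap_lin ih vF addrC.
Qed.

Lemma N_fin x : (N x < +oo)%E -> exists M, N x = M%:E /\ lpb (kap x) M.
Proof. by rewrite N_kap => /(lpb_finite p1 mu_gt0). Qed.

Lemma N_le x M : lpb (kap x) M -> (N x <= M%:E)%E.
Proof. by rewrite N_kap; exact: lpb_norm. Qed.

Lemma N_lty x M : lpb (kap x) M -> (N x < +oo)%E.
Proof. by move/N_le/le_lt_trans; apply; rewrite ltry. Qed.

Lemma N_cvg_lpb (u : nat -> V) x : (forall eps, 0 < eps ->
    exists K0, forall K, (K0 <= K)%N -> lpb (kap (u K - x)) eps) -> N_cvg N u x.
Proof.
move=> h; apply/fine_cvgP; split.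
  have [K0 HK] := h 1 ltr01; exists K0 => // K /HK /N_lty.
  rewrite /= fin_numE N_kap; have := lp_norm_ge0 p mu (kap (u K - x)).
  by case: (lp_norm _ _ _).
apply/cvgrPdist_le => eps e0; have [K0 HK] := h _ e0.
exists K0 => // K /HK hK /=; rewrite sub0r normrN.
have := N_le hK; rewrite N_kap; have := lp_norm_ge0 p mu (kap (u K - x)).
case: (lp_norm _ _ _) => [r| |]//=; rewrite !lee_fin => r0.
by rewrite ger0_norm.
Qed.

Lemma N_cvg_synthesis (v : nat -> V) (s : nat -> nat) F D (c : seqC) M x :
  lp_operator F D -> (forall n, kap (v n) = F (delta n)) -> lpb c M -> kap x = F c ->
  bijective s -> N_cvg N (series ((fun n => c n *: v n) \o s)) x.
Proof.
move=> FD vF cM xF sb; apply: N_cvg_lpb => eps e0; have [D0 FD' _] := FD.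
have [K0 HK] := partial_cvg p1 mu_gt0 sb cM (divr_gt0 e0 D0).
exists K0 => K /HK /FD'; rewrite mulrCA mulfV ?gt_eqF// mulr1.
have [M' hM'] := lpb_partial p1 mu_gt0 s K c.
by rewrite (lp_operatorB FD hM' cM) kapB (kap_series _ _ _ FD)// xF.
Qed.

Variables (dom : set seqC) (U Ud : V -> seqC) (e d : nat -> V).
Variables (FA FB FAd FBd : seqC -> seqC) (DA DB DAd DBd : R).
Hypothesis kap_inj : forall x, (forall n, kap x n = 0) -> x = 0.
Hypotheses (bA : lp_operator FA DA) (bB : lp_operator FB DB) (bAd : lp_operator FAd DAd) (bBd : lp_operator FBd DBd).
Hypothesis U_kap : forall x, (N x < +oo)%E -> dom (U x) /\ U x = FA (kap x).
Hypothesis Ud_kap : forall x, (N x < +oo)%E -> dom (Ud x) /\ Ud x = FAd (kap x).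
Hypothesis dom_lp : forall c, dom c -> lp_space p mu c.
Hypothesis e_kap : forall n, kap (e n) = FB (delta n).
Hypothesis d_kap : forall n, kap (d n) = FBd (delta n).
Hypothesis synth_e : forall c, dom c ->
  exists2 x, tends (series (fun n => c n *: e n)) x & kap x = FB c.
Hypothesis synth_d : forall c, dom c ->
  exists2 x, tends (series (fun n => c n *: d n)) x & kap x = FBd c.
Hypothesis BdA : forall n, FBd (FA (delta n)) = delta n.
Hypothesis BAd : forall n, FB (FAd (delta n)) = delta n.
Hypothesis inv1 : forall n, FBd (FAd (FB (FA (delta n)))) = delta n.
Hypothesis inv2 : forall n, FB (FA (FBd (FAd (delta n)))) = delta n.

Let BdA' c M : lpb c M -> FBd (FA c) = c.
Proof. exact: (lp_operator_ext p1 mu_gt0 (lp_operator_comp bBd bA) (lp_operator_id p mu) BdA). Qed.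
Let BAd' c M : lpb c M -> FB (FAd c) = c.
Proof. exact: (lp_operator_ext p1 mu_gt0 (lp_operator_comp bB bAd) (lp_operator_id p mu) BAd). Qed.
Let inv1' c M : lpb c M -> FBd (FAd (FB (FA c))) = c.
Proof.
exact: (lp_operator_ext p1 mu_gt0 (lp_operator_comp bBd (lp_operator_comp bAd (lp_operator_comp bB bA))) (lp_operator_id p mu) inv1).
Qed.
Let inv2' c M : lpb c M -> FB (FA (FBd (FAd c))) = c.
Proof.
exact: (lp_operator_ext p1 mu_gt0 (lp_operator_comp bB (lp_operator_comp bA (lp_operator_comp bBd bAd))) (lp_operator_id p mu) inv2).
Qed.

Lemma synthesis_kap (v : nat -> V) F c : (exists2 x, tends (series (fun n => c n *: v n)) x & kap x = F c) ->
  cvgn (series (fun n => c n *: v n)) /\ kap (synthesis v c) = F c.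
Proof. by move=> [x vx <-]; split; [exact: tends_cvgn vx|rewrite /synthesis (tends_limn vx)]. Qed.

Lemma kap_eq x y : kap x = kap y -> x = y.
Proof.
move=> xy; apply/eqP; rewrite -subr_eq0; apply/eqP/kap_inj => n.
by rewrite kapB xy subrr.
Qed.

Let idb : bijective (id : nat -> nat). Proof. by exists id. Qed.

Lemma analysis_bounded_coords (W : V -> seqC) F D : lp_operator F D ->
  (forall x, (N x < +oo)%E -> W x = F (kap x)) -> analysis_bounded N p mu W.
Proof.
move=> [D0 FD _] WF; exists D => x Nx; have [M [NM xM]] := N_fin Nx.
rewrite WF//; have h := FD _ _ xM; split.
  by apply/(lp_spaceP p1 mu_gt0); exists (D * M).
by rewrite NM -EFinM; exact: lpb_norm.
Qed.

(** The lower bound comes from the bounded left inverse [G] of the analysis matrix [F]. *)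
Lemma norm_equivalence_coords (W : V -> seqC) F G D E : lp_operator F D -> lp_operator G E ->
  (forall x, (N x < +oo)%E -> W x = F (kap x)) ->
  (forall c M, lpb c M -> G (F c) = c) -> norm_equivalence N p mu W.
Proof.
move=> FD GE WF GF; have [D0 FD' _] := FD; have [E0 GE' _] := GE.
exists E^-1, D; split; [by rewrite invr_gt0|exact: D0|] => x Nx.
have [M [NM xM]] := N_fin Nx; have h := FD' _ _ xM.
rewrite WF//; split; last by rewrite NM -EFinM; exact: lpb_norm.
have [|m [-> hm]] := @lpb_finite R p p1 mu mu_gt0 (F (kap x)).
  by apply/(lp_spaceP p1 mu_gt0); exists (D * M).
have := GE' _ _ hm; rewrite (GF _ _ xM) => /N_le; rewrite NM -EFinM !lee_fin.
by rewrite ler_pdivrMl.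
Qed.

(** In coordinates every conclusion is a statement about the four bounded operators [FA], [FB],
    [FAd], [FBd], linked by identities extended from unit sequences. The set [dom] consists of
    coefficient sequences whose synthesis series converge in [V], which may be fewer than all of
    l^p_mu. *)
Lemma items_coords :
  [/\ analysis_bounded N p mu U,
      synthesis_bounded N p mu dom e,
      frame_operator_invertible N U e,
      frame_expansions N U Ud e d &
      norm_equivalence N p mu U /\ norm_equivalence N p mu Ud].
Proof.
have UE x : (N x < +oo)%E -> U x = FA (kap x) by move/U_kap => [].
have UdE x : (N x < +oo)%E -> Ud x = FAd (kap x) by move/Ud_kap => [].
have [A0 bA' _] := bA; have [B0 bB' _] := bB.
have [Ad0 bAd' _] := bAd; have [Bd0 bBd' _] := bBd.
split.
- exact: analysis_bounded_coords bA UE.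
- exists DB => c dc; have [M [cE cM]] := lpb_finite p1 mu_gt0 (dom_lp dc).
  have [cv kE] := synthesis_kap (synth_e dc).
  have h : lpb (kap (synthesis e c)) (DB * M) by rewrite kE; exact: bB'.
  split=> //; [exact: (N_cvg_synthesis bB e_kap cM kE idb)|exact: N_lty h|].
  by rewrite cE -EFinM; exact: N_le.
- have SE x : (N x < +oo)%E -> kap (synthesis e (U x)) = FB (FA (kap x)).
    move=> Nx; have [dU UE'] := U_kap Nx.
    by have [_ ->] := synthesis_kap (synth_e dU); rewrite UE'.
  split.
  + split.
    * move=> x /= Nx; have [M [_ xM]] := N_fin Nx.
      by apply: (N_lty (M := DB * (DA * M))); rewrite SE//; exact/bB'/bA'.
    * move=> x y; rewrite !inE /= => Nx Ny Sxy.
      have [M [_ xM]] := N_fin Nx; have [M' [_ yM]] := N_fin Ny.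
      apply: kap_eq; rewrite -(inv1' xM) -(inv1' yM).
      by rewrite -(SE _ Nx) -(SE _ Ny) Sxy.
    (* The preimage is [S^-1 y], realized as the frame operator of the dual frame applied to [y]. *)
    * move=> y /= Ny; have [M [_ yM]] := N_fin Ny; have [dU UdE'] := Ud_kap Ny.
      have [_ kE] := synthesis_kap (synth_d dU).
      have xN : (N (synthesis d (Ud y)) < +oo)%E.
        by apply: (N_lty (M := DBd * (DAd * M))); rewrite kE UdE'; exact/bBd'/bAd'.
      exists (synthesis d (Ud y)) => //.
      by apply: kap_eq; rewrite SE// kE UdE' (inv2' yM).
  + exists (DB * DA) => x Nx; have [M [NM xM]] := N_fin Nx.
    by rewrite NM -EFinM -mulrA; apply: N_le; rewrite SE//; exact/bB'/bA'.
  + exists (DBd * DAd) => x Nx; have [M [NM xM]] := N_fin Nx.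
    have h : lpb (kap (synthesis e (U x))) (DB * (DA * M)) by rewrite SE//; exact/bB'/bA'.
    have [m [-> mM]] := N_fin (N_lty h).
    rewrite -EFinM -mulrA; apply: N_le; rewrite -(inv1' xM) -(SE _ Nx).
    exact/bBd'/bAd'.
  + move=> x Nx s sb; have [M [_ xM]] := N_fin Nx.
    apply: (N_cvg_synthesis bB e_kap (M := DA * M)) => //; first by rewrite UE//; exact: bA'.
    by rewrite SE// UE.
- move=> x Nx; have [M [_ xM]] := N_fin Nx; split=> s sb.
    apply: (N_cvg_synthesis bBd d_kap (M := DA * M)) => //; rewrite UE//; first exact: bA'.
    by rewrite (BdA' xM).
  apply: (N_cvg_synthesis bB e_kap (M := DAd * M)) => //; rewrite UdE//; first exact: bAd'.
  by rewrite (BAd' xM).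
- split; first exact: (norm_equivalence_coords bA bBd UE BdA').
  exact: (norm_equivalence_coords bAd bB UdE BAd').
Qed.

End Coordinates.
End ItemsTheorem.

(** * Coordinatewise limits in weighted l^p *)

Section LpLimits.
Context {R : realType}.
Variables (p : R) (p1 : 1 <= p) (mu : R -> R) (mu_gt0 : forall n : nat, 0 < mu n.+1%:R).
Implicit Types (b : nat -> R) (c : nat -> R[i]).

Let p0 : 0 < p. Proof. by rewrite (lt_le_trans ltr01). Qed.

Lemma lple_sumP b M : 0 <= M ->
  lple p b M <-> forall L, (\sum_(0 <= n < L) b n `^ p) `^ p^-1 <= M.
Proof.
move=> M0; have s0 L : 0 <= \sum_(0 <= n < L) b n `^ p.
  by apply: sumr_ge0 => n _; exact: powR_ge0.
split=> h L.
  have := h L; rewrite -[X in X <= _ -> _](powRr1 (s0 L)) -(mulVf (lt0r_neq0 p0)) powRrM.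
  by move/(powR_le_inv p1); apply=> //; exact: powR_ge0.
have /(@ge0_ler_powR R p (ltW p0)) := h L; rewrite !nnegrE powR_ge0 M0.
by rewrite -powRrM mulVf ?gt_eqF// powRr1//; exact.
Qed.

Lemma lple_inf b M : 0 <= M -> (forall eps, 0 < eps -> lple p b (M + eps)) -> lple p b M.
Proof.
move=> M0 h; apply/lple_sumP => // L; apply/ler_addgt0Pr => eps e0.
have Me : 0 <= M + eps by lra.
exact: (lple_sumP b Me).1 (h _ e0) L.
Qed.

Lemma lple_indicator L : lple p (fun n => if (n < L)%N then 1 else 0) L%:R.
Proof.
move=> K; case: L => [|L].
  by rewrite big1 ?powR_ge0// => n _; rewrite ltn0 powR0// gt_eqF.
apply: le_trans (_ : L.+1%:R <= _); last by apply: le1r_powR => //; rewrite ler1n.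
apply: le_trans (_ : \sum_(0 <= n < maxn K L.+1) (if (n < L.+1)%N then 1 else 0) <= _).
  rewrite [leRHS](@big_cat_nat _ _ _ K) ?leq_maxl//=.
  apply: le_trans (_ : \sum_(0 <= n < K) (if (n < L.+1)%N then 1 else 0) <= _).
    by apply: ler_sum => n _; case: ifP; rewrite ?powR1// powR0// gt_eqF.
  by rewrite lerDl sumr_ge0// => n _; case: ifP.
rewrite (@big_cat_nat _ _ _ L.+1) ?leq_maxr//= [X in _ + X]big_nat [X in _ + X]big1 ?addr0.
  apply: le_trans (_ : \sum_(0 <= n < L.+1) 1 <= _); last by rewrite sumr_const_nat subn0.
  by apply: ler_sum => n _; case: ifP.
by move=> n /andP[Ln _]; rewrite ltnNge Ln.
Qed.

(** A Fatou property. Only [L] coordinates enter a partial sum; on them some [u j] is uniformly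
    within [d] of [c] in weighted modulus, and by Minkowski the error adds at most [d L <= eps]. *)
Lemma lpb_fatou (u : nat -> nat -> R[i]) c M J : 0 <= M ->
  (forall n, tends (fun j => u j n) (c n)) -> (forall j, (J <= j)%N -> lpb p mu (u j) M) ->
  lpb p mu c M.
Proof.
have mu_ge0 n : 0 <= mu n.+1%:R by exact: ltW.
move=> M0 uc uM; split=> // L.
pose b n := if (n < L)%N then wabs mu c n else 0.
have b0 n : 0 <= b n by rewrite /b; case: ifP => // _; exact: wabs_ge0.
suff h : lple p b M.
  apply: le_trans (h L); apply: ler_sum_nat => n /andP[_ nL].
  by rewrite /b nL.
apply: lple_inf => // eps e0.
pose d := eps / L.+1%:R; have d0 : 0 < d by rewrite divr_gt0.
have [J' HJ'] : exists J', forall j n, (J' <= j)%N -> (n < L)%N ->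
    rnorm (u j n - c n) * mu n.+1%:R <= d.
  elim: (L) => [|L' [J1 H1]]; first by exists 0%N.
  have [J2 H2] := uc L' (d / mu L'.+1%:R) (divr_gt0 d0 (mu_gt0 L')).
  exists (maxn J1 J2) => j n; rewrite geq_max => /andP[j1 j2].
  rewrite ltnS leq_eqVlt => /predU1P[->|]; last exact: H1.
  by rewrite -ler_pdivlMr//; exact: H2.
pose j := maxn J J'.
have [_ hj] := uM j (leq_maxl _ _).
have hi : lple p (fun n => d * (if (n < L)%N then 1 else 0)) (d * L%:R).
  by apply: lpleZ (lple_indicator L); rewrite ?(ltW d0)// => n; case: ifP.
have dL : 0 <= d * L%:R by rewrite mulr_ge0// ltW.
have := lpleD p1 (wabs_ge0 mu_ge0 (u j)) _ M0 dL hj hi => h.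
apply: (@lple_leM _ p p1 _ (M + d * L%:R)); first exact: addr_ge0.
  rewrite lerD2l /d mulrAC ler_pdivrMr// ler_wpM2l ?(ltW e0)// ler_nat; exact: leqnSn.
apply: (lple_mono p1) (h _) => n; last by rewrite mulr_ge0 ?(ltW d0)//; case: ifP.
rewrite b0/= /b; case: ifP => nL; last by rewrite mulr0 addr0 wabs_ge0.
have := HJ' j n (leq_maxr _ _) nL; rewrite mulr1 => hd.
apply: le_trans (lerD (lexx _) hd); rewrite /wabs -mulrDl ler_wpM2r//.
by have := rnorm_sub_ge (c n) (u j n); rewrite rnorm_dist; lra.
Qed.

End LpLimits.

(** * The space HG and its completions *)

Section Instances.
Context {R : realType} {H : completeNormedModType R[i]}.
Variable dot : {dot H for Num.conj}.
Hypothesis dotE : forall x : H, `|x| ^+ 2 = dot x x.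
Variables (g : nat -> H) (rieszG : riesz_basis dot g) (e : nat -> H) (frameE : frame dot e).
Variables (mu : R -> R) (mu_gt0 : forall n : nat, 0 < mu n.+1%:R).
Variable dec : (nat -> nat -> R) -> Prop.
Hypothesis decA : decay_algebra dec.
Hypothesis dec_schur : forall A, (forall m n, 0 <= A m n) -> dec A ->
  exists2 D, 0 < D & schur_bounded (fun n => mu n.+1%:R) A D.
Variables (p : R) (p1 : 1 <= p).

Local Notation gd := (canonical_dual dot g).
Local Notation ed := (canonical_dual dot e).
Local Notation kappa := (analysis dot gd).
Local Notation lpb := (lpb p mu).
Local Notation lp_operator := (lp_operator p mu).
Let mu_ge0 n : 0 <= mu n.+1%:R. Proof. exact: ltW. Qed.

Definition analysis_mx (v : nat -> H) m n : R[i] := dot (g n) (v m).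
Definition synthesis_mx (v : nat -> H) m n : R[i] := dot (v n) (gd m).

Lemma analysis_mxE (v : nat -> H) f : mact (analysis_mx v) (kappa f) = analysis dot v f.
Proof.
apply/funext => m; apply: mactE.
have := tends_functional (riesz_expansion dotE rieszG f)
  (phi := fun x => dot x (v m)) (C := rnorm (v m)).
have -> : (fun n => analysis_mx v m n * kappa f n) = (fun n => dot f (gd n) * dot (g n) (v m)).
  by apply/funext => n; rewrite mulrC.
by apply=> [a x y|x]; [rewrite dotDl dotZl|rewrite mulrC; exact: cauchy_schwarz].
Qed.

Lemma synthesis_mxE (v : nat -> H) c x : tends (series (fun n => c n *: v n)) x ->
  mact (synthesis_mx v) c = kappa x.
Proof.
move=> cx; apply/funext => m; apply: mactE.
have := tends_functional cx (phi := fun x => dot x (gd m)) (C := rnorm (gd m)).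
have -> : (fun n => synthesis_mx v m n * c n) = (fun n => c n * dot (v n) (gd m)).
  by apply/funext => n; rewrite mulrC.
by apply=> [a z y|z]; [rewrite dotDl dotZl|rewrite mulrC; exact: cauchy_schwarz].
Qed.

(** The bridge between H and l^p_mu: an identity valid on H holds on unit sequences, whatever the
    relation of l^p_mu to l^2. *)
Lemma delta_kappa n : delta n = kappa (g n) :> (nat -> R[i]).
Proof. by apply/funext => m; rewrite /analysis (riesz_biorthogonal dotE rieszG) eq_sym. Qed.

Lemma tends_delta (W : normedModType R[i]) (v : nat -> W) n :
  tends (series (fun k => delta n k *: v k)) (v n).
Proof.
move=> eps e0; exists n.+1 => k nk; rewrite /series/=.
rewrite (bigD1_seq n) ?mem_index_iota ?iota_uniq//= /delta eqxx scale1r big1 ?addr0.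
  by rewrite subrr rnorm0 ltW.
by move=> j /negbTE ->; rewrite scale0r.
Qed.

Lemma synthesis_mx_delta (v : nat -> H) n : kappa (v n) = mact (synthesis_mx v) (delta n).
Proof. by rewrite (synthesis_mxE (tends_delta v n)). Qed.

Lemma lp_operator_analysis (v : nat -> H) : dec (fun m n => rnorm (dot (v m) (g n))) ->
  exists D, lp_operator (mact (analysis_mx v)) D.
Proof.
move=> dv; have [|D D0 hD] := dec_schur _ dv; first by move=> m n; exact: rnorm_ge0.
exists D; apply: lp_operator_mact => //.
have -> // : (fun m n => rnorm (analysis_mx v m n)) = (fun m n => rnorm (dot (v m) (g n))).
by apply/funext => m; apply/funext => n; rewrite rnorm_dotC.
Qed.

Lemma lp_operator_synthesis (v : nat -> H) : dec (fun m n => rnorm (dot (v m) (gd n))) ->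
  exists D, lp_operator (mact (synthesis_mx v)) D.
Proof.
move=> dv; have [|D D0 hD] := dec_schur _ (decay_tr decA dv).
  by move=> m n; exact: rnorm_ge0.
by exists D; apply: lp_operator_mact.
Qed.

Lemma lp2_energy c : lp_space 2 (cst (1 : R)) c <-> exists D, sums_le (energy c) D.
Proof.
have one_gt0 (n : nat) : 0 < cst (1 : R) (n.+1%:R : R) by [].
have le12 : 1 <= 2%:R :> R by rewrite ler1n.
have E n : wabs (cst (1 : R)) c n `^ 2 = energy c n.
  by rewrite /wabs mulr1 powR_mulrn ?rnorm_ge0.
split=> [/(lp_spaceP le12 one_gt0)[M [M0 h]]|[D h]].
  by exists (M `^ 2) => L; under eq_bigr do rewrite -E; exact: h.
have D0 := sums_le_ge0 h.
apply/(lp_spaceP le12 one_gt0); exists (Num.sqrt D); split; first exact: sqrtr_ge0.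
by move=> L; under eq_bigr do rewrite E; rewrite powR_mulrn ?sqrtr_ge0// sqr_sqrtr.
Qed.

Section WithOperators.
Variables (DA DB DAd DBd : R).
Hypotheses (bA : lp_operator (mact (analysis_mx e)) DA) (bB : lp_operator (mact (synthesis_mx e)) DB)
  (bAd : lp_operator (mact (analysis_mx ed)) DAd) (bBd : lp_operator (mact (synthesis_mx ed)) DBd).

Let FA := mact (analysis_mx e).
Let FB := mact (synthesis_mx e).
Let FAd := mact (analysis_mx ed).
Let FBd := mact (synthesis_mx ed).

(** Each identity is one in H evaluated at [g n]: the two frame expansions and
    [S^-1 S = S S^-1 = 1], where dual analysis is analysis after [S^-1]. *)
Lemma synth_analysis_delta n :
  [/\ FBd (FA (delta n)) = delta n, FB (FAd (delta n)) = delta n,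
      FBd (FAd (FB (FA (delta n)))) = delta n & FB (FA (FBd (FAd (delta n)))) = delta n].
Proof.
have [A [B [A0 B0 eB eA]]] := frame_bounds frameE.
have ex1 f : FBd (analysis dot e f) = kappa f.
  exact: synthesis_mxE (dual_frame_expansion dotE A0 B0 eB eA f).
have ex2 f : FB (analysis dot ed f) = kappa f.
  exact: synthesis_mxE (frame_expansion dotE A0 B0 eB eA f).
have S1 f : FB (analysis dot e f) = kappa (frame_operator dot e f).
  exact: synthesis_mxE (frame_operator_tends dotE B0 eB f).
have Ud f : analysis dot ed f = analysis dot e (frame_inverse dot e f).
  by apply/funext => k; rewrite /analysis (dot_dual dotE A0 B0 eB eA).
rewrite delta_kappa /FA /FAd !analysis_mxE; split=> //.
  rewrite S1 analysis_mxE Ud (frame_operatorK dotE A0 B0 eB eA); exact: ex1.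
by rewrite Ud ex1 analysis_mxE S1 (frame_inverseK dotE A0 B0 eB eA).
Qed.

Let N := HG_norm dot g p mu.

(** Here the coordinates are those given by G. The Bessel bounds put analysis sequences in l^2, and
    membership in l^2 makes synthesis series converge in H. *)
Lemma HG_items :
  [/\ analysis_bounded N p mu (analysis dot e),
      synthesis_bounded N p mu (lp_space p mu `&` lp_space 2 (cst 1)) e,
      frame_operator_invertible N (analysis dot e) e,
      frame_expansions N (analysis dot e) (analysis dot ed) e ed &
      norm_equivalence N p mu (analysis dot e) /\ norm_equivalence N p mu (analysis dot ed)].
Proof.
have [A [B [A0 B0 eB eA]]] := frame_bounds frameE.
have [Bd Bd0 edB] := bessel_dual dotE A0 B0 eB eA.
have l2 (v : nat -> H) D x : bessel dot v D -> lp_space 2 (cst 1) (analysis dot v x).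
  by move=> vD; apply/lp2_energy; exists (D * rnorm x ^+ 2); exact: vD.
have Nlp x : (N x < +oo)%E -> exists M, lpb (kappa x) M.
  by move/(lpb_finite p1 mu_gt0) => [M [_ h]]; exists M.
have synth (v : nat -> H) D c : 0 < D -> bessel dot v D ->
    (lp_space p mu `&` lp_space 2 (cst 1)) c ->
    exists2 x, tends (series (fun n => c n *: v n)) x & kappa x = mact (synthesis_mx v) c.
  move=> D0 vD [_ /lp2_energy[E cE]].
  have [x cx] := synth_cvg (ltW D0) (bessel_synth dotE D0 vD) cE.
  by exists x => //; rewrite (synthesis_mxE cx).
have an (v : nat -> H) D E : bessel dot v D -> lp_operator (mact (analysis_mx v)) E ->
    forall x, (N x < +oo)%E -> (lp_space p mu `&` lp_space 2 (cst 1)) (analysis dot v x) /\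
    analysis dot v x = mact (analysis_mx v) (kappa x).
  move=> vD [_ vE _] x /Nlp[M xM]; split; last by rewrite analysis_mxE.
  split; last exact: l2 vD.
  by apply/(lp_spaceP p1 mu_gt0); exists (E * M); rewrite -analysis_mxE; exact: vE.
apply: (items_coords p1 mu_gt0 (kap := kappa) _ _ _ bA bB bAd bBd).
- by move=> a x y n; rewrite /analysis dotDl dotZl.
- by [].
- by move=> x h; apply: (riesz_inj dotE rieszG).
- exact: an eB bA.
- exact: an edB bAd.
- by move=> c [].
- by move=> n; exact: synthesis_mx_delta.
- by move=> n; exact: synthesis_mx_delta.
- by move=> c; exact: synth eB.
- by move=> c; exact: synth edB.
- by move=> n; case: (synth_analysis_delta n) => h1 h2 h3 h4; exact: h1.
- by move=> n; case: (synth_analysis_delta n) => h1 h2 h3 h4; exact: h2.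
- by move=> n; case: (synth_analysis_delta n) => h1 h2 h3 h4; exact: h3.
- by move=> n; case: (synth_analysis_delta n) => h1 h2 h3 h4; exact: h4.
Qed.

Lemma HG_lpb f : HG dot g p mu f <-> exists M, lpb (kappa f) M.
Proof. exact: (lp_spaceP p1 mu_gt0). Qed.

Lemma HG_mem (v : nat -> H) D n : lp_operator (mact (synthesis_mx v)) D -> HG dot g p mu (v n).
Proof.
move=> [_ vD _]; have [M hM] := lpb_delta p1 mu_gt0 n.
by apply/HG_lpb; exists (D * M); rewrite synthesis_mx_delta; exact: vD.
Qed.

Section Completion.
Variables (X : completeNormedModType R[i]) (iota : H -> X).
Hypothesis compX : HG_completion dot g p mu iota.
Local Notation HG := (HG dot g p mu).

Lemma HG_lin a f h : HG f -> HG h -> HG (a *: f + h).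
Proof.
move=> /HG_lpb[M fM] /HG_lpb[M' hM]; apply/HG_lpb; exists (rnorm a * M + M').
have -> : kappa (a *: f + h) = fun n => a * kappa f n + kappa h n.
  by apply/funext => n; rewrite /analysis dotDl dotZl.
by apply: (lpbD p1 mu_gt0) => //; exact: (lpbZ mu_gt0).
Qed.

Lemma iota_lpb f : HG f -> lpb (kappa f) (rnorm (iota f)).
Proof.
move=> hf; have [_ iso _] := compX; have [M [E h]] := lpb_finite p1 mu_gt0 hf.
by have := iso f hf; rewrite /HG_norm E => -[->].
Qed.

Lemma iota_le f M : HG f -> lpb (kappa f) M -> rnorm (iota f) <= M.
Proof.
move=> hf hM; have [_ iso _] := compX.
by rewrite -lee_fin (iso f hf); exact: (lpb_norm p1 mu_gt0).
Qed.

Lemma HGB f h : HG f -> HG h -> HG (f - h).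
Proof. by move=> hf hh; rewrite addrC -scaleN1r; exact: HG_lin. Qed.

Lemma iotaB f h : HG f -> HG h -> iota (f - h) = iota f - iota h.
Proof.
move=> hf hh; have [lin _ _] := compX.
by rewrite addrC -scaleN1r lin// scaleN1r addrC.
Qed.

Lemma HG_dense x : exists f : nat -> H, (forall j, HG (f j)) /\ tends (iota \o f) x.
Proof.
have [_ _ dX] := compX.
have /choice[f fP] : forall j : nat, exists f, HG f /\ rnorm (iota f - x) <= j.+1%:R^-1.
  move=> j; have j0 : 0 < ((j.+1%:R^-1)%:C)%C :> R[i] by rewrite ltcR invr_gt0.
  have [|z [/= xb [f hf fz]]] := dX (ball x ((j.+1%:R^-1)%:C)%C) _ (ball_open x _).
    by exists x; exact: ballxx.
  rewrite -fz in xb; exists f; split=> //; rewrite rnorm_dist -le_rnorm.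
  by move: xb; rewrite -ball_normE => /ltW.
exists f; split=> [j|eps e0]; first by have [] := fP j.
exists (Num.bound eps^-1) => j hj; apply: le_trans (fP j).2 _.
rewrite invf_ple ?posrE//; apply: ltW; apply: lt_le_trans (archi_boundP _) _.
  by rewrite invr_ge0 ltW.
by rewrite ler_nat ltnW.
Qed.

(** The continuous extension of the G-coordinates to the completion, as a limit along some
    approximating sequence; [coords_tends] shows that the choice of sequence does not matter. *)
Definition coords x n : R[i] := xget 0 [set s | exists f : nat -> H,
  [/\ forall j, HG (f j), tends (iota \o f) x & tends (fun j => dot (f j) (gd n)) s]].

Lemma iota_entry f n : HG f -> rnorm (dot f (gd n)) <= rnorm (iota f) / mu n.+1%:R.
Proof. by move=> /iota_lpb h; rewrite ler_pdivlMr//; exact: (lpb_entry p1 mu_gt0 n h). Qed.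

(** On HG the [n]-th coordinate is Lipschitz with constant [1 / mu (n + 1)] for the norm of HG, so
    it maps Cauchy sequences to Cauchy sequences and cannot separate two sequences with the same
    limit. *)
Lemma coords_tends x (f : nat -> H) n : (forall j, HG (f j)) -> tends (iota \o f) x ->
  tends (fun j => dot (f j) (gd n)) (coords x n).
Proof.
move=> hf fx; have mi : 0 <= (mu n.+1%:R)^-1 by rewrite invr_ge0.
have [s fs] : exists s, tends (fun j => dot (f j) (gd n)) s.
  apply: rcauchy_complex; apply: (rcauchy_lip mi) (tends_rcauchy fx) => j k.
  by rewrite -dotBl /= -iotaB// mulrC; apply: iota_entry; exact: HGB.
suff -> : coords x n = s by [].
rewrite /coords; case: xgetP => [t _ [h [hh hx ht]]|/(_ s)]; last first.
  by move=> hn; exfalso; apply: hn; exists f.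
apply: tends_unique ht _.
have d0 : tends (fun j => dot (h j - f j) (gd n)) 0.
  have := tendsD hx (tendsZ (-1) fx); rewrite scaleN1r subrr => d.
  apply: (tends_lip mi (N := 0%N)) d => j _; rewrite !subr0 scaleN1r mulrC /= -iotaB//.
  by apply: iota_entry; exact: HGB.
have := tendsD d0 fs; rewrite add0r; congr tends; apply/funext => j.
by rewrite dotBl subrK.
Qed.

Lemma coords_lin a x y n : coords (a *: x + y) n = a * coords x n + coords y n.
Proof.
have [f [hf fx]] := HG_dense x; have [h [hh hy]] := HG_dense y.
have [lin _ _] := compX.
have hfh j : HG (a *: f j + h j) by exact: HG_lin.
have t : tends (iota \o (fun j => a *: f j + h j)) (a *: x + y).
  have := tendsD (tendsZ a fx) hy; congr tends; apply/funext => j /=.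
  by rewrite lin.
apply: tends_unique (coords_tends n hfh t) _.
have := tendsD (tendsZ (V := R[i]^o) a (coords_tends n hf fx)) (coords_tends n hh hy).
by congr tends; apply/funext => j; rewrite dotDl dotZl.
Qed.

Lemma coords_iota f : HG f -> coords (iota f) = kappa f.
Proof.
move=> hf; apply/funext => n.
exact: tends_unique (coords_tends n (fun=> hf) (tends_cst _)) (tends_cst _).
Qed.

Lemma coords_lpb x : lpb (coords x) (rnorm x).
Proof.
have [f [hf fx]] := HG_dense x.
have h eps : 0 < eps -> lpb (coords x) (rnorm x + eps).
  move=> e0; have [J HJ] := fx _ e0.
  apply: (lpb_fatou p1 mu_gt0 (u := fun j => kappa (f j)) (J := J)).
  - by rewrite addr_ge0 ?rnorm_ge0// ltW.
  - by move=> n; exact: coords_tends.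
  move=> j Jj; apply: (lpb_le p1 _ (iota_lpb (hf j))).
  have := HJ j Jj; have := rnorm_sub_ge (iota (f j)) x => /=; lra.
split; first exact: rnorm_ge0.
by apply: (lple_inf p1 (rnorm_ge0 x)) => eps /h[].
Qed.

(** With [coords_lpb] this makes [coords] an isometry. Compare [x] with a nearby [iota f], where the
    norms agree by definition; the coordinates of the difference are controlled by [coords_lpb]. *)
Lemma coords_norm x M : lpb (coords x) M -> rnorm x <= M.
Proof.
move=> xM; apply/ler_addgt0Pr => eps e0; have e2 : 0 < eps / 2 by rewrite divr_gt0.
have [f [hf fx]] := HG_dense x; have [J /(_ J (leqnn J)) /= HJ] := fx _ e2.
have fM : lpb (kappa (f J)) (M + rnorm (iota (f J) - x)).
  rewrite -coords_iota//.
  have -> : coords (iota (f J)) = fun n => coords x n + coords (iota (f J) - x) n.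
    apply/funext => n; rewrite -[X in coords X n](subrK x) -[X in coords (X + _) n]scale1r.
    by rewrite coords_lin mul1r addrC.
  by apply: (lpbD p1 mu_gt0) => //; exact: coords_lpb.
have := iota_le (hf J) fM; have := rnorm_sub_ge x (iota (f J)).
by rewrite rnorm_dist; lra.
Qed.

(** The partial sums are Cauchy in X because their coordinates are Cauchy in l^p_mu and [coords] is
    isometric; completeness of X replaces the l^2 condition needed in H. *)
Lemma coords_synth (v : nat -> X) F D c : lp_operator F D -> (forall n, coords (v n) = F (delta n)) ->
  lp_space p mu c ->
  exists2 x, tends (series (fun n => c n *: v n)) x & coords x = F c.
Proof.
move=> FD vF /(lp_spaceP p1 mu_gt0)[M cM]; have [D0 FD' _] := FD.
have idb : bijective (id : nat -> nat) by exists id.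
have cs K : coords (series (fun n => c n *: v n) K) = F (partial id K c).
  exact: (kap_series p1 mu_gt0 coords_lin id c K FD vF).
have h eps : 0 < eps -> exists K0, forall K, (K0 <= K)%N ->
    lpb (fun n => F (partial id K c) n - F c n) eps.
  move=> e0; have [K0 HK] := partial_cvg p1 mu_gt0 idb cM (divr_gt0 e0 D0).
  exists K0 => K /HK /FD'; rewrite mulrCA mulfV ?gt_eqF// mulr1.
  have [M' hM'] := lpb_partial p1 mu_gt0 id K c.
  by rewrite (lp_operatorB FD hM' cM).
have [x cx] : exists x, tends (series (fun n => c n *: v n)) x.
  apply: rcauchy_cvg => eps e0; have e2 : 0 < eps / 2 by rewrite divr_gt0.
  have [K0 HK] := h _ e2; exists K0 => m n mK nK.
  apply: coords_norm; rewrite (kapB coords_lin) !cs.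
  have -> : eps = eps / 2 + rnorm (-1 : R[i]) * (eps / 2) by rewrite rnormN rnorm1; lra.
  have := lpbD p1 mu_gt0 (HK _ mK) (lpbZ mu_gt0 (-1) (HK _ nK)).
  rewrite (_ : (fun k => _) = fun k => F (partial id m c) k - F (partial id n c) k)//.
  by apply/funext => k; ring.
exists x => //; apply/funext => n.
have t1 : tends (fun K => coords (series (fun n => c n *: v n) K) n) (coords x n).
  have mi : 0 <= (mu n.+1%:R)^-1 by rewrite invr_ge0.
  apply: (tends_lip mi (N := 0%N)) cx => K _.
  rewrite mulrC ler_pdivlMr//.
  have := lpb_entry p1 mu_gt0 n (coords_lpb (series (fun n => c n *: v n) K - x)).
  by rewrite (kapB coords_lin).
apply: tends_unique t1 _ => eps e0.
have [K0 HK] := h _ (mulr_gt0 e0 (mu_gt0 n)); exists K0 => K /HK hK.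
rewrite cs -(ler_pM2r (mu_gt0 n)); exact: (lpb_entry p1 mu_gt0 n hK).
Qed.

Let NX (x : X) := (rnorm x)%:E.

(** The extended analysis operators are the analysis matrices acting on [coords], and every sequence
    of l^p_mu is now admissible for synthesis. *)
Lemma completion_items :
  (forall n, HG (e n) /\ HG (ed n)) /\
  exists U Ud : X -> nat -> R[i],
    [/\ analysis_extension dot g p mu iota e U,
        analysis_extension dot g p mu iota ed Ud &
    [/\ analysis_bounded NX p mu U,
        synthesis_bounded NX p mu (lp_space p mu) (iota \o e),
        frame_operator_invertible NX U (iota \o e),
        frame_expansions NX U Ud (iota \o e) (iota \o ed) &
        norm_equivalence NX p mu U /\ norm_equivalence NX p mu Ud]].
Proof.
have HGe n : HG (e n) by exact: HG_mem bB.
have HGed n : HG (ed n) by exact: HG_mem bBd.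
split=> [n|]; first by split.
exists (fun x => FA (coords x)), (fun x => FAd (coords x)).
have ext (v : nat -> H) E : lp_operator (mact (analysis_mx v)) E ->
    analysis_extension dot g p mu iota v (fun x => mact (analysis_mx v) (coords x)).
  move=> [_ _ vl]; split=> [a x y n|f hf]; last by rewrite coords_iota// analysis_mxE.
  have -> : coords (a *: x + y) = fun n => a * coords x n + coords y n.
    by apply/funext => k; rewrite coords_lin.
  by rewrite (vl _ _ _ _ _ (coords_lpb x) (coords_lpb y)).
have an F D x : lp_operator F D -> lp_space p mu (F (coords x)).
  move=> [_ FD _]; apply/(lp_spaceP p1 mu_gt0); exists (D * rnorm x).
  exact/FD/coords_lpb.
have ekap n : coords (iota (e n)) = FB (delta n) by rewrite coords_iota// synthesis_mx_delta.
have edkap n : coords (iota (ed n)) = FBd (delta n) by rewrite coords_iota// synthesis_mx_delta.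
split; [exact: ext bA|exact: ext bAd|].
apply: (items_coords p1 mu_gt0 (kap := coords) coords_lin _ _ bA bB bAd bBd).
- move=> x; have [|M [E xM]] := @lpb_finite R p p1 mu mu_gt0 (coords x).
    by apply/(lp_spaceP p1 mu_gt0); exists (rnorm x); exact: coords_lpb.
  rewrite E /NX; congr (_%:E); apply/le_anti; rewrite coords_norm//=.
  by rewrite -lee_fin -E; exact: (lpb_norm p1 mu_gt0 (coords_lpb x)).
- move=> x h; apply: rnorm_eq0; apply: coords_norm.
  have -> : coords x = fun=> 0 by apply/funext.
  exact: lpb0.
- by move=> x _; split=> //; exact: an bA.
- by move=> x _; split=> //; exact: an bAd.
- by [].
- exact: ekap.
- exact: edkap.
- by move=> c; exact: coords_synth bB ekap.
- by move=> c; exact: coords_synth bBd edkap.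
- by move=> n; case: (synth_analysis_delta n) => h1 h2 h3 h4; exact: h1.
- by move=> n; case: (synth_analysis_delta n) => h1 h2 h3 h4; exact: h2.
- by move=> n; case: (synth_analysis_delta n) => h1 h2 h3 h4; exact: h3.
- by move=> n; case: (synth_analysis_delta n) => h1 h2 h3 h4; exact: h4.
Qed.

End Completion.
End WithOperators.
End Instances.

(** * Localization as membership in a decay class *)

Section Localization.
Context {R : realType} {H : completeNormedModType R[i]}.
Variable dot : {dot H for Num.conj}.
Implicit Types (w : R -> R) (e g : nat -> H).

Lemma localized_dominated w e g : localized_by dot w e g ->
  dominated_by w (fun m n => rnorm (dot (e m) (g n))) /\
  dominated_by w (fun m n => rnorm (dot (e m) (canonical_dual dot g n))).
Proof.
by move=> [C C0 h]; split; exists C => m n; have := h m n; rewrite ge_max => /andP[].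
Qed.

Lemma dominated_localized w e g : (forall t, 0 <= t -> 0 <= w t) ->
  dominated_by w (fun m n => rnorm (dot (e m) (g n))) ->
  dominated_by w (fun m n => rnorm (dot (e m) (canonical_dual dot g n))) ->
  localized_by dot w e g.
Proof.
move=> w0 /(dominated_gt0 w0)[C C0 hC] /(dominated_gt0 w0)[D D0 hD].
exists (Num.max C D) => [|m n]; first by rewrite lt_max C0.
have wg : 0 <= w (gap m n) by rewrite w0// gap_ge0.
by rewrite ge_max; apply/andP; split;
  [apply: le_trans (hC m n) _|apply: le_trans (hD m n) _];
  rewrite ler_wpM2r// le_max lexx ?orbT.
Qed.

Lemma subexp_localizedE b e g : subexp_localized dot b e g <->
  exp_decay b (fun m n => rnorm (dot (e m) (g n))) /\
  exp_decay b (fun m n => rnorm (dot (e m) (canonical_dual dot g n))).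
Proof.
split=> [[c c0 /localized_dominated[hC hD]]|[[c c0 hC] [d d0 hD]]].
  by split; exists c.
exists (Num.min c d); first by rewrite lt_min c0.
apply: dominated_localized => [t _||]; first exact: expR_ge0.
  by apply: dominated_wexp hC; rewrite ge_min lexx.
by apply: dominated_wexp hD; rewrite ge_min lexx orbT.
Qed.

(** Makes case (B) the endpoint [b = 1] of the sub-exponential argument. *)
Lemma exp_localizedE e g : exp_localized dot e g <-> subexp_localized dot 1 e g.
Proof.
by split=> -[c c0 [C C0 h]]; exists c => //; exists C => // m n; have := h m n;
  rewrite powRr1.
Qed.

Lemma poly_localizedE s e g : poly_localized dot s e g <->
  poly_decay s (fun m n => rnorm (dot (e m) (g n))) /\
  poly_decay s (fun m n => rnorm (dot (e m) (canonical_dual dot g n))).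
Proof.
split=> [/localized_dominated//|[hC hD]].
by apply: dominated_localized hD => // t _; exact: powR_ge0.
Qed.

End Localization.

Section DualLocalization.
Context {R : realType} {H : completeNormedModType R[i]}.
Variable dot : {dot H for Num.conj}.
Hypothesis dotE : forall x : H, `|x| ^+ 2 = dot x x.
Variables (g : nat -> H) (rieszG : riesz_basis dot g) (e : nat -> H) (frameE : frame dot e).
Variables (mu : R -> R).

Local Notation decays v dec := (dec (fun m n => rnorm (dot (v m) (g n))) /\
  dec (fun m n => rnorm (dot (v m) (canonical_dual dot g n)))).
Local Notation ed := (canonical_dual dot e).

Lemma dual_decay dec : decay_algebra dec -> decays e dec -> decays ed dec.
Proof.
move=> da [dG dGd]; split.
  exact: (dual_decay_basis dotE rieszG frameE da dG dGd).
exact: (dual_decay_dual dotE rieszG frameE da dG dGd).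
Qed.

Lemma subexp_localized_dual b : 0 < b <= 1 -> subexp_localized dot b e g ->
  subexp_localized dot b ed g.
Proof.
move=> b01 /subexp_localizedE h; apply/subexp_localizedE.
exact: dual_decay (exp_decay_algebra b01) h.
Qed.

Lemma poly_localized_dual s : 1 < s -> poly_localized dot s e g ->
  poly_localized dot s ed g.
Proof.
move=> s1 /poly_localizedE h; apply/poly_localizedE.
exact: dual_decay (poly_decay_algebra s1) h.
Qed.

Definition schur_class (dec : (nat -> nat -> R) -> Prop) :=
  forall A : nat -> nat -> R, (forall m n, 0 <= A m n) -> dec A ->
  exists2 D, 0 < D & schur_bounded (fun n => mu n.+1%:R) A D.

(** In each case the exponents leave exactly the room the Schur test needs: [bm < b] in case (A),
    [bm < 1] in case (B), and [1 + eps > 1] after the loss of [k] in case (C). *)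
Lemma localization_class :
  [\/ exists beta : R, subexp_case dot e g mu beta, exp_case dot e g mu |
      exists k eps : R, poly_case dot e g mu k eps] ->
  exists dec, [/\ decay_algebra dec, decays e dec & schur_class dec].
Proof.
case=> [[b [/andP[b0 b1] /subexp_localizedE dh [bm [/andP[bm0 _] bmb smu]]]]|
        [/exp_localizedE/subexp_localizedE dh [bm bm01 smu]]|
        [k [eps [k0 e0 /poly_localizedE dh mmu]]]].
- exists (exp_decay b); split=> //; first by apply: exp_decay_algebra; rewrite b0 ltW.
  move=> A A0 dA; apply: (exp_decay_schur _ (ltW b1) smu A0 dA).
  by rewrite bm0.
- exists (exp_decay 1); split=> //; first by apply: exp_decay_algebra; rewrite ltr01 lexx.
  by move=> A A0 dA; apply: (exp_decay_schur bm01 (lexx 1) smu A0 dA).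
- exists (poly_decay (k + 1 + eps)); split=> //.
    by apply: poly_decay_algebra; rewrite -addrA addrCA ltrDl ltr_wpDl.
  by move=> A A0 dA; exact: (poly_decay_schur k0 e0 mmu A0 dA).
Qed.

End DualLocalization.

(* The conclusions other than the localization of the dual frame are stated
   - on HG, the space of all f in H with coefficients in l^p_mu;
   - on any Banach completion X of HG (X is HG itself when HG is complete, in
     particular when l^p_mu is a subset of l^2).
   When l^p_mu is not a subset of l^2 (which requires p > 2), the series
   sum_n c_n e_n with c in l^p_mu need not converge to an element of HG: take
   E = G orthonormal, mu = 1, p = 4 and c_n = n^(-1/2). This is why the
   boundedness of the synthesis operator is stated on HG for c in
   l^p_mu `&` l^2 (which is l^p_mu as soon as l^p_mu is a subset of l^2), and
   for all c in l^p_mu on the completion. *)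
Theorem theorem5p4 (R : realType) (H : completeNormedModType R[i])
    (dot : {dot H for Num.conj})
    (dotE : forall x : H, `|x| ^+ 2 = dot x x)
    (sepH : separable_space H)
    (g : nat -> H) (rieszG : riesz_basis dot g)
    (e : nat -> H) (frameE : frame dot e)
    (mu : R -> R) (mu_weight : weight mu)
    (mu_ge1 : forall n : nat, 1 <= mu n.+1%:R)
    (cases : [\/ exists beta : R, subexp_case dot e g mu beta,
                 exp_case dot e g mu |
                 exists k eps : R, poly_case dot e g mu k eps]) :
  let ed := canonical_dual dot e in
  (forall p : R, 1 <= p ->
     let N := HG_norm dot g p mu in
     let U := analysis dot e in
     let Ud := analysis dot ed in
     [/\ analysis_bounded N p mu U,
         synthesis_bounded N p mu (lp_space p mu `&` lp_space 2 (cst 1)) e,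
         frame_operator_invertible N U e,
         frame_expansions N U Ud e ed &
         norm_equivalence N p mu U /\ norm_equivalence N p mu Ud]) /\
  (forall p : R, 1 <= p ->
     forall (X : completeNormedModType R[i]) (iota : H -> X),
     HG_completion dot g p mu iota ->
     let N (x : X) := (rnorm x)%:E in
     let eX := iota \o e in
     let edX := iota \o ed in
     (forall n, HG dot g p mu (e n) /\ HG dot g p mu (ed n)) /\
     exists U Ud : X -> nat -> R[i],
       [/\ analysis_extension dot g p mu iota e U,
           analysis_extension dot g p mu iota ed Ud &
       [/\ analysis_bounded N p mu U,
           synthesis_bounded N p mu (lp_space p mu) eX,
           frame_operator_invertible N U eX,
           frame_expansions N U Ud eX edX &
           norm_equivalence N p mu U /\ norm_equivalence N p mu Ud]]) /\
  [/\ forall beta : R, subexp_case dot e g mu beta ->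
        subexp_localized dot beta ed g,
      exp_case dot e g mu -> exp_localized dot ed g &
      forall k eps : R, poly_case dot e g mu k eps ->
        poly_localized dot (k + 1 + eps) ed g].
Proof.
have mu_gt0 n : 0 < mu n.+1%:R by case: mu_weight.
have [dec [da dE sE]] := localization_class cases.
have dEd := dual_decay dotE rieszG frameE da dE.
move=> ed; split.
  move=> p p1.
  have [DA bA] := lp_operator_analysis mu_gt0 sE p1 dE.1.
  have [DB bB] := lp_operator_synthesis mu_gt0 da sE p1 dE.2.
  have [DAd bAd] := lp_operator_analysis mu_gt0 sE p1 dEd.1.
  have [DBd bBd] := lp_operator_synthesis mu_gt0 da sE p1 dEd.2.
  exact: (HG_items dotE rieszG frameE mu_gt0 p1 bA bB bAd bBd).
split.
  move=> p p1 X iota compX.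
  have [DA bA] := lp_operator_analysis mu_gt0 sE p1 dE.1.
  have [DB bB] := lp_operator_synthesis mu_gt0 da sE p1 dE.2.
  have [DAd bAd] := lp_operator_analysis mu_gt0 sE p1 dEd.1.
  have [DBd bBd] := lp_operator_synthesis mu_gt0 da sE p1 dEd.2.
  exact: (completion_items dotE rieszG frameE mu_gt0 p1 bA bB bAd bBd compX).
split.
- move=> beta [/andP[b0 b1] loc _].
  by apply: (subexp_localized_dual dotE rieszG frameE _ loc); rewrite b0 ltW.
- move=> [/exp_localizedE loc _]; apply/exp_localizedE.
  by apply: (subexp_localized_dual dotE rieszG frameE _ loc); rewrite ltr01 lexx.
- move=> k eps [k0 e0 loc _].
  apply: (poly_localized_dual dotE rieszG frameE _ loc).
  by rewrite -addrA addrCA ltrDl ltr_wpDl.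
Qed.
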